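(* Let $d\ge 1$, $\frac{d}{d+1}\le p<1$ and $0<q\le p$. Then $\operatorname{span} \mathscr{H}_d$ is not dense in $B^1_{p,q}(\mathbb{R}^d)$.
   Context: $B^s_{p,q}(\mathbb{R}^d)$ is the usual inhomogeneous Besov space. Haar system: let $h^{(0)}=\mathbf{1}_{[0,1)}$ and $h^{(1)}=\mathbf{1}_{[0,1/2)}-\mathbf{1}_{[1/2,1)}$ on $\mathbb{R}$. For $\epsilon\in\{0,1\}^d$, $k\in\mathbb{N}_0$, $\mu\in\mathbb{Z}^d$ put $h^{\epsilon}_{k,\mu}(x)=\prod_{i=1}^d h^{(\epsilon_i)}(2^kx_i-\mu_i)$. With $\Upsilon=\{0,1\}^d\setminus\{\vec 0\}$, $\mathscr{H}_d=\{h^{\vec 0}_{0,\mu}\}_{\mu\in\mathbb{Z}^d}\cup\{h^{\epsilon}_{k,\mu}: k\in\mathbb{N}_0,\mu\in\mathbb{Z}^d,\epsilon\in\Upsilon\}$. $\operatorname{span}\mathscr{H}_d$ is the vector space of all finite linear combinations of Haar functions. *)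

(* Defs.v *)
From HB Require Import structures.
From mathcomp Require Import all_boot all_order all_algebra.
From mathcomp Require Import all_classical all_reals all_analysis.
From mathcomp Require Import complex.

Set Implicit Arguments.
Unset Strict Implicit.
Unset Printing Implicit Defensive.
Import Order.TTheory GRing.Theory Num.Theory.
Import numFieldNormedType.Exports.

Local Open Scope classical_set_scope.
Local Open Scope ring_scope.
Local Open Scope complex_scope.

(* Lebesgue measure on R^n is built on n.-tuple R by iterating the library's
   product measure: each step transports m1 \x m2 along (x, t) |-> x :: t. *)
Section cons_measure.
Context d (T : measurableType d) (R : realType) (n : nat).
Variables (m1 : {sigma_finite_measure set T -> \bar R})
          (m2 : {sigma_finite_measure set (n.-tuple T) -> \bar R}).
Local Open Scope ereal_scope.

Definition cons_pair (x : T * n.-tuple T) : n.+1.-tuple T :=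
  [tuple of x.1 :: x.2].

Lemma measurable_cons_pair : measurable_fun setT cons_pair.
Proof. exact: measurable_cons measurable_fst measurable_snd. Qed.

Let measurable_cons_preimage A :
  measurable A -> measurable (cons_pair @^-1` A).
Proof.
by move=> mA; rewrite -[X in measurable X]setTI; exact: measurable_cons_pair.
Qed.

Definition cons_measure : set (n.+1.-tuple T) -> \bar R :=
  pushforward (m1 \x m2) cons_pair.

Let cons_measure0 : cons_measure set0 = 0.
Proof. by rewrite /cons_measure /pushforward preimage_set0 measure0. Qed.

Let cons_measure_ge0 A : 0 <= cons_measure A.
Proof. by rewrite /cons_measure /pushforward; exact: measure_ge0. Qed.

Let cons_measure_sigma_additive : semi_sigma_additive cons_measure.
Proof.
move=> F mF tF mUF; rewrite /cons_measure /pushforward preimage_bigcup.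
apply: measure_semi_sigma_additive.
- by move=> i; exact: measurable_cons_preimage.
- apply/trivIsetP => /= i j _ _ ij; rewrite -preimage_setI.
  by move/trivIsetP : tF => /(_ _ _ _ _ ij) ->//; rewrite preimage_set0.
- by rewrite -preimage_bigcup; exact: measurable_cons_preimage.
Qed.

HB.instance Definition _ := isMeasure.Build _ _ _ cons_measure
  cons_measure0 cons_measure_ge0 cons_measure_sigma_additive.

Let product_sigma_finite : sigma_finite setT (m1 \x m2).
Proof.
have /sigma_finiteP[F [TF ndF Foo]] := sigma_finiteT m1.
have /sigma_finiteP[G [TG ndG Goo]] := sigma_finiteT m2.
exists (fun i => F i `*` G i).
  rewrite -setXTT TF TG predeqE => -[x y]; split.
    move=> [/= [i _ Fix] [k _ Gky]]; exists (maxn i k) => //; split.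
    - by move: x Fix; exact/subsetPset/ndF/leq_maxl.
    - by move: y Gky; exact/subsetPset/ndG/leq_maxr.
  by move=> [i _ []/= ? ?]; split; exists i.
move=> k; have [? ?] := Foo k; have [? ?] := Goo k.
split; first exact: measurableX.
by rewrite product_measure1E// lte_mul_pinfty// ge0_fin_numE.
Qed.

Let cons_measure_sigma_finite : sigma_finite setT cons_measure.
Proof.
have [F TF Foo] : sigma_finite setT (m1 \x m2) by exact: product_sigma_finite.
pose g (t : n.+1.-tuple T) := (thead t, [tuple of behead t]).
have gK : cancel cons_pair g.
  by case=> x t; rewrite /g /cons_pair /= theadE; congr pair; exact: val_inj.
have cK : cancel g cons_pair by move=> t; rewrite [RHS]tuple_eta.
have mg : measurable_fun setT g.
  apply/measurable_fun_pair; last exact: measurable_behead.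
  exact: measurable_tnth.
exists (fun i => g @^-1` F i).
  by rewrite -preimage_bigcup -TF preimage_setT.
move=> i; have [mF Fi] := Foo i; split.
  by rewrite -[X in measurable X]setTI; exact: mg.
rewrite /cons_measure /pushforward -comp_preimage.
by rewrite (_ : g \o cons_pair = id)//; apply/funext => x /=; rewrite gK.
Qed.

HB.instance Definition _ := Measure_isSigmaFinite.Build _ _ _ cons_measure
  cons_measure_sigma_finite.

End cons_measure.

Fixpoint lebesgue_tuple (R : realType) (n : nat) :
    {sigma_finite_measure set (n.-tuple (measurableTypeR R)) -> \bar R} :=
  match n with
  | 0%N => \d_ [tuple]
  | m.+1 => cons_measure (@lebesgue_measure R) (lebesgue_tuple R m)
  end.

Section euclidean.
Context (R : realType) (d : nat).
Implicit Types (x y xi : 'rV[R]_d).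

Definition row_of_tuple (t : d.-tuple (measurableTypeR R)) : 'rV[R]_d :=
  \row_i tnth t i.

Definition dotp x y : R := \sum_(i < d) x 0 i * y 0 i.

Definition enorm x : R := Num.sqrt (dotp x x).

Definition cmod (z : R[i]) : R := ComplexField.Normc.normc z.

Definition cintegral (f : 'rV[R]_d -> R[i]) : R[i] :=
  (\int[lebesgue_tuple R d]_t complex.Re (f (row_of_tuple t))) +i*
  (\int[lebesgue_tuple R d]_t complex.Im (f (row_of_tuple t))).

Definition cLnorm (p : \bar R) (f : 'rV[R]_d -> R[i]) : \bar R :=
  Lnorm (lebesgue_tuple R d) p (fun t => (cmod (f (row_of_tuple t)))%:E).

(* Iterated partial derivatives; s lists the directions. *)
Fixpoint pderiv (s : seq 'I_d) (u : 'rV[R]_d -> R) : 'rV[R]_d -> R :=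
  match s with
  | [::] => u
  | i :: s' => fun x => 'D_(delta_mx 0 i) (pderiv s' u) x
  end.

Definition smooth (u : 'rV[R]_d -> R) : Prop :=
  forall s x, differentiable (pderiv s u) x.

Definition cpderiv s (f : 'rV[R]_d -> R[i]) x : R[i] :=
  pderiv s (@complex.Re R \o f) x +i* pderiv s (@complex.Im R \o f) x.

Definition schwartz_norm (N : nat) (f : 'rV[R]_d -> R[i]) : \bar R :=
  ereal_sup [set z | exists s x, (size s <= N)%N /\
    z = ((1 + enorm x) ^+ N * cmod (cpderiv s f x))%:E].

Definition schwartz (f : 'rV[R]_d -> R[i]) : Prop :=
  [/\ smooth (@complex.Re R \o f), smooth (@complex.Im R \o f) &
      forall N, (schwartz_norm N f < +oo)%E].

(* A distribution is represented by a functional on all functions, of which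
   only the values at Schwartz functions matter. *)
Definition functional := ('rV[R]_d -> R[i]) -> R[i].

Definition tempered (T : functional) : Prop :=
  (forall (a : R[i]) f g, schwartz f -> schwartz g ->
     T (fun x => a * f x + g x) = a * T f + T g) /\
  (exists (N : nat) (C : R), forall f, schwartz f ->
     ((cmod (T f))%:E <= C%:E * schwartz_norm N f)%E).

Definition regular_distribution (g : 'rV[R]_d -> R[i]) : functional :=
  fun f => cintegral (fun x => g x * f x).

Definition inverse_fourier (g : 'rV[R]_d -> R[i]) x : R[i] :=
  ((2 * pi) ^- d)%:C *
  cintegral (fun xi => g xi * (cos (dotp x xi) +i* sin (dotp x xi))).

(* Generator of an inhomogeneous dyadic resolution of unity. *)
Definition admissible (phi0 : 'rV[R]_d -> R[i]) : Prop :=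
  [/\ schwartz phi0,
      forall xi, enorm xi <= 1 -> phi0 xi = 1 &
      forall xi, 2 <= enorm xi -> phi0 xi = 0].

Definition dyadic (phi0 : 'rV[R]_d -> R[i]) (k : nat) xi : R[i] :=
  match k with
  | 0%N => phi0 xi
  | j.+1 => phi0 (2 ^- j.+1 *: xi) - phi0 (2 ^- j *: xi)
  end.

(* The inverse Fourier transform of (dyadic phi0 k) times the Fourier transform
   of T, i.e. the convolution of T with inverse_fourier (dyadic phi0 k). *)
Definition lp_block phi0 (T : functional) (k : nat) x : R[i] :=
  T (fun y => inverse_fourier (dyadic phi0 k) (x - y)).

Definition besov_norm phi0 (s : R) (p q : \bar R) (T : functional) : \bar R :=
  Lnorm (@counting nat R) q
    (fun k => ((2 `^ (k%:R * s))%:E * cLnorm p (lp_block phi0 T k))%E).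

Definition besov phi0 s p q : set functional :=
  [set T | tempered T /\ (besov_norm phi0 s p q T < +oo)%E].

(* When T lies in the Besov space, a finite besov_norm of T - g forces g to lie
   in it too, so membership of g need not be required separately. *)
Definition dense_in_besov phi0 s p q (A : set ('rV[R]_d -> R[i])) : Prop :=
  forall T, besov phi0 s p q T -> forall e : R, 0 < e ->
    exists2 g, A g &
      (besov_norm phi0 s p q (fun f => T f - regular_distribution g f)%R
         < e%:E)%E.

End euclidean.

Section haar.
Context (R : realType).

Definition haar1 (b : bool) (x : R) : R :=
  if b then \1_(`[0, 2^-1[) x - \1_(`[2^-1, 1[) x else \1_(`[0, 1[) x.

Context (d : nat).

Definition haar (eps : 'I_d -> bool) (k : nat) (mu : 'I_d -> int)
    (x : 'rV[R]_d) : R :=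
  \prod_(i < d) haar1 (eps i) (2 ^+ k * x 0 i - (mu i)%:~R).

Definition haar_system : set ('rV[R]_d -> R) :=
  [set h | exists mu, h = haar (fun=> false) 0 mu] `|`
  [set h | exists (eps : 'I_d -> bool) k mu,
     (exists i, eps i) /\ h = haar eps k mu].

(* Finite linear combinations with complex coefficients. *)
Definition haar_span : set ('rV[R]_d -> R[i]) :=
  [set g | exists (n : nat) (c : 'I_n -> R[i]) (h : 'I_n -> 'rV[R]_d -> R),
     (forall j, haar_system (h j)) /\
     g = (fun x => \sum_(j < n) c j * (h j x)%:C)].

End haar.

(* Main.v *)
From HB Require Import structures.
Require Import Defs.
From mathcomp Require Import all_boot all_order all_algebra.
From mathcomp Require Import all_classical all_reals all_analysis.
From mathcomp Require Import measurable_realfun complex.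
From mathcomp Require Import ring lra.
Import Order.TTheory GRing.Theory Num.Theory.
Import numFieldNormedType.Exports.
Local Open Scope classical_set_scope.
Local Open Scope ring_scope.
Local Open Scope complex_scope.
Set Implicit Arguments.
Unset Strict Implicit.
Unset Printing Implicit Defensive.


(** The proof exhibits one function that no sequence of Haar sums approaches,
    because in this range of parameters the quasi-norm of the space controls the
    L^p size of the almost everywhere limit of mollified first derivatives, and
    for a Haar sum this limit is 0.

    Let [F] be [target], the inverse Fourier transform of [phi0 (2 xi)]. Only its
    first Littlewood-Paley block is nonzero, and it decays rapidly, so it lies in
    the space ([target_besov]). Let [g] be a Haar sum and [h = F - g], and write
    [u_k] for the [k]-th block of [h] and [v_k] for its partial derivative in the
    first coordinate, up to a unimodular constant. Three facts are combined.

    - Reconstruction: [v_0 + ... + v_K] is the derivative of [h] mollified at scale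
      [2 ^- K]. For [F] this is the derivative [F'] of [F] itself; for [g] it
      tends to 0 at each point near which [g] is constant, since the mollifying
      kernel has integral 0 and small tails ([conv_locally_constant]). As the
      [p]-th power is subadditive for [p <= 1], almost everywhere
      [`|F'| `^ p <= \sum_k `|v_k| `^ p] ([ae_target_deriv_le]).

    - Bernstein: the integral of [`|v_k| `^ p] is at most a constant times
      [2 `^ (k p)] times that of [`|u_k| `^ p]. For [p < 1] this rests on Peetre's
      maximal function ([integral_conv_powR_le]): [u_k] is reproduced by a
      rapidly decreasing kernel, so a factor [`|u_k| `^ (1 - p)] can be estimated
      by the maximal function and absorbed.

    - Since [q <= p], the sum over [k] of [2 `^ (k p)] times the integral of
      [`|u_k| `^ p] is at most [e `^ q] once the quasi-norm of [h] is less than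
      [e <= 1] ([besov_sum_le]).

    Together they bound the integral of [`|F'| `^ p] by a constant times [e `^ q]
    whenever some Haar sum is [e]-close to [F]. That integral is positive
    ([target_deriv_neq0]), so [e] cannot be arbitrarily small.

    The kernels are inverse Fourier transforms of [phi0] and of [xi_1 * phi0],
    rescaled. Their decay comes from finite differences of the symbol
    ([kernel_decay]); all convolution identities come from the inversion formula,
    proved by Abel summation ([fourier_inversion]), and Fubini's theorem. *)


(** * Complex-valued integration *)

Section cmod_theory.
Context (R : realType).
Implicit Types (z w : R[i]).

Local Notation Re := (@complex.Re R).
Local Notation Im := (@complex.Im R).

Lemma ReD z w : Re (z + w) = Re z + Re w. Proof. by case: z w => ? ? []. Qed.
Lemma ImD z w : Im (z + w) = Im z + Im w. Proof. by case: z w => ? ? []. Qed.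
Lemma ReM z w : Re (z * w) = Re z * Re w - Im z * Im w.
Proof. by case: z w => ? ? []. Qed.
Lemma ImM z w : Im (z * w) = Re z * Im w + Im z * Re w.
Proof. by case: z w => ? ? []. Qed.
Lemma ReN z : Re (- z) = - Re z. Proof. by case: z. Qed.
Lemma ImN z : Im (- z) = - Im z. Proof. by case: z. Qed.

Lemma cmod_ge0 z : 0 <= cmod z.
Proof. by case: z => a b; exact: sqrtr_ge0. Qed.

Lemma ecmod_ge0 z : (0 <= (cmod z)%:E)%E.
Proof. by rewrite lee_fin cmod_ge0. Qed.

Lemma cmodM z w : cmod (z * w) = cmod z * cmod w.
Proof. exact: ComplexField.Normc.normcM. Qed.

Lemma cmodD z w : cmod (z + w) <= cmod z + cmod w.
Proof. exact: le_normcD. Qed.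

Lemma cmodN z : cmod (- z) = cmod z.
Proof. exact: normcN. Qed.

Lemma cmodB z w : cmod (z - w) <= cmod z + cmod w.
Proof. by rewrite -(cmodN w) cmodD. Qed.

Lemma cmod0 : cmod (0 : R[i]) = 0.
Proof. exact: ComplexField.Normc.normc0. Qed.

Lemma cmod0_eq0 z : cmod z = 0 -> z = 0.
Proof. exact: ComplexField.Normc.eq0_normc. Qed.

Lemma cmod_real (a : R) : cmod a%:C = `|a|.
Proof. by rewrite /cmod /= expr0n /= addr0 sqrtr_sqr. Qed.

Lemma cmod1 : cmod (1 : R[i]) = 1.
Proof. exact: ComplexField.Normc.normc1. Qed.

Lemma cmod_prod (I : Type) (r : seq I) (F : I -> R[i]) :
  cmod (\prod_(i <- r) F i) = \prod_(i <- r) cmod (F i).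
Proof.
by elim/big_rec2: _ => [|i x y _ <-]; rewrite ?cmod1 ?cmodM.
Qed.

Lemma cmod_sum (I : Type) (r : seq I) (F : I -> R[i]) :
  cmod (\sum_(i <- r) F i) <= \sum_(i <- r) cmod (F i).
Proof.
elim/big_ind2: _ => [|x1 x2 y1 y2 h1 h2|//]; first by rewrite cmod0.
by rewrite (le_trans (cmodD _ _))// lerD.
Qed.

Lemma cmodX z n : cmod (z ^+ n) = cmod z ^+ n.
Proof. by elim: n => [|n IH]; rewrite ?cmod1 // !exprS cmodM IH. Qed.

Lemma Re_le_cmod z : `|Re z| <= cmod z.
Proof.
by case: z => a b; rewrite /cmod /= -sqrtr_sqr ler_wsqrtr // lerDl sqr_ge0.
Qed.

Lemma Im_le_cmod z : `|Im z| <= cmod z.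
Proof.
by case: z => a b; rewrite /cmod /= -sqrtr_sqr ler_wsqrtr // lerDr sqr_ge0.
Qed.

Lemma cmod_le_ReIm z : cmod z <= `|Re z| + `|Im z|.
Proof.
rewrite -[leRHS]ger0_norm ?addr_ge0 // -sqrtr_sqr; case: z => a b.
rewrite /cmod /= ler_wsqrtr // sqrrD !real_normK ?num_real //.
by rewrite addrAC lerDl mulrn_wge0 // mulr_ge0.
Qed.

Definition cis (a : R) : R[i] := cos a +i* sin a.

Lemma cisD a b : cis (a + b) = cis a * cis b.
Proof.
by rewrite /cis cosD sinD; apply/eqP; rewrite eq_complex /= eqxx/= addrC.
Qed.

Lemma cis0 : cis 0 = 1.
Proof. by rewrite /cis cos0 sin0. Qed.

Lemma cmod_cis a : cmod (cis a) = 1.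
Proof. by rewrite /cmod /= cos2Dsin2 sqrtr1. Qed.

Lemma cis_sum (I : Type) (r : seq I) (F : I -> R) :
  cis (\sum_(i <- r) F i) = \prod_(i <- r) cis (F i).
Proof.
by elim/big_rec2: _ => [|i x y _ <-]; rewrite ?cis0 ?cisD.
Qed.

End cmod_theory.

#[local] Hint Extern 0 (is_true (@Order.le _ _ _ (cmod _))) => exact: cmod_ge0 : core.
#[local] Hint Extern 0 (is_true (@Order.le _ _ _ (@EFin _ (cmod _)))) =>
  exact: ecmod_ge0 : core.

Section cmeasurable.
Context (R : realType) d (T : measurableType d).
Implicit Types (f g : T -> R[i]).

Definition cmeasurable f :=
  measurable_fun setT (@complex.Re R \o f) /\
  measurable_fun setT (@complex.Im R \o f).

Lemma cmeasurable_cst (z : R[i]) : cmeasurable (fun _ => z).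
Proof. by split; exact: measurable_cst. Qed.

Lemma cmeasurableD f g : cmeasurable f -> cmeasurable g ->
  cmeasurable (fun x => f x + g x).
Proof.
move=> [f1 f2] [g1 g2]; split.
  by rewrite (_ : _ \o _ = (@complex.Re R \o f) \+ (@complex.Re R \o g));
    [exact: measurable_funD|apply/funext => x /=; rewrite ReD].
by rewrite (_ : _ \o _ = (@complex.Im R \o f) \+ (@complex.Im R \o g));
    [exact: measurable_funD|apply/funext => x /=; rewrite ImD].
Qed.

Lemma cmeasurableM f g : cmeasurable f -> cmeasurable g ->
  cmeasurable (fun x => f x * g x).
Proof.
move=> [f1 f2] [g1 g2]; split.
  rewrite (_ : _ \o _ = (@complex.Re R \o f) \* (@complex.Re R \o g) \-
      ((@complex.Im R \o f) \* (@complex.Im R \o g))).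
    by apply: measurable_funB; exact: measurable_funM.
  by apply/funext => x /=; rewrite ReM.
rewrite (_ : _ \o _ = (@complex.Re R \o f) \* (@complex.Im R \o g) \+
      ((@complex.Im R \o f) \* (@complex.Re R \o g))).
  by apply: measurable_funD; exact: measurable_funM.
by apply/funext => x /=; rewrite ImM.
Qed.

Lemma cmeasurableN f : cmeasurable f -> cmeasurable (fun x => - f x).
Proof.
move=> mf; rewrite (_ : (fun _ => _) = (fun x => (-1) * f x)).
  by apply: cmeasurableM => //; exact: cmeasurable_cst.
by apply/funext => x; rewrite mulN1r.
Qed.

Lemma cmeasurableB f g : cmeasurable f -> cmeasurable g ->
  cmeasurable (fun x => f x - g x).
Proof. by move=> mf mg; apply: cmeasurableD => //; exact: cmeasurableN. Qed.

Lemma cmeasurable_real (a : T -> R) : measurable_fun setT a ->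
  cmeasurable (fun x => (a x)%:C).
Proof.
move=> ma; split => //.
by rewrite (_ : _ \o _ = cst 0) //; exact: measurable_cst.
Qed.

Lemma cmeasurable_cis (a : T -> R) : measurable_fun setT a ->
  cmeasurable (fun x => cis (a x)).
Proof.
move=> ma; split.
  rewrite (_ : _ \o _ = @cos R \o a) //; apply: measurableT_comp => //.
  by apply: continuous_measurable_fun; exact: continuous_cos.
rewrite (_ : _ \o _ = @sin R \o a) //; apply: measurableT_comp => //.
by apply: continuous_measurable_fun; exact: continuous_sin.
Qed.

Lemma cmeasurable_prod (I : Type) (r : seq I) (F : I -> T -> R[i]) :
  (forall i, cmeasurable (F i)) ->
  cmeasurable (fun x => \prod_(i <- r) F i x).
Proof.
move=> mF; elim: r => [|i r IH].
  rewrite (_ : (fun _ => _) = fun=> 1); first exact: cmeasurable_cst.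
  by apply/funext => x; rewrite big_nil.
rewrite (_ : (fun _ => _) = (fun x => F i x * \prod_(i <- r) F i x)).
  exact: cmeasurableM.
by apply/funext => x; rewrite big_cons.
Qed.

Lemma cmeasurable_sum (I : Type) (r : seq I) (F : I -> T -> R[i]) :
  (forall i, cmeasurable (F i)) ->
  cmeasurable (fun x => \sum_(i <- r) F i x).
Proof.
move=> mF; elim: r => [|i r IH].
  rewrite (_ : (fun _ => _) = fun=> 0); first exact: cmeasurable_cst.
  by apply/funext => x; rewrite big_nil.
rewrite (_ : (fun _ => _) = (fun x => F i x + \sum_(i <- r) F i x)).
  exact: cmeasurableD.
by apply/funext => x; rewrite big_cons.
Qed.

Lemma measurable_cmod f : cmeasurable f -> measurable_fun setT (@cmod R \o f).
Proof.
move=> [f1 f2]; rewrite (_ : _ \o _ =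
    @Num.sqrt R \o (fun x => complex.Re (f x) ^+ 2 + complex.Im (f x) ^+ 2)).
  apply: measurableT_comp.
    by apply: continuous_measurable_fun; exact: sqrt_continuous.
  by apply: measurable_funD; exact: measurable_funX.
by apply/funext => x /=; rewrite /cmod; case: (f x).
Qed.

Lemma measurable_ecmod f : cmeasurable f ->
  measurable_fun setT (fun x => (cmod (f x))%:E).
Proof. by move=> mf; apply/measurable_EFinP; exact: measurable_cmod. Qed.

End cmeasurable.

Lemma cmeasurable_comp (R : realType) d1 d2 (T1 : measurableType d1)
  (T2 : measurableType d2) (f : T2 -> R[i]) (h : T1 -> T2) :
  cmeasurable f -> measurable_fun setT h -> cmeasurable (fun x => f (h x)).
Proof.
by move=> [f1 f2] mh; split;
  [exact: (measurableT_comp f1)|exact: (measurableT_comp f2)].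
Qed.

Section cint.
Context (R : realType) d (T : measurableType d)
  (mu : {measure set T -> \bar R}).
Implicit Types (f g : T -> R[i]).

Definition cint f : R[i] :=
  (\int[mu]_x complex.Re (f x)) +i* (\int[mu]_x complex.Im (f x)).

Definition cintegrable f := cmeasurable f /\
  (\int[mu]_x (cmod (f x))%:E < +oo)%E.

Lemma cintegrableP f : cintegrable f <->
  mu.-integrable setT (fun x => (complex.Re (f x))%:E) /\
  mu.-integrable setT (fun x => (complex.Im (f x))%:E).
Proof.
split.
  move=> [[f1 f2] foo]; split; apply/integrableP; split.
  - exact/measurable_EFinP.
  - apply: le_lt_trans foo; apply: ge0_le_integral => //.
    + by apply/measurableT_comp => //; exact/measurable_EFinP.
    + by apply: measurable_ecmod; split.
    + by move=> x _; rewrite abse_EFin lee_fin Re_le_cmod.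
  - exact/measurable_EFinP.
  - apply: le_lt_trans foo; apply: ge0_le_integral => //.
    + by apply/measurableT_comp => //; exact/measurable_EFinP.
    + by apply: measurable_ecmod; split.
    + by move=> x _; rewrite abse_EFin lee_fin Im_le_cmod.
move=> [/integrableP[/measurable_EFinP m1 i1] /integrableP[/measurable_EFinP m2 i2]].
split; first by split.
apply: le_lt_trans (lte_add_pinfty i1 i2).
rewrite -ge0_integralD //; last 2 first.
- by apply/measurableT_comp => //; exact/measurable_EFinP.
- by apply/measurableT_comp => //; exact/measurable_EFinP.
apply: ge0_le_integral => //.
- by apply: measurable_ecmod; split.
- by apply: emeasurable_funD;
    apply/measurableT_comp => //; exact/measurable_EFinP.
- by move=> x _; rewrite !abse_EFin -EFinD lee_fin cmod_le_ReIm.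
Qed.

Lemma cintegrableD f g : cintegrable f -> cintegrable g ->
  cintegrable (fun x => f x + g x).
Proof.
move=> [mf fi] [mg gi]; split; first exact: cmeasurableD.
apply: le_lt_trans (lte_add_pinfty fi gi); rewrite -ge0_integralD //.
- apply: ge0_le_integral => //.
  + by apply: measurable_ecmod; exact: cmeasurableD.
  + by apply: emeasurable_funD; exact: measurable_ecmod.
  + by move=> x _; rewrite lee_fin cmodD.
- exact: measurable_ecmod.
- exact: measurable_ecmod.
Qed.

(** The scalar lets the criterion apply to the product of a bounded factor and an
    integrable function. *)
Lemma cintegrable_le (f : T -> R[i]) (g : T -> R[i]) (C : R) :
  cmeasurable f -> cintegrable g ->
  (forall x, cmod (f x) <= C * cmod (g x)) -> cintegrable f.
Proof.
move=> mf [mg gi] fg; split => //.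
have C0 x : cmod (f x) <= `|C| * cmod (g x).
  by rewrite (le_trans (fg x))// ler_wpM2r ?cmod_ge0 ?ler_norm.
have : (`|C|%:E * \int[mu]_x (cmod (g x))%:E < +oo)%E.
  by rewrite lte_mul_pinfty.
apply: le_lt_trans; rewrite -ge0_integralZl //.
- apply: ge0_le_integral => //.
  + exact: measurable_ecmod.
  + by apply: measurable_funeM; exact: measurable_ecmod.
  + by move=> x _; rewrite -EFinM lee_fin.
- exact: measurable_ecmod.
Qed.

Lemma cintegrableM f g (C : R) : cmeasurable f ->
  (forall x, cmod (f x) <= C) -> cintegrable g ->
  cintegrable (fun x => f x * g x).
Proof.
move=> mf fC gi; apply: (@cintegrable_le _ g C) => //.
  by apply: cmeasurableM => //; case: gi.
by move=> x; rewrite cmodM ler_wpM2r ?cmod_ge0.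
Qed.

Lemma cintegrableZ (a : R[i]) f : cintegrable f ->
  cintegrable (fun x => a * f x).
Proof.
by move=> fi; apply: (@cintegrableM _ _ (cmod a)) => //;
  exact: cmeasurable_cst.
Qed.

Lemma cintegrableB f g : cintegrable f -> cintegrable g ->
  cintegrable (fun x => f x - g x).
Proof.
move=> fi gi; apply: cintegrableD => //.
by rewrite (_ : (fun _ => _) = (fun x => (-1) * g x));
  [exact: cintegrableZ|apply/funext => x; rewrite mulN1r].
Qed.

Lemma cintD f g : cintegrable f -> cintegrable g ->
  cint (fun x => f x + g x) = cint f + cint g.
Proof.
move=> /cintegrableP[f1 f2] /cintegrableP[g1 g2].
apply/eqP; rewrite eq_complex /cint /=; apply/andP; split; apply/eqP.
  by rewrite -RintegralD //; apply: eq_Rintegral => x _; rewrite ReD.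
by rewrite -RintegralD //; apply: eq_Rintegral => x _; rewrite ImD.
Qed.

Lemma cintZ (a : R[i]) f : cintegrable f ->
  cint (fun x => a * f x) = a * cint f.
Proof.
move=> /cintegrableP[f1 f2].
apply/eqP; rewrite eq_complex ReM ImM /cint /=; apply/andP; split; apply/eqP.
  rewrite -RintegralZl // -RintegralZl // -RintegralB //.
  - by apply: eq_Rintegral => x _; rewrite ReM.
  - exact: (integrableZl measurableT (complex.Re a) f1).
  - exact: (integrableZl measurableT (complex.Im a) f2).
rewrite -RintegralZl // -RintegralZl // -RintegralD //.
- by apply: eq_Rintegral => x _; rewrite ImM.
- exact: (integrableZl measurableT (complex.Re a) f2).
- exact: (integrableZl measurableT (complex.Im a) f1).
Qed.

Lemma cintN f : cintegrable f -> cint (fun x => - f x) = - cint f.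
Proof.
move=> fi; rewrite -mulN1r -cintZ //; congr cint.
by apply/funext => x; rewrite mulN1r.
Qed.

Lemma cintB f g : cintegrable f -> cintegrable g ->
  cint (fun x => f x - g x) = cint f - cint g.
Proof.
move=> fi gi; rewrite cintD // ?cintN //.
by rewrite (_ : (fun _ => _) = (fun x => (-1) * g x));
  [exact: cintegrableZ|apply/funext => x; rewrite mulN1r].
Qed.

Lemma cint0 : cint (fun _ => 0) = 0.
Proof. by rewrite /cint /= /Rintegral integral0. Qed.

(** The factor 2 comes from estimating the real and the imaginary part
    separately. *)
Lemma cmod_cint_le f : cintegrable f ->
  ((cmod (cint f))%:E <= 2%:E * \int[mu]_x (cmod (f x))%:E)%E.
Proof.
move=> fi; have [[mf1 mf2] _] := fi.
have mf : cmeasurable f by split.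
have [f1 f2] := (cintegrableP f).1 fi.
rewrite (_ : 2%:E = 1 + 1)%E // ge0_muleDl // mul1e.
apply: (@le_trans _ _ (`|complex.Re (cint f)| + `|complex.Im (cint f)|)%:E).
  by rewrite lee_fin cmod_le_ReIm.
rewrite EFinD; apply: leeD; rewrite /cint /=.
- rewrite EFin_normr_Rintegral //.
  apply: (le_trans (le_abse_integral _ _ _)) => //; first by case/integrableP: f1.
  apply: ge0_le_integral => //.
  + by apply/measurableT_comp => //; exact/measurable_EFinP.
  + exact: measurable_ecmod.
  + by move=> x _; rewrite abse_EFin lee_fin Re_le_cmod.
- rewrite EFin_normr_Rintegral //.
  apply: (le_trans (le_abse_integral _ _ _)) => //; first by case/integrableP: f2.
  apply: ge0_le_integral => //.
  + by apply/measurableT_comp => //; exact/measurable_EFinP.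
  + exact: measurable_ecmod.
  + by move=> x _; rewrite abse_EFin lee_fin Im_le_cmod.
Qed.

End cint.

(** * Parametric integrals, Fubini's theorem and dominated convergence *)

Section parametric.
Context (R : realType) d1 d2 (T1 : measurableType d1) (T2 : measurableType d2).
Variable m1 : {sigma_finite_measure set T1 -> \bar R}.
Variable m2 : {sigma_finite_measure set T2 -> \bar R}.

Lemma measurable_Rintegral_param (f : T1 * T2 -> R) :
  measurable_fun setT f ->
  measurable_fun setT (fun x => \int[m2]_y f (x, y)).
Proof.
move=> mf; apply: (measurableT_comp (f := fine)) => //.
have mEf : measurable_fun setT (EFin \o f) by exact/measurable_EFinP.
have -> : (fun x => \int[m2]_y (f (x, y))%:E)%E =
    (fun x => (\int[m2]_y ((EFin \o f)^\+ (x, y))%E -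
               \int[m2]_y ((EFin \o f)^\- (x, y))%E)%E).
  apply/funext => x; rewrite integralE.
  by congr (_ - _)%E; apply: eq_integral => y _; rewrite ?funeposE ?funenegE.
apply: emeasurable_funB.
  by apply: (measurable_fun_fubini_tonelli_F (EFin \o f)^\+%E) => //;
    exact: measurable_funepos.
by apply: (measurable_fun_fubini_tonelli_F (EFin \o f)^\-%E) => //;
  exact: measurable_funeneg.
Qed.

Lemma cmeasurable_cint_param (f : T1 * T2 -> R[i]) : cmeasurable f ->
  cmeasurable (fun x => cint m2 (fun y => f (x, y))).
Proof.
move=> [f1 f2]; split.
  exact: (measurable_Rintegral_param f1).
exact: (measurable_Rintegral_param f2).
Qed.

Lemma Rintegral_prod (f : T1 * T2 -> R) :
  (m1 \x m2)%E.-integrable setT (EFin \o f) ->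
  \int[m1]_x \int[m2]_y f (x, y) = \int[(m1 \x m2)%E]_z f z.
Proof.
move=> fi; have mf : measurable_fun setT f.
  by case/integrableP: fi => /measurable_EFinP.
rewrite /Rintegral; congr fine; rewrite -(integral12_prod_meas1 fi).
apply: ae_eq_integral => //.
- by apply/measurable_EFinP; exact: measurable_Rintegral_param.
- by have /integrableP[] := integrable_fubini_F fi.
- have := integrable_ae measurableT (integrable_fubini_F fi).
  by apply: filterS => x /(_ I) fx _; rewrite fineK.
Qed.

Lemma Rintegral_swap (f : T1 * T2 -> R) :
  (m1 \x m2)%E.-integrable setT (EFin \o f) ->
  \int[m1]_x \int[m2]_y f (x, y) = \int[m2]_y \int[m1]_x f (x, y).
Proof.
move=> fi; rewrite Rintegral_prod // /Rintegral; congr fine.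
rewrite -(integral21_prod_meas1 fi); apply/esym/ae_eq_integral => //.
- apply/measurable_EFinP; apply: (measurableT_comp (f := fine)) => //.
  exact: (measurable_fubini_G fi).
- exact: (measurable_fubini_G fi).
- have := ae_integrable2 fi.
  by apply: filterS => y iy _; rewrite fineK // integrable_fin_num.
Qed.

Lemma cint_prod (f : T1 * T2 -> R[i]) : cintegrable (m1 \x m2)%E f ->
  cint m1 (fun x => cint m2 (fun y => f (x, y))) = cint (m1 \x m2)%E f.
Proof.
by move=> /cintegrableP[i1 i2]; rewrite /cint /=; congr (_ +i* _);
  [exact: (Rintegral_prod i1)|exact: (Rintegral_prod i2)].
Qed.

(** Fubini's theorem for complex-valued functions, with the hypothesis in the
    form in which it is checked: finiteness of one iterated integral of the
    modulus. *)
Lemma cint_swap (f : T1 * T2 -> R[i]) : cmeasurable f ->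
  (\int[m1]_x \int[m2]_y (cmod (f (x, y)))%:E < +oo)%E ->
  cint m1 (fun x => cint m2 (fun y => f (x, y))) =
  cint m2 (fun y => cint m1 (fun x => f (x, y))).
Proof.
move=> mf foo; have [f1 f2] := mf.
have : cintegrable (m1 \x m2)%E f.
  by split => //; rewrite (fubini_tonelli1 (fun z => (cmod (f z))%:E)) //; exact: (measurable_ecmod mf).
move=> /cintegrableP[i1 i2].
by rewrite /cint /=; congr (_ +i* _);
  [exact: (Rintegral_swap i1)|exact: (Rintegral_swap i2)].
Qed.

End parametric.

Section cdct.
Context (R : realType) d (T : measurableType d)
  (mu : {measure set T -> \bar R}).

(** Convergence is expressed by the modulus of the difference tending to 0 in
    [R], so that no topology on [R[i]] enters. *)
Lemma cint_dominated_convergence (f_ : nat -> T -> R[i]) (f g : T -> R[i]) :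
  (forall n, cmeasurable (f_ n)) -> cmeasurable f -> cintegrable mu g ->
  (forall n x, cmod (f_ n x) <= cmod (g x)) ->
  (forall x, cmod (f x) <= cmod (g x)) ->
  (forall x, cmod (f_ n x - f x) @[n --> \oo] --> (0 : R)) ->
  cmod (cint mu (f_ n) - cint mu f) @[n --> \oo] --> (0 : R).
Proof.
move=> mf_ mf gi f_g fg f_f; have [mg goo] := gi.
have f_i n : cintegrable mu (f_ n).
  by apply: (cintegrable_le (C := 1) _ gi) => // x; rewrite mul1r.
have fi : cintegrable mu f.
  by apply: (cintegrable_le (C := 1) _ gi) => // x; rewrite mul1r.
have di n : cintegrable mu (fun x => f_ n x - f x) by exact: cintegrableB.
have cdi n : cmeasurable (fun x => f_ n x - f x) by case: (di n).
have G2 : mu.-integrable setT (fun x => (2 * cmod (g x))%:E).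
  have G1 : mu.-integrable setT (fun x => (cmod (g x))%:E).
    apply/integrableP; split; first exact: measurable_ecmod.
    by under eq_integral do rewrite gee0_abs //.
  exact: (integrableZl measurableT 2 G1).
have lim0 : (\int[mu]_x (cmod (f_ n x - f x))%:E)%E @[n --> \oo] --> 0%E.
  have [] := @dominated_convergence _ _ _ mu setT measurableT
    (fun n x => (cmod (f_ n x - f x))%:E) (fun=> 0%E)
    (fun x => (2 * cmod (g x))%:E) (fun n => measurable_ecmod (cdi n)).
  - exact: measurable_cst.
  - apply: aeW => x _; apply: cvg_EFin; first exact: nearW.
    exact: f_f.
  - exact: G2.
  - apply: aeW => x n _; rewrite gee0_abs // lee_fin mulr2n mulrDl !mul1r.
    by rewrite (le_trans (cmodB _ _))// lerD.
  by move=> _ _; rewrite integral0.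
have fin n : (\int[mu]_x (cmod (f_ n x - f x))%:E)%E \is a fin_num.
  by rewrite ge0_fin_numE ?integral_ge0 //; case: (di n).
have lim1 : 2 * fine (\int[mu]_x (cmod (f_ n x - f x))%:E)%E @[n --> \oo]
    --> (0 : R).
  by rewrite -(mulr0 2); exact: cvgMl_tmp (fine_cvg lim0).
apply: (squeeze_cvgr _ (cvg_cst _) lim1); apply: nearW => n.
rewrite cmod_ge0 -(cintB (f_i n) fi) -lee_fin EFinM fineK //=.
exact: cmod_cint_le.
Qed.

End cdct.

(** * Lebesgue measure on row vectors *)

Section row_measurable.
Context (R : realType) (d : nat).

(** The sigma-algebra transported from tuples. It contains the open sets
    ([open_row_measurable] below), hence is suited to continuous functions. *)
Definition row_measurable (A : set 'rV[R]_d) :=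
  measurable (@row_of_tuple R d @^-1` A).

Let row_measurable0 : row_measurable set0.
Proof. by rewrite /row_measurable preimage_set0; exact: measurable0. Qed.

Let row_measurableC A : row_measurable A -> row_measurable (~` A).
Proof. by rewrite /row_measurable preimage_setC; exact: measurableC. Qed.

Let row_measurableU (F : (set 'rV[R]_d)^nat) :
  (forall i, row_measurable (F i)) -> row_measurable (\bigcup_i F i).
Proof.
by move=> mF; rewrite /row_measurable preimage_bigcup; exact: bigcupT_measurable.
Qed.

HB.instance Definition _ := @isMeasurable.Build default_measure_display
  'rV[R]_d row_measurable row_measurable0 row_measurableC row_measurableU.

Lemma measurable_row_of_tuple : measurable_fun setT (@row_of_tuple R d).
Proof. by move=> _ A mA; rewrite setTI. Qed.

Definition tuple_of_row (x : 'rV[R]_d) : d.-tuple (measurableTypeR R) :=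
  [tuple x 0 i | i < d].

Lemma tuple_of_rowK : cancel tuple_of_row (@row_of_tuple R d).
Proof. by move=> x; apply/rowP => i; rewrite mxE tnth_mktuple. Qed.

Lemma row_of_tupleK : cancel (@row_of_tuple R d) tuple_of_row.
Proof. by move=> t; apply: eq_from_tnth => i; rewrite tnth_mktuple mxE. Qed.

Lemma measurable_coord (i : 'I_d) :
  measurable_fun setT (fun x : 'rV[R]_d => x 0 i).
Proof.
move=> _ A mA; rewrite setTI /measurable /= /row_measurable.
rewrite (_ : _ @^-1` _ = (fun t => tnth t i) @^-1` A).
  by rewrite -[X in measurable X]setTI; exact: measurable_tnth.
by apply/seteqP; split => t /=; rewrite mxE.
Qed.

Lemma measurable_row d' (T : measurableType d') (f : T -> 'rV[R]_d) :
  (forall i, measurable_fun setT (fun x => f x 0 i)) -> measurable_fun setT f.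
Proof.
move=> mf _ A mA; rewrite setTI.
rewrite (_ : f @^-1` A = (tuple_of_row \o f) @^-1` (@row_of_tuple R d @^-1` A)).
  rewrite -[X in measurable X]setTI.
  have : measurable_fun setT (tuple_of_row \o f).
    apply/measurable_fun_tnthP => i.
    apply: eq_measurable_fun (mf i) => x _ /=.
    by rewrite tnth_mktuple.
  by move=> h; exact: h.
by apply/seteqP; split => x /=; rewrite tuple_of_rowK.
Qed.

Definition leb : set 'rV[R]_d -> \bar R :=
  pushforward (lebesgue_tuple R d) (@row_of_tuple R d).

Let leb0 : leb set0 = 0%E.
Proof. by rewrite /leb /pushforward preimage_set0 measure0. Qed.

Let leb_ge0 A : (0 <= leb A)%E.
Proof. by rewrite /leb /pushforward; exact: measure_ge0. Qed.

Let leb_sigma_additive : semi_sigma_additive leb.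
Proof.
move=> F mF tF mUF; rewrite /leb /pushforward preimage_bigcup.
apply: measure_semi_sigma_additive => //.
- apply/trivIsetP => /= i j _ _ ij; rewrite -preimage_setI.
  by move/trivIsetP : tF => /(_ _ _ _ _ ij) ->//; rewrite preimage_set0.
Qed.

HB.instance Definition _ := isMeasure.Build _ _ _ leb
  leb0 leb_ge0 leb_sigma_additive.

Let leb_sigma_finite : sigma_finite setT leb.
Proof.
have [F TF Foo] := sigma_finiteT (lebesgue_tuple R d).
have E i : @row_of_tuple R d @^-1` (tuple_of_row @^-1` F i) = F i.
  by apply/seteqP; split => t /=; rewrite row_of_tupleK.
exists (fun i => tuple_of_row @^-1` F i).
  by rewrite -preimage_bigcup -TF preimage_setT.
move=> i; have [mF Fi] := Foo i; split.
  by rewrite /measurable /= /row_measurable E.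
by rewrite /leb /pushforward E.
Qed.

HB.instance Definition _ := Measure_isSigmaFinite.Build _ _ _ leb
  leb_sigma_finite.

Lemma ge0_integral_leb (f : 'rV[R]_d -> \bar R) : measurable_fun setT f ->
  (forall x, 0 <= f x)%E ->
  (\int[leb]_x f x = \int[lebesgue_tuple R d]_t f (row_of_tuple t))%E.
Proof.
move=> mf f0; transitivity
  (\int[pushforward (lebesgue_tuple R d) (@row_of_tuple R d)]_x f x)%E.
  by [].
by rewrite ge0_integral_pushforward //; exact: measurable_row_of_tuple.
Qed.

Lemma Rintegral_leb (f : 'rV[R]_d -> R) : measurable_fun setT f ->
  \int[leb]_x f x = \int[lebesgue_tuple R d]_t f (row_of_tuple t).
Proof.
move=> /measurable_EFinP mf; rewrite /Rintegral; congr fine.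
rewrite integralE [in RHS]integralE.
rewrite !ge0_integral_leb //; last 2 first.
- exact: measurable_funeneg.
- exact: measurable_funepos.
by congr (_ - _)%E; apply: eq_integral => y _; rewrite ?funeposE ?funenegE.
Qed.

Lemma cintegralE (f : 'rV[R]_d -> R[i]) : cmeasurable f ->
  cintegral f = cint leb f.
Proof. by move=> [f1 f2]; rewrite /cintegral /cint !Rintegral_leb. Qed.

End row_measurable.

Section tuple_integration.
Context (R : realType).
Notation L1 := (@lebesgue_measure R).
Notation LT := (lebesgue_tuple R).
Local Open Scope ereal_scope.

Lemma ge0_integral_tuple0 (f : 0.-tuple (measurableTypeR R) -> \bar R) :
  measurable_fun setT f -> (forall x, 0 <= f x) ->
  \int[LT 0]_t f t = f [tuple].
Proof. by move=> mf f0; rewrite /= integral_dirac // diracE in_setT mul1e. Qed.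

Lemma ge0_integral_tupleS n (f : n.+1.-tuple (measurableTypeR R) -> \bar R) :
  measurable_fun setT f -> (forall x, 0 <= f x) ->
  \int[LT n.+1]_t f t =
  \int[L1]_x \int[LT n]_t f [tuple of x :: t].
Proof.
move=> mf f0.
transitivity (\int[pushforward (L1 \x LT n) (@cons_pair _ _ n)]_t f t).
  by [].
have mc := @measurable_cons_pair _ (measurableTypeR R) n.
rewrite ge0_integral_pushforward //= (fubini_tonelli1 (f \o @cons_pair _ _ n)) //.
- exact: measurableT_comp.
- by move=> x; exact: f0.
Qed.

(** One scaling factor for all coordinates; a negative one gives reflections,
    which occur in convolutions. *)
Definition affine_tuple n (a : R) (b : 'I_n -> R)
    (t : n.-tuple (measurableTypeR R)) : n.-tuple (measurableTypeR R) :=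
  [tuple (a * tnth t i + b i)%R | i < n].

Lemma measurable_affine_tuple n (a : R) (b : 'I_n -> R) :
  measurable_fun setT (affine_tuple a b).
Proof.
apply/measurable_fun_tnthP => i.
rewrite (_ : _ \o _ = (fun t => a * tnth t i + b i)%R).
  by apply: measurable_funD => //; apply: measurable_funM => //;
    exact: measurable_tnth.
by apply/funext => t /=; rewrite tnth_mktuple.
Qed.

Lemma measurable_affine (a b : R) :
  measurable_fun setT (fun x : measurableTypeR R => a * x + b : measurableTypeR R)%R.
Proof.
by apply: measurable_funD => //; exact: measurable_funM.
Qed.

(** The image of Lebesgue measure under [x |-> a * x + b], multiplied by
    [`|a|], gives each interval its length, so it is Lebesgue measure. *)
Lemma ge0_integral_affine1 (a b : R) (f : R -> \bar R) : a != 0%R ->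
  measurable_fun setT f -> (forall x, 0 <= f x) ->
  \int[L1]_x f (a * x + b)%R = `|a|^-1%:E * \int[L1]_x f x.
Proof.
move=> a0 mf f0.
have maff := measurable_affine a b.
have na0 : (0 < `|a|)%R by rewrite normr_gt0.
pose c : {nonneg R} := NngNum (normr_ge0 a).
pose m := mscale c (pushforward L1 (fun x : R => (a * x + b)%R : measurableTypeR R)).
have E : forall A, measurable A -> L1 A = m maff A.
  apply: lebesgue_measure_unique => _ [[u v] _ <-].
  transitivity (`|a|%:E * L1 ((fun x : R => (a * x + b)%R) @^-1` `]u, v]%classic)); last by [].
  have [a_gt0|a_lt0] := ltrP 0%R a.
    rewrite (_ : _ @^-1` _ = `]((u - b) / a)%R, ((v - b) / a)%R]%classic); last first.
      apply/seteqP; split => x /=; rewrite !in_itv /= ltr_pdivrMr // ler_pdivlMr //;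
        by rewrite ltrBlDr lerBrDr mulrC.
    rewrite !lebesgue_measure_itv /= !lte_fin ltr_pM2r ?invr_gt0 // ltrD2r.
    case: ifPn => _; last by rewrite mule0.
    by rewrite gtr0_norm // -!EFinB -EFinM; congr EFin; field.
  have {}a_lt0 : (a < 0)%R by rewrite lt_neqAle a0.
  rewrite (_ : _ @^-1` _ = `[((v - b) / a)%R, ((u - b) / a)%R[%classic); last first.
    apply/seteqP; split => x /=; rewrite !in_itv /= ltr_ndivlMr // ler_ndivrMr //;
      by rewrite ltrBlDr lerBrDr mulrC andbC.
  rewrite !lebesgue_measure_itv /= !lte_fin ltr_nM2r ?invr_lt0 // ltrD2r.
  case: ifPn => _; last by rewrite mule0.
  by rewrite ltr0_norm // -!EFinB -EFinM; congr EFin; field.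
have -> : \int[L1]_x f x = \int[m maff]_x f x.
  by apply: eq_measure_integral => A mA _; exact: E.
rewrite ge0_integral_mscale // ge0_integral_pushforward // muleA -EFinM.
by rewrite mulVf ?normr_eq0 // mul1e.
Qed.

Lemma affine_tuple_cons n (a : R) (b : 'I_n.+1 -> R) x
    (t : n.-tuple (measurableTypeR R)) :
  affine_tuple a b [tuple of x :: t] =
  [tuple of (a * x + b ord0)%R :: affine_tuple a (b \o lift ord0) t].
Proof.
apply: eq_from_tnth => i; rewrite tnth_mktuple.
have [j ->|->] := unliftP ord0 i; last by rewrite !tnth0.
by rewrite !tnthS tnth_mktuple.
Qed.

Lemma ge0_integral_affine_tuple n (a : R) (b : 'I_n -> R)
    (f : n.-tuple (measurableTypeR R) -> \bar R) : a != 0%R ->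
  measurable_fun setT f -> (forall x, 0 <= f x) ->
  \int[LT n]_t f (affine_tuple a b t) = (`|a|^-1 ^+ n)%:E * \int[LT n]_t f t.
Proof.
move=> a0; elim: n b f => [|n IH] b f mf f0.
  rewrite !ge0_integral_tuple0 //;
    last exact: (measurableT_comp mf (measurable_affine_tuple _ _)).
  by rewrite expr0 mul1e; rewrite [affine_tuple _ _ _]tuple0.
have mcons x : measurable_fun setT
    (fun t : n.-tuple (measurableTypeR R) => f [tuple of x :: t]).
  apply: (measurableT_comp mf); apply: measurable_cons => //.
rewrite ge0_integral_tupleS //; last first.
  exact: (measurableT_comp mf (measurable_affine_tuple _ _)).
rewrite ge0_integral_tupleS //.
have mfc : measurable_fun setT (fun z : measurableTypeR R * n.-tuple (measurableTypeR R) =>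
    f [tuple of z.1 :: z.2]).
  by apply: (measurableT_comp mf); exact: measurable_cons_pair.
have mF : measurable_fun setT (fun x : measurableTypeR R =>
    \int[LT n]_t f [tuple of x :: t]).
  exact: (measurable_fun_fubini_tonelli_F _ mfc (fun z => f0 _)).
transitivity (\int[L1]_x ((`|a|^-1 ^+ n)%:E *
    \int[LT n]_t f [tuple of (a * x + b ord0)%R :: t])).
  apply: eq_integral => x _.
  under eq_integral do rewrite affine_tuple_cons.
  by rewrite (IH (b \o lift ord0)
    (fun t => f [tuple of (a * x + b ord0)%R :: t])).
have na0 : (0 <= `|a|^-1)%R by rewrite invr_ge0.
rewrite ge0_integralZl //; last 2 first.
- exact: (measurableT_comp mF (measurable_affine a (b ord0))).
- by move=> x _; exact: integral_ge0.
rewrite (ge0_integral_affine1 (b ord0) a0 mF); last by move=> x; exact: integral_ge0.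
by rewrite exprSr EFinM muleA.
Qed.

End tuple_integration.

Section leb_affine.
Context (R : realType) (d : nat).
Notation leb := (@leb R d).
Local Open Scope ereal_scope.

Lemma measurable_affine_row (a : R) (b : 'rV[R]_d) :
  measurable_fun setT (fun x : 'rV[R]_d => a *: x + b : 'rV[R]_d)%R.
Proof.
apply: measurable_row => i.
apply: (eq_measurable_fun (fun x : 'rV[R]_d => a * x 0 i + b 0 i)%R).
  by move=> x _; rewrite !mxE.
apply: measurable_funD => //; apply: measurable_funM => //.
exact: measurable_coord.
Qed.

Lemma ge0_integral_affine (a : R) (b : 'rV[R]_d) (f : 'rV[R]_d -> \bar R) :
  a != 0%R -> measurable_fun setT f -> (forall x, 0 <= f x) ->
  \int[leb]_x f (a *: x + b)%R = (`|a|^-1 ^+ d)%:E * \int[leb]_x f x.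
Proof.
move=> a0 mf f0; rewrite !ge0_integral_leb //; last first.
  exact: (measurableT_comp mf (measurable_affine_row _ _)).
rewrite -(ge0_integral_affine_tuple (fun i => b 0%R i)
  (f := fun t => f (row_of_tuple t)) a0) //.
apply: eq_integral => t _; congr f.
by apply/rowP => i; rewrite !mxE tnth_mktuple.
Qed.

End leb_affine.

(** * Change of variables *)

(** A change-of-variables formula for nonnegative functions implies the one for
    integrable complex functions. The section serves affine maps of row vectors
    as well as the passage between tuples and rows. *)
Section transfer.
Context (R : realType) d1 d2 (X : measurableType d1) (Y : measurableType d2).
Context (mu : {measure set X -> \bar R}) (nu : {measure set Y -> \bar R}).
Variables (phi : X -> Y) (c : R).
Hypothesis c_ge0 : 0 <= c.
Hypothesis mphi : measurable_fun setT phi.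
Hypothesis phiE : forall f : Y -> \bar R, measurable_fun setT f ->
  (forall y, 0 <= f y)%E ->
  (\int[mu]_x f (phi x) = c%:E * \int[nu]_y f y)%E.

Lemma Rintegral_transfer (f : Y -> R) : nu.-integrable setT (EFin \o f) ->
  \int[mu]_x f (phi x) = c * \int[nu]_y f y.
Proof.
move=> fi; have /integrableP[mf foo] := fi.
have pfin := integrable_fin_num measurableT (integrable_funepos measurableT fi).
have nfin := integrable_fin_num measurableT (integrable_funeneg measurableT fi).
rewrite /Rintegral integralE [in RHS]integralE.
have P : (\int[mu]_x (fun x => (f (phi x))%:E)^\+ x =
  c%:E * \int[nu]_y (fun y => (f y)%:E)^\+ y)%E.
  rewrite -phiE; [|exact: measurable_funepos|by []].
  by apply: eq_integral => y _; rewrite !funeposE.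
have N : (\int[mu]_x (fun x => (f (phi x))%:E)^\- x =
  c%:E * \int[nu]_y (fun y => (f y)%:E)^\- y)%E.
  rewrite -phiE; [|exact: measurable_funeneg|by []].
  by apply: eq_integral => y _; rewrite !funenegE.
rewrite P N -muleBr //; last by rewrite fin_num_adde_defr.
by rewrite fineM // fin_numB pfin.
Qed.

Lemma cintegrable_transfer (f : Y -> R[i]) : cintegrable nu f ->
  cintegrable mu (fun x => f (phi x)).
Proof.
move=> [mf foo]; split; first exact: cmeasurable_comp.
rewrite (phiE (f := fun y => (cmod (f y))%:E)) //; last exact: measurable_ecmod.
by rewrite lte_mul_pinfty.
Qed.

Lemma cint_transfer (f : Y -> R[i]) : cintegrable nu f ->
  cint mu (fun x => f (phi x)) = c%:C * cint nu f.
Proof.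
move=> /cintegrableP[f1 f2]; apply/eqP; rewrite eq_complex ReM ImM /=.
rewrite !mul0r subr0 addr0; apply/andP; split; apply/eqP;
  exact: Rintegral_transfer.
Qed.

End transfer.

Section leb_change_of_variables.
Context (R : realType) (d : nat).
Notation leb := (@leb R d).
Implicit Types (f : 'rV[R]_d -> R[i]) (a : R) (b : 'rV[R]_d).

Lemma cintegrable_affine a b f : a != 0 -> cintegrable leb f ->
  cintegrable leb (fun x => f (a *: x + b)).
Proof.
move=> a0; apply: (cintegrable_transfer (c := `|a|^-1 ^+ d)).
- by rewrite exprn_ge0 // invr_ge0.
- exact: measurable_affine_row.
- by move=> g mg g0; exact: ge0_integral_affine.
Qed.

Lemma cint_affine a b f : a != 0 -> cintegrable leb f ->
  cint leb (fun x => f (a *: x + b)) = (`|a|^-1 ^+ d)%:C * cint leb f.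
Proof.
move=> a0; apply: cint_transfer => g mg g0; exact: ge0_integral_affine.
Qed.

Lemma affineN1 (b x : 'rV[R]_d) : b - x = (-1) *: x + b.
Proof. by rewrite scaleN1r addrC. Qed.

Lemma measurable_subl b : measurable_fun setT (fun x : 'rV[R]_d => b - x : 'rV[R]_d).
Proof.
under eq_fun do rewrite affineN1; exact: measurable_affine_row.
Qed.

Lemma cintegrable_reflect b f : cintegrable leb f ->
  cintegrable leb (fun x => f (b - x)).
Proof.
move=> fi; under eq_fun do rewrite affineN1.
by apply: cintegrable_affine => //; rewrite oppr_eq0 oner_eq0.
Qed.

Lemma cint_reflect b f : cintegrable leb f ->
  cint leb (fun x => f (b - x)) = cint leb f.
Proof.
move=> fi; under [in LHS]eq_fun do rewrite affineN1.
rewrite cint_affine ?oppr_eq0 ?oner_eq0 //.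
by rewrite normrN normr1 invr1 expr1n mul1r.
Qed.

Lemma ge0_integral_reflect b (f : 'rV[R]_d -> \bar R) :
  measurable_fun setT f -> (forall x, 0 <= f x)%E ->
  (\int[leb]_x f (b - x)%R = \int[leb]_x f x)%E.
Proof.
move=> mf f0; under eq_integral do rewrite affineN1.
rewrite ge0_integral_affine ?oppr_eq0 ?oner_eq0 //.
by rewrite normrN normr1 invr1 expr1n mul1e.
Qed.

Lemma ge0_integral_translate b (f : 'rV[R]_d -> \bar R) :
  measurable_fun setT f -> (forall x, 0 <= f x)%E ->
  (\int[leb]_x f (x - b)%R = \int[leb]_x f x)%E.
Proof.
move=> mf f0.
under eq_integral => x _ do rewrite -[x in f (x - _)]scale1r.
by rewrite ge0_integral_affine ?oner_eq0 // normr1 invr1 expr1n mul1e.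
Qed.

(** The two functions of a common parameter allow [z.1 - z.2] on a product space,
    which is what Fubini's theorem asks for in convolutions. *)
Lemma measurable_sub d1 (T : measurableType d1) (g h : T -> 'rV[R]_d) :
  measurable_fun setT g -> measurable_fun setT h ->
  measurable_fun setT (fun t => g t - h t).
Proof.
move=> mg mh; apply: measurable_row => i.
apply: (eq_measurable_fun (fun t => g t 0 i - h t 0 i)).
  by move=> x _; rewrite !mxE.
by apply: measurable_funB;
  [exact: (measurableT_comp (measurable_coord i) mg)
  |exact: (measurableT_comp (measurable_coord i) mh)].
Qed.

Lemma measurable_dotp d1 (T : measurableType d1) (g h : T -> 'rV[R]_d) :
  measurable_fun setT g -> measurable_fun setT h ->
  measurable_fun setT (fun t => dotp (g t) (h t)).
Proof.
move=> mg mh; apply: measurable_sum => i; apply: measurable_funM.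
  exact: (measurableT_comp (measurable_coord i) mg).
exact: (measurableT_comp (measurable_coord i) mh).
Qed.

(** An open set is the union of the boxes with rational centre and side
    [2 / n.+1] that it contains, and there are countably many of them. *)
Lemma open_row_measurable (A : set 'rV[R]_d) : open A -> measurable A.
Proof.
move=> oA.
pose box (z : 'rV[rat]_d * nat) : set 'rV[R]_d :=
  [set x | forall i, `|x 0 i - ratr (z.1 0 i)| < z.2.+1%:R^-1].
(* Boxes that stick out of [A] are replaced by the empty set, so that the union
   can run over the whole countable type of boxes. *)
pose F z := if pselect (box z `<=` A) then box z else set0.
have mbox z : measurable (box z).
  rewrite (_ : box z = \bigcap_(i in [set: 'I_d])
      [set x | `|x 0 i - ratr (z.1 0 i)| < z.2.+1%:R^-1]).
    apply: fin_bigcap_measurable => // i _.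
    rewrite [X in measurable X](_ : _ = (fun x : 'rV[R]_d => x 0 i) @^-1`
       (ball (ratr (z.1 0 i) : R) z.2.+1%:R^-1)).
      rewrite -[X in measurable X]setTI; apply: measurable_coord => //.
      exact: measurable_ball.
    by apply/seteqP; split => x /=; rewrite /ball /= distrC.
  apply/seteqP; split => x /= h.
    by move=> i _; exact: h.
  by move=> i; exact: (h i I).
have -> : A = \bigcup_z F z.
  apply/seteqP; split => x; last first.
    by move=> [z _]; rewrite /F; case: pselect => // zA; exact: zA.
  move=> Ax; have /nbhs_ballP[e /= e0 eA] := open_nbhs_nbhs (conj oA Ax).
  have [n ne] : exists n, n.+1%:R^-1 < e / 2.
    have e2 : 0 < e / 2 by rewrite divr_gt0.
    have [n _ hn] := near_infty_natSinv_lt (PosNum e2).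
    by exists n; exact: (hn n (leqnn n)).
  have q_ i : exists q : rat, `|x 0 i - ratr q| < n.+1%:R^-1.
    have [|q] := @rat_in_itvoo R (x 0 i - n.+1%:R^-1) (x 0 i + n.+1%:R^-1).
      by rewrite ltrD2l gt0_cp // invr_gt0.
    rewrite in_itv /= => /andP[h1 h2]; exists q.
    by rewrite distrC ltr_distl h1 h2.
  have [q qx] := choice q_.
  exists (\row_i q i, n) => //.
  rewrite /F; case: pselect => [_ i|]; first by rewrite mxE; exact: qx.
  move=> nA; exfalso; apply: nA => y by_; apply: eA; split => // i j.
  rewrite ord1 /ball /=.
  have := by_ j; have := qx j; rewrite /= mxE; move: (ratr _) => r h1 h2.
  rewrite (_ : x 0 j - y 0 j = (x 0 j - r) - (y 0 j - r)); last by ring.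
  rewrite (le_lt_trans (ler_normB _ _))// (lt_trans (ltrD h1 h2))//.
  by rewrite (lt_le_trans (ltrD ne ne))// -splitr.
apply: countable_bigcupT_measurable => [|z].
  exact: countableP.
by rewrite /F; case: pselect => zA; [exact: mbox|exact: measurable0].
Qed.

Lemma continuous_row_measurable (f : 'rV[R]_d -> R) :
  continuous f -> measurable_fun setT f.
Proof.
move=> /continuousP cf; apply: (measurability _ (RGenOpens.measurableE R)).
move=> B [C [a [b CE]] <-]; rewrite setTI CE; apply: open_row_measurable.
by apply: cf; exact: interval_open.
Qed.

End leb_change_of_variables.

(** * Product functions and Abel means *)

Section product_functions.
Context (R : realType).
Notation L1 := (@lebesgue_measure R).
Notation LT := (lebesgue_tuple R).

Lemma measurable_prod_tuple n (f : 'I_n -> R -> R) :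
  (forall i, measurable_fun setT (f i)) ->
  measurable_fun setT
    (fun t : n.-tuple (measurableTypeR R) => \prod_i f i (tnth t i)).
Proof.
move=> mf; apply: measurable_prod => i _.
exact: (measurableT_comp (mf i) (@measurable_tnth _ (measurableTypeR R) n i)).
Qed.

Lemma ge0_integral_prod_tuple n (f : 'I_n -> R -> R) :
  (forall i, measurable_fun setT (f i)) -> (forall i x, 0 <= f i x) ->
  (\int[LT n]_t (\prod_i f i (tnth t i))%:E =
   \prod_i \int[L1]_x (f i x)%:E)%E.
Proof.
elim: n f => [|n IH] f mf f0.
  rewrite ge0_integral_tuple0; last 2 first.
  - by apply/measurable_EFinP; exact: measurable_prod_tuple.
  - by move=> t; rewrite lee_fin prodr_ge0.
  by rewrite !big_ord0.
rewrite ge0_integral_tupleS; last 2 first.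
- by apply/measurable_EFinP; exact: measurable_prod_tuple.
- by move=> t; rewrite lee_fin prodr_ge0.
rewrite big_ord_recl -(IH (fun i => f (lift ord0 i))) //.
rewrite muleC -ge0_integralZl //; last 3 first.
- by apply/measurable_EFinP; exact: (mf ord0).
- by move=> x _; rewrite lee_fin.
- by apply: integral_ge0 => t _; rewrite lee_fin prodr_ge0.
apply: eq_integral => x _.
under eq_integral => t _.
  rewrite big_ord_recl tnth0 EFinM.
  under eq_bigr do rewrite tnthS.
  over.
rewrite ge0_integralZl //.
- by rewrite muleC.
- by apply/measurable_EFinP; apply: (measurable_prod_tuple (f := fun i => f (lift ord0 i))).
- by move=> t _; rewrite lee_fin prodr_ge0.
- by rewrite lee_fin.
Qed.

Lemma cint_tupleS n (f : n.+1.-tuple (measurableTypeR R) -> R[i]) :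
  cintegrable (LT n.+1) f ->
  cint (LT n.+1) f = cint L1 (fun x => cint (LT n) (fun t => f [tuple of x :: t])).
Proof.
move=> fi; have mc := @measurable_cons_pair _ (measurableTypeR R) n.
have E : forall g : n.+1.-tuple (measurableTypeR R) -> \bar R,
    measurable_fun setT g -> (forall y, 0 <= g y)%E ->
  (\int[(L1 \x LT n)%E]_x g (cons_pair x) = 1%:E * \int[LT n.+1]_y g y)%E.
  move=> g mg g0; rewrite mul1e ge0_integral_tupleS //.
  rewrite (fubini_tonelli1 (g \o @cons_pair _ _ n)) //.
    exact: measurableT_comp.
  by move=> x; exact: g0.
have := cint_transfer E fi; rewrite mul1r => <-.
rewrite -cint_prod //.
exact: (cintegrable_transfer _ mc E fi).
Qed.

Lemma cintegrable_prod_tuple n (f : 'I_n -> R -> R[i]) :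
  (forall i, cintegrable L1 (f i)) ->
  cintegrable (LT n) (fun t => \prod_i f i (tnth t i)).
Proof.
move=> fi; split.
  apply: cmeasurable_prod => i.
  exact: (cmeasurable_comp (fi i).1 (@measurable_tnth _ (measurableTypeR R) n i)).
under eq_integral do rewrite cmod_prod.
rewrite (ge0_integral_prod_tuple (f := fun i x => cmod (f i x))) //; last first.
  by move=> i; exact: measurable_cmod (fi i).1.
pose r i := fine (\int[L1]_x (cmod (f i x))%:E)%E.
rewrite (eq_bigr (fun i => (r i)%:E)); first by rewrite prodEFin ltry.
move=> i _; rewrite /r fineK // ge0_fin_numE ?integral_ge0 //.
by have [] := fi i.
Qed.

Lemma cint_prod_tuple n (f : 'I_n -> R -> R[i]) :
  (forall i, cintegrable L1 (f i)) ->
  cint (LT n) (fun t => \prod_i f i (tnth t i)) = \prod_i cint L1 (f i).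
Proof.
elim: n f => [|n IH] f fi.
  have E (g : 0.-tuple (measurableTypeR R) -> R) : measurable_fun setT g ->
      \int[LT 0]_t g t = g [tuple].
    move=> mg; rewrite /Rintegral /= integral_dirac //; last exact/measurable_EFinP.
    by rewrite diracT mul1e.
  have [m1 m2] : cmeasurable (fun t : 0.-tuple (measurableTypeR R) =>
      \prod_i f i (tnth t i)) by case: (cintegrable_prod_tuple fi).
  by rewrite big_ord0 /cint (E _ m1) (E _ m2) /= !big_ord0.
rewrite cint_tupleS; last exact: cintegrable_prod_tuple.
rewrite big_ord_recl mulrC -cintZ //; congr cint; apply/funext => x.
rewrite mulrC -(IH (fun i => f (lift ord0 i))) // -cintZ //; last first.
  exact: (cintegrable_prod_tuple (f := fun i => f (lift ord0 i))).
congr cint; apply/funext => t; rewrite big_ord_recl tnth0; congr (_ * _).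
by apply: eq_bigr => i _; rewrite tnthS.
Qed.

End product_functions.

Section abel_kernel.
Context (R : realType).
Notation L1 := (@lebesgue_measure R).
Implicit Types (e eta x : R).

(** The one-dimensional Fourier transform of [x |-> expR (- e * `|x|)], as shown
    in [cint_abel_wave]. *)
Definition abel e eta : R := 2 * e / (e ^+ 2 + eta ^+ 2).

(** An antiderivative of [expR (- e * x) * (1 + cos (eta * x))]. The cosine is
    shifted by 1 to make the integrand nonnegative, as the fundamental theorem
    of calculus on a half-line requires. *)
Let prim e eta x : R := expR (- e * x) *
  (- e^-1 + (- e * cos (eta * x) + eta * sin (eta * x)) / (e ^+ 2 + eta ^+ 2)).

Let prim_derive e eta x : 0 < e ->
  is_derive x 1 (prim e eta) (expR (- e * x) * (1 + cos (eta * x))).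
Proof.
move=> e0; have D : e ^+ 2 + eta ^+ 2 != 0.
  by rewrite lt0r_neq0 // ltr_pwDl ?exprn_gt0 ?sqr_ge0.
apply: is_derive_eq; rewrite /GRing.scale /=.
by field; rewrite D lt0r_neq0.
Qed.

Let prim_cvg e eta : 0 < e -> prim e eta x @[x --> +oo] --> (0 : R).
Proof.
move=> e0.
pose B := e^-1 + (e + `|eta|) / (e ^+ 2 + eta ^+ 2).
have Bx x : `|prim e eta x| <= B * expR (- e * x).
  rewrite /prim normrM [`|expR _|]gtr0_norm ?expR_gt0 // mulrC.
  rewrite ler_wpM2r ?expR_ge0 // /B (le_trans (ler_normD _ _)) // lerD //.
    by rewrite normrN gtr0_norm // invr_gt0.
  rewrite normrM [`|_^-1|]ger0_norm ?invr_ge0 ?addr_ge0 ?sqr_ge0 //.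
  rewrite ler_wpM2r ?invr_ge0 ?addr_ge0 ?sqr_ge0 //.
  rewrite (le_trans (ler_normD _ _)) // lerD // normrM.
    rewrite normrN (gtr0_norm e0) ger_pMr // ler_norml.
    by rewrite cos_geN1 cos_le1.
  by rewrite ler_piMr // ler_norml sin_geN1 sin_le1.
have lim0 : B * expR (- e * x) @[x --> +oo] --> (0 : R).
  rewrite -(mulr0 B); apply: cvgMl_tmp.
  rewrite (_ : (fun x => expR (- e * x)) =
               (fun z => expR (- z)) \o (fun z => e * z)); last first.
    by apply: eq_fun => x; rewrite mulNr.
  apply: (@cvg_comp _ _ _ _ _ _ (pinfty_nbhs R)); last exact: cvgr_expR.
  exact: gt0_cvgMry.
apply/norm_cvg0P; apply: (squeeze_cvgr _ (cvg_cst _) lim0).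
by apply: nearW => x; rewrite normr_ge0 Bx.
Qed.

Lemma integral_expR_1Dcos e eta : 0 < e ->
  (\int[L1]_(x in `[0%R, +oo[) (expR (- e * x) * (1 + cos (eta * x)))%:E =
   (e^-1 + e / (e ^+ 2 + eta ^+ 2))%:E)%E.
Proof.
move=> e0.
have D x := prim_derive eta x e0.
have cf : continuous (fun x => expR (- e * x) * (1 + cos (eta * x)) : R).
  move=> x; apply/differentiable_continuous/derivable1_diffP.
  exact: ex_derive.
rewrite (ge0_continuous_FTC2y _ _ (prim_cvg eta e0)) /=.
- rewrite -EFinB /prim !mulr0 expR0 cos0 sin0 mul1r mulr0 addr0 mulr1.
  by congr EFin; rewrite sub0r opprD opprK mulNr opprK.
- by move=> x _; rewrite mulr_ge0 ?expR_ge0 // -lerBlDl sub0r cos_geN1.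
- exact: continuous_subspaceT.
- by move=> x _; exact: ex_derive.
- apply: cvg_at_right_filter; apply/differentiable_continuous/derivable1_diffP.
  exact: ex_derive.
- by move=> x _; rewrite derive1E; exact: derive_val.
Qed.

End abel_kernel.

Section abel_transform.
Context (R : realType).
Notation L1 := (@lebesgue_measure R).
Implicit Types (e eta x : R).

Definition expRabs e x : R := expR (- e * `|x|).

Lemma expRabs_gt0 e x : 0 < expRabs e x. Proof. exact: expR_gt0. Qed.

Lemma continuous_expRabs e : continuous (expRabs e).
Proof.
move=> x; apply: (@continuous_comp _ _ _ (fun x => - e * `|x|) expR).
  by apply: continuousM; [exact: cst_continuous|exact: norm_continuous].
exact: continuous_expR.
Qed.

Lemma measurable_expRabs e : measurable_fun setT (expRabs e).
Proof. exact: (continuous_measurable_fun (@continuous_expRabs e)). Qed.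

Let integral_expRabs_1Dcos e eta : 0 < e ->
  (\int[L1]_x (expRabs e x * (1 + cos (eta * x)))%:E =
   (2 * (e^-1 + e / (e ^+ 2 + eta ^+ 2)))%:E)%E.
Proof.
move=> e0; rewrite ge0_symfun_integralT; last 3 first.
- by move=> x; apply: mulr_ge0; [exact: ltW (expRabs_gt0 _ _)
    |rewrite -lerBlDl sub0r cos_geN1].
- move=> x; apply: continuousM; first exact: continuous_expRabs.
  apply: continuousD; first exact: cst_continuous.
  apply: (@continuous_comp _ _ _ (fun x => eta * x) (@cos R)).
    by apply: continuousM; [exact: cst_continuous|exact: cvg_id].
  exact: continuous_cos.
- by move=> x /=; rewrite /expRabs normrN mulrN cosN.
rewrite EFinM -(integral_expR_1Dcos eta e0) set_itvcy; congr (_ * _)%E.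
by apply: eq_integral => x; rewrite inE /= => x0; rewrite /expRabs ger0_norm.
Qed.

Lemma integral_expRabs e : 0 < e ->
  (\int[L1]_x (expRabs e x)%:E = (2 / e)%:E)%E.
Proof.
move=> e0; have := integral_expRabs_1Dcos 0 e0.
under eq_integral => x _ do rewrite mul0r cos0 mulrC EFinM.
rewrite ge0_integralZl //; last 2 first.
- by apply/measurable_EFinP; exact: measurable_expRabs.
- by move=> x _; rewrite lee_fin ltW ?expRabs_gt0.
move=> H; have {}H : ((2^-1)%:E * ((1 + 1)%:E * \int[L1]_x (expRabs e x)%:E) =
    (2^-1)%:E * (2 * (e^-1 + e / (e ^+ 2 + 0 ^+ 2)))%:E)%E by rewrite H.
move: H; rewrite muleA -EFinM (_ : 2^-1 * (1 + 1) = 1 :> R); last by field.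
rewrite mul1e => ->; rewrite -EFinM; congr EFin.
by field; rewrite lt0r_neq0.
Qed.

Definition abel_wave e eta x : R[i] := (expRabs e x)%:C * cis (eta * x).

Lemma cmeasurable_abel_wave e eta : cmeasurable (abel_wave e eta).
Proof.
apply: cmeasurableM.
  by apply: cmeasurable_real; exact: measurable_expRabs.
by apply: cmeasurable_cis; apply: measurable_funM.
Qed.

Lemma cmod_abel_wave e eta x : cmod (abel_wave e eta x) = expRabs e x.
Proof. by rewrite cmodM cmod_cis mulr1 cmod_real gtr0_norm ?expRabs_gt0. Qed.

Lemma cintegrable_abel_wave e eta : 0 < e -> cintegrable L1 (abel_wave e eta).
Proof.
move=> e0; split; first exact: cmeasurable_abel_wave.
by under eq_integral do rewrite cmod_abel_wave; rewrite integral_expRabs ?ltry.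
Qed.

(** The real part is the difference of two integrals of nonnegative functions,
    [expRabs e x * (1 + cos (eta * x))] and [expRabs e x]. The imaginary part is
    odd, so reflection shows that its integral equals its own opposite. *)
Lemma cint_abel_wave e eta : 0 < e ->
  cint L1 (abel_wave e eta) = (abel e eta)%:C.
Proof.
move=> e0; have fi := cintegrable_abel_wave eta e0.
have [f1 f2] := (cintegrableP _ _).1 fi.
have ai : L1.-integrable setT (fun x => (expRabs e x)%:E).
  apply/integrableP; split.
    by apply/measurable_EFinP; exact: measurable_expRabs.
  under eq_integral do rewrite gee0_abs ?lee_fin ?ltW ?expRabs_gt0 //.
  by rewrite integral_expRabs ?ltry.
apply/eqP; rewrite eq_complex /=; apply/andP; split; apply/eqP.
  have H : \int[L1]_x (expRabs e x + complex.Re (abel_wave e eta x)) =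
      2 * (e^-1 + e / (e ^+ 2 + eta ^+ 2)).
    rewrite -[RHS]/(fine (2 * (e^-1 + e / (e ^+ 2 + eta ^+ 2)))%:E).
    rewrite -integral_expRabs_1Dcos //; congr fine; apply: eq_integral => x _.
    by rewrite ReM /= mul0r subr0 mulrDr mulr1.
  move: H; rewrite RintegralD // {1}/Rintegral integral_expRabs //= => H.
  apply: (addrI (2 / e)); rewrite H /abel.
  by field; rewrite ?lt0r_neq0 // ltr_pwDl ?exprn_gt0 ?sqr_ge0.
have E : forall g : measurableTypeR R -> \bar R, measurable_fun setT g ->
    (forall y, 0 <= g y)%E ->
    (\int[L1]_x g (-1 * x + 0)%R = 1%:E * \int[L1]_x g x)%E.
  move=> g mg g0; rewrite (ge0_integral_affine1 0 _ mg g0) ?oppr_eq0 ?oner_eq0 //.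
  by rewrite normrN normr1 invr1.
have := Rintegral_transfer E f2; rewrite mul1r => H.
have : \int[L1]_x complex.Im (abel_wave e eta x) =
       - \int[L1]_x complex.Im (abel_wave e eta x).
  rewrite -{1}H -[RHS]mulN1r -RintegralZl //; apply: eq_Rintegral => x _.
  rewrite !ImM /= /expRabs addr0 !mulN1r normrN mulrN sinN; ring.
by move=> /eqP; rewrite -addr_eq0 -mulr2n mulrn_eq0 /= => /eqP.
Qed.

End abel_transform.

Section row_products.
Context (R : realType) (d : nat).
Notation L1 := (@lebesgue_measure R).
Notation leb := (@leb R d).

Lemma measurable_prod_row (f : 'I_d -> R -> R) :
  (forall i, measurable_fun setT (f i)) ->
  measurable_fun setT (fun x : 'rV[R]_d => \prod_i f i (x 0 i)).
Proof.
move=> mf; apply: measurable_prod => i _.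
exact: (measurableT_comp (mf i) (measurable_coord i)).
Qed.

Lemma ge0_integral_prod_row (f : 'I_d -> R -> R) :
  (forall i, measurable_fun setT (f i)) -> (forall i x, 0 <= f i x) ->
  (\int[leb]_x (\prod_i f i (x 0%R i))%:E = \prod_i \int[L1]_x (f i x)%:E)%E.
Proof.
move=> mf f0; rewrite ge0_integral_leb; last 2 first.
- by apply/measurable_EFinP; exact: measurable_prod_row.
- by move=> x; rewrite lee_fin prodr_ge0.
rewrite -ge0_integral_prod_tuple //; apply: eq_integral => t _.
by congr EFin; apply: eq_bigr => i _; rewrite mxE.
Qed.

Let leb_transfer (g : 'rV[R]_d -> \bar R) : measurable_fun setT g ->
  (forall y, 0 <= g y)%E ->
  (\int[lebesgue_tuple R d]_t g (row_of_tuple t) = 1%:E * \int[leb]_x g x)%E.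
Proof. by move=> mg g0; rewrite mul1e ge0_integral_leb. Qed.

Lemma cintegrable_prod_row (f : 'I_d -> R -> R[i]) :
  (forall i, cintegrable L1 (f i)) ->
  cintegrable leb (fun x => \prod_i f i (x 0 i)).
Proof.
move=> fi; have [mt tfin] := cintegrable_prod_tuple fi.
have mf : cmeasurable (fun x : 'rV[R]_d => \prod_i f i (x 0 i)).
  apply: cmeasurable_prod => i.
  exact: (cmeasurable_comp (fi i).1 (measurable_coord i)).
split => //; rewrite ge0_integral_leb //; last exact: measurable_ecmod.
move: tfin; congr (_ < _)%E; apply: eq_integral => t _.
by congr ((cmod _)%:E); apply: eq_bigr => i _; rewrite mxE.
Qed.

Lemma cint_prod_row (f : 'I_d -> R -> R[i]) :
  (forall i, cintegrable L1 (f i)) ->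
  cint leb (fun x => \prod_i f i (x 0 i)) = \prod_i cint L1 (f i).
Proof.
move=> fi; rewrite -cint_prod_tuple //.
have := cint_transfer leb_transfer (cintegrable_prod_row fi).
rewrite mul1r => <-; congr cint; apply/funext => t.
by apply: eq_bigr => i _; rewrite mxE.
Qed.

(** The Cauchy density, unnormalised: an integrable positive function against
    which all kernels and symbols are compared. Being the limit of rescaled Abel
    kernels, it is also the weight that appears in Fourier inversion. *)
Definition cauchy_weight (x : 'rV[R]_d) : R := \prod_i (oneDsqr (x 0 i))^-1.

Lemma measurable_cauchy1 : measurable_fun setT (fun x : R => (oneDsqr x)^-1).
Proof. by apply: continuous_measurable_fun; exact: continuous_oneDsqrV. Qed.

Lemma oneDsqrV_gt0 (x : R) : 0 < (oneDsqr x)^-1.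
Proof. by rewrite invr_gt0 (lt_le_trans ltr01). Qed.

Lemma cauchy_weight_gt0 x : 0 < cauchy_weight x.
Proof. by rewrite /cauchy_weight prodr_gt0 // => i _; exact: oneDsqrV_gt0. Qed.

Lemma measurable_cauchy_weight : measurable_fun setT cauchy_weight.
Proof. exact: (measurable_prod_row (fun i => measurable_cauchy1)). Qed.

Lemma integral_cauchy1 : (\int[L1]_x (oneDsqr x)^-1%:E = pi%:E)%E.
Proof.
rewrite ge0_symfun_integralT; last 3 first.
- by move=> x; rewrite ltW // oneDsqrV_gt0.
- exact: continuous_oneDsqrV.
- by move=> x; rewrite /= /oneDsqr sqrrN.
rewrite -set_itvcy integral0y_oneDsqr -EFinM; congr EFin.
by rewrite mulrC divfK.
Qed.

Lemma integral_cauchy_weight : (\int[leb]_x (cauchy_weight x)%:E = (pi ^+ d)%:E)%E.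
Proof.
rewrite (ge0_integral_prod_row (f := fun _ x => (oneDsqr x)^-1)).
- under eq_bigr do rewrite integral_cauchy1.
  by rewrite prodEFin prodr_const card_ord.
- by move=> i; exact: measurable_cauchy1.
- by move=> i x; rewrite ltW // oneDsqrV_gt0.
Qed.

(** Integrate the product of the indicator of [[set c]] in the coordinate [i] and
    of Cauchy weights in the other coordinates: the integral is 0, although the
    integrand is positive on the whole hyperplane. *)
Lemma ae_coord_neq (i : 'I_d) (c : R) : {ae leb, forall x : 'rV[R]_d, x 0 i != c}.
Proof.
pose f j (t : R) : R := if j == i then \1_[set c] t else (oneDsqr t)^-1.
have mf j : measurable_fun setT (f j).
  rewrite /f; case: eqP => _; last exact: measurable_cauchy1.
  by apply: measurable_indic.
have f0 j t : 0 <= f j t.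
  by rewrite /f; case: eqP => _ //; rewrite ltW // oneDsqrV_gt0.
have I0 : (\int[leb]_x (\prod_j f j (x 0%R j))%:E = 0)%E.
  rewrite ge0_integral_prod_row // (bigD1 i) //= /f eqxx.
  rewrite integral_indic // setIT.
  by have /= -> := lebesgue_measure_set1 c; rewrite mul0e.
have mF : measurable_fun setT (fun x : 'rV[R]_d => (\prod_j f j (x 0 j))%:E).
  by apply/measurable_EFinP; exact: measurable_prod_row.
have /(ae_eq_integral_abs leb measurableT mF) : 
   (\int[leb]_x `|(\prod_j f j (x 0%R j))%:E| = 0)%E.
  rewrite -I0; apply: eq_integral => x _.
  by rewrite gee0_abs // lee_fin prodr_ge0.
apply: filterS => x /(_ I) [] /eqP; rewrite prodf_seq_eq0 => /hasP[j _ /=].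
rewrite /f; case: ifPn => [/eqP -> | _]; last first.
  by rewrite gt_eqF // oneDsqrV_gt0.
rewrite indicE; apply: contraTneq => ->.
by rewrite mem_set // oner_eq0.
Qed.

End row_products.

(** * The bracket [1 + |x_1| + ... + |x_d|] *)

Section bracket.
Context (R : realType) (d : nat).
Notation leb := (@leb R d).
Implicit Types (x y : 'rV[R]_d).

(** An l^1 variant of the Japanese bracket; it is submultiplicative
    ([bracketD]) without a constant. *)
Definition bracket x : R := 1 + \sum_i `|x 0 i|.

Lemma bracket_ge1 x : 1 <= bracket x.
Proof. by rewrite lerDl sumr_ge0. Qed.

Lemma bracket_gt0 x : 0 < bracket x.
Proof. exact: lt_le_trans ltr01 (bracket_ge1 x). Qed.

Lemma bracket_coord x i : 1 + `|x 0 i| <= bracket x.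
Proof. by rewrite lerD2l (bigD1 i) //= lerDl sumr_ge0. Qed.

Lemma bracket0 : bracket 0 = 1.
Proof. by rewrite /bracket big1 ?addr0 // => i _; rewrite mxE normr0. Qed.

Lemma bracketD x y : bracket (x + y) <= bracket x * bracket y.
Proof.
rewrite /bracket; set a := \sum_i `|x 0 i|; set b := \sum_i `|y 0 i|.
have a0 : 0 <= a by rewrite sumr_ge0.
have b0 : 0 <= b by rewrite sumr_ge0.
have : \sum_i `|(x + y) 0 i| <= a + b.
  by rewrite -big_split ler_sum // => i _; rewrite mxE ler_normD.
by move=> h; nra.
Qed.

Lemma measurable_bracket : measurable_fun setT bracket.
Proof.
apply: measurable_funD => //; apply: measurable_sum => i.
by apply: measurableT_comp => //; exact: measurable_coord.
Qed.

Lemma measurable_bracketV n : measurable_fun setT (fun x => bracket x ^- n).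
Proof.
rewrite (_ : (fun _ => _) = (fun r => r `^ (- n%:R)) \o bracket).
  by apply: measurableT_comp measurable_bracket; exact: measurable_powR.
by apply/funext => x /=; rewrite powRN powR_mulrn // ltW // bracket_gt0.
Qed.

(** Each factor [1 + x_i ^ 2] is at most [bracket x ^ 2]. *)
Lemma bracketV_le_cauchy x n : (2 * d <= n)%N ->
  bracket x ^- n <= cauchy_weight x.
Proof.
move=> dn; apply: (@le_trans _ _ (bracket x ^- (2 * d))).
  rewrite lef_pV2 ?posrE ?exprn_gt0 ?bracket_gt0 //.
  by rewrite ler_weXn2l // bracket_ge1.
rewrite /cauchy_weight prodfV lef_pV2 ?posrE; last 2 first.
- by rewrite exprn_gt0 ?bracket_gt0.
- by apply: prodr_gt0 => i _; rewrite -invr_gt0 oneDsqrV_gt0.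
rewrite exprM -[d in leRHS]card_ord -prodr_const; apply: ler_prod => i _.
rewrite (le_trans ler01) //=.
have := bracket_coord x i; have := normr_ge0 (x 0 i).
rewrite /oneDsqr -(real_normK (num_real (x 0 i))).
by move: (`|_|) (bracket x) => a b h1 h2; nra.
Qed.

Lemma integral_bracketV n : (2 * d <= n)%N ->
  (\int[leb]_x (bracket x ^- n)%:E < +oo)%E.
Proof.
move=> dn; apply: (@le_lt_trans _ _ (\int[leb]_x (cauchy_weight x)%:E)%E).
  apply: ge0_le_integral => //.
  - by move=> x _; rewrite lee_fin invr_ge0 exprn_ge0 // ltW // bracket_gt0.
  - by apply/measurable_EFinP; exact: measurable_bracketV.
  - by apply/measurable_EFinP; exact: measurable_cauchy_weight.
  - by move=> x _; rewrite lee_fin bracketV_le_cauchy.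
by rewrite integral_cauchy_weight ltry.
Qed.

End bracket.

(** * Decay and inversion of the inverse Fourier transform *)

Section fourier_kernel.
Context (R : realType) (d : nat).
Notation leb := (@leb R d).
Notation C := R[i].
Implicit Types (phi : 'rV[R]_d -> C) (x xi zeta : 'rV[R]_d).

Lemma dotpC x xi : dotp x xi = dotp xi x.
Proof. by apply: eq_bigr => i _; rewrite mulrC. Qed.

Lemma dotpDl x y xi : dotp (x + y) xi = dotp x xi + dotp y xi.
Proof. by rewrite -big_split; apply: eq_bigr => i _; rewrite mxE mulrDl. Qed.

Lemma dotpZl (a : R) x xi : dotp (a *: x) xi = a * dotp x xi.
Proof. by rewrite mulr_sumr; apply: eq_bigr => i _; rewrite mxE mulrA. Qed.

Lemma dotpNl x xi : dotp (- x) xi = - dotp x xi.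
Proof. by rewrite -scaleN1r dotpZl mulN1r. Qed.

Lemma dotpDr x y xi : dotp xi (x + y) = dotp xi x + dotp xi y.
Proof. by rewrite dotpC dotpDl !(dotpC xi). Qed.

Lemma dotpZr (a : R) x xi : dotp xi (a *: x) = a * dotp xi x.
Proof. by rewrite dotpC dotpZl dotpC. Qed.

Lemma dotpNr x xi : dotp xi (- x) = - dotp xi x.
Proof. by rewrite dotpC dotpNl dotpC. Qed.

Lemma dotp_delta x (i : 'I_d) : dotp x (delta_mx 0 i) = x 0 i.
Proof.
rewrite /dotp (bigD1 i) //= big1 => [|j ji]; rewrite !mxE ?eqxx ?mulr1 ?addr0 //.
by rewrite (negbTE ji) mulr0.
Qed.

Lemma inverse_fourierE phi x : cmeasurable phi ->
  inverse_fourier phi x =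
  ((2 * pi) ^- d)%:C * cint leb (fun xi => phi xi * cis (dotp x xi)).
Proof.
move=> mphi; rewrite -cintegralE //; apply: cmeasurableM => //.
apply: cmeasurable_cis; apply: measurable_dotp => //; exact: measurable_cst.
Qed.

Lemma cintegrable_cis phi (a : 'rV[R]_d -> R) : measurable_fun setT a ->
  cintegrable leb phi -> cintegrable leb (fun xi => phi xi * cis (a xi)).
Proof.
move=> ma [mphi phioo]; split.
  by apply: cmeasurableM => //; exact: cmeasurable_cis.
by under eq_integral do rewrite cmodM cmod_cis mulr1.
Qed.

Lemma measurable_dotp_cst x : measurable_fun setT (fun xi : 'rV[R]_d => dotp x xi).
Proof. by apply: measurable_dotp => //; exact: measurable_cst. Qed.

Lemma cmeasurable_inverse_fourier phi : cmeasurable phi ->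
  cmeasurable (inverse_fourier phi).
Proof.
move=> mphi; rewrite (_ : inverse_fourier phi = fun x => ((2 * pi) ^- d)%:C *
    cint leb (fun xi => phi xi * cis (dotp x xi))); last first.
  by apply/funext => x; rewrite inverse_fourierE.
apply: cmeasurableM; first exact: cmeasurable_cst.
apply: (@cmeasurable_cint_param _ _ _ _ _ leb
  (fun z : 'rV[R]_d * 'rV[R]_d => phi z.2 * cis (dotp z.1 z.2))).
apply: cmeasurableM; first exact: (cmeasurable_comp mphi measurable_snd).
apply: cmeasurable_cis.
by apply: measurable_dotp; [exact: measurable_fst|exact: measurable_snd].
Qed.

Lemma inverse_fourierB phi psi x : cintegrable leb phi -> cintegrable leb psi ->
  inverse_fourier (fun xi => phi xi - psi xi) x =
  inverse_fourier phi x - inverse_fourier psi x.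
Proof.
move=> iphi ipsi; have [[mphi _] [mpsi _]] := (iphi, ipsi).
rewrite !inverse_fourierE //; last exact: cmeasurableB.
rewrite -mulrBr -cintB; [|exact: cintegrable_cis (measurable_dotp_cst x) _..].
by congr (_ * cint _ _); apply/funext => xi; rewrite mulrBl.
Qed.

Lemma cmod_inverse_fourier_le phi x : cintegrable leb phi ->
  cmod (inverse_fourier phi x) <=
  2 * (2 * pi) ^- d * fine (\int[leb]_xi (cmod (phi xi))%:E)%E.
Proof.
move=> iphi; have [mphi phioo] := iphi.
have c0 : 0 <= (2 * pi) ^- d :> R.
  by rewrite invr_ge0 exprn_ge0 // mulr_ge0 // pi_ge0.
rewrite inverse_fourierE // cmodM cmod_real ger0_norm // mulrAC mulrC.
rewrite ler_wpM2r // -lee_fin EFinM fineK; last first.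
  by rewrite ge0_fin_numE // integral_ge0.
have := cmod_cint_le (cintegrable_cis (measurable_dotp_cst x) iphi).
by under eq_integral do rewrite cmodM cmod_cis mulr1.
Qed.

(** Finite differences take the place of derivatives in the decay estimate:
    [inverse_fourier] turns the difference with step [h] into multiplication by
    [cis (- h * x_i) - 1], which has modulus 2 for [h = pi / x_i]. *)
Definition fdiff (i : 'I_d) (h : R) phi : 'rV[R]_d -> C :=
  fun xi => phi (xi + h *: delta_mx 0 i) - phi xi.

Lemma cintegrable_translate phi b : cintegrable leb phi ->
  cintegrable leb (fun xi => phi (xi + b)).
Proof.
move=> iphi; under eq_fun do rewrite -[X in X + b]scale1r.
by apply: cintegrable_affine => //; exact: oner_neq0.
Qed.

Lemma cint_translate phi b : cintegrable leb phi ->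
  cint leb (fun xi => phi (xi + b)) = cint leb phi.
Proof.
move=> iphi; under eq_fun do rewrite -[X in X + b]scale1r.
by rewrite cint_affine ?oner_neq0 // normr1 invr1 expr1n mul1r.
Qed.

Lemma cintegrable_fdiff i h phi : cintegrable leb phi ->
  cintegrable leb (fdiff i h phi).
Proof.
by move=> iphi; apply: cintegrableB => //; exact: cintegrable_translate.
Qed.

Lemma cintegrable_iter_fdiff i h M phi : cintegrable leb phi ->
  cintegrable leb (iter M (fdiff i h) phi).
Proof. by move=> iphi; elim: M => //= M IH; exact: cintegrable_fdiff. Qed.

Lemma inverse_fourier_translate phi x b : cintegrable leb phi ->
  inverse_fourier (fun xi => phi (xi + b)) x =
  cis (- dotp x b) * inverse_fourier phi x.
Proof.
move=> iphi; have ib := cintegrable_translate b iphi.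
rewrite !inverse_fourierE; [|by case: iphi|by case: ib].
rewrite mulrCA; congr (_ * _).
rewrite -cintZ; last exact: cintegrable_cis (measurable_dotp_cst x) iphi.
rewrite -[RHS](cint_translate b); last first.
  by apply: cintegrableZ; exact: cintegrable_cis (measurable_dotp_cst x) iphi.
congr cint; apply/funext => xi.
rewrite mulrCA -cisD dotpDr; congr (_ * cis _); ring.
Qed.

Lemma inverse_fourier_fdiff i h phi x : cintegrable leb phi ->
  inverse_fourier (fdiff i h phi) x =
  (cis (- (h * x 0 i)) - 1) * inverse_fourier phi x.
Proof.
move=> iphi; rewrite inverse_fourierB //; last exact: cintegrable_translate.
by rewrite inverse_fourier_translate // dotpZr dotp_delta mulrBl mul1r.
Qed.

Lemma inverse_fourier_iter_fdiff i h M phi x : cintegrable leb phi ->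
  inverse_fourier (iter M (fdiff i h) phi) x =
  (cis (- (h * x 0 i)) - 1) ^+ M * inverse_fourier phi x.
Proof.
move=> iphi; elim: M => [|M IH] /=; first by rewrite mul1r.
rewrite inverse_fourier_fdiff; last exact: cintegrable_iter_fdiff.
by rewrite IH mulrA -exprS.
Qed.

Definition invn (n : nat) : R := n.+1%:R^-1.

(** What decay and inversion require of a symbol. The weight makes each iterated
    difference integrable, with the power of the step that smoothness gives;
    continuity is along the sequences that occur in the inversion formula. *)
Definition nice phi :=
  [/\ cmeasurable phi,
      exists B, forall xi, cmod (phi xi) <= B * cauchy_weight xi,
      forall i M, exists B, forall h, `|h| <= 1 -> forall xi,
        cmod (iter M (fdiff i h) phi xi) <= B * `|h| ^+ M * cauchy_weight xi &
      forall xi eta,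
        cmod (phi (invn n *: eta + xi) - phi xi) @[n --> \oo] --> (0 : R)].

Lemma integral_le_cauchy_weight (f : 'rV[R]_d -> R) (B : R) : measurable_fun setT f ->
  (forall xi, 0 <= f xi) ->
  (forall xi, f xi <= B * cauchy_weight xi) ->
  (\int[leb]_xi (f xi)%:E <= (B * pi ^+ d)%:E)%E.
Proof.
move=> mf f0 fB.
have B0 : 0 <= B.
  have := le_trans (f0 0) (fB 0).
  by rewrite pmulr_lge0 // cauchy_weight_gt0.
rewrite EFinM -integral_cauchy_weight -ge0_integralZl //; last 2 first.
- by apply/measurable_EFinP; exact: measurable_cauchy_weight.
- by move=> x _; rewrite lee_fin ltW // cauchy_weight_gt0.
apply: ge0_le_integral => //.
- by move=> x _; rewrite lee_fin.
- exact/measurable_EFinP.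
- apply: measurable_funeM.
  by apply/measurable_EFinP; exact: measurable_cauchy_weight.
- by move=> x _; rewrite -EFinM lee_fin.
Qed.

Lemma nice_integrable phi : nice phi -> cintegrable leb phi.
Proof.
move=> [mphi [B phiB] _ _]; split => //.
apply: le_lt_trans (ltry (B * pi ^+ d)).
by apply: integral_le_cauchy_weight => //; exact: measurable_cmod.
Qed.

(** For [`|x 0 i| >= pi] the step [h = pi / x 0 i] is at most 1, and [M] differences
    with this step multiply the kernel by [(- 2) ^+ M] and are of size
    [`|h| ^+ M], hence of size [`|x 0 i| ^- M]. *)
Lemma coord_decay phi (i : 'I_d) M : nice phi -> exists B, forall x,
  cmod (inverse_fourier phi x) * (1 + `|x 0 i|) ^+ M <= B.
Proof.
move=> nphi; have iphi := nice_integrable nphi.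
have [_ _ /(_ i M)[B hB] _] := nphi.
set K := inverse_fourier phi; set c : R := (2 * pi) ^- d.
have c0 : 0 <= c.
  by rewrite invr_ge0 exprn_ge0 // mulr_ge0 // pi_ge0.
pose B0 := 2 * c * fine (\int[leb]_xi (cmod (phi xi))%:E)%E.
have KB0 x : cmod (K x) <= B0 by exact: cmod_inverse_fourier_le.
have B00 : 0 <= B0 by rewrite (le_trans _ (KB0 0)).
pose B1 := 2 * c * (B * pi ^+ d).
have pi1 : 1 <= pi :> R by rewrite (le_trans _ (@pi_ge2 R)) // ler1n.
have pi0 : 0 < pi :> R by exact: pi_gt0.
exists (`|B1| * pi ^+ M + B0 * (1 + pi) ^+ M) => x.
have [xpi|xpi] := leP pi `|x 0 i|; last first.
  apply: ler_wpDl; first by rewrite mulr_ge0 // exprn_ge0 // ltW.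
  have p1 : 0 <= 1 + pi :> R by rewrite addr_ge0 // ltW.
  rewrite ler_pM ?exprn_ge0 ?addr_ge0 ?KB0 //.
  by apply: lerXn2r; rewrite ?nnegrE ?p1 ?addr_ge0 // lerD2l ltW.
apply: ler_wpDr; first by rewrite mulr_ge0 // exprn_ge0 // addr_ge0 // ltW.
have x0 : 0 < `|x 0 i| by rewrite (lt_le_trans pi0).
have xn0 : x 0 i != 0 by rewrite -normr_gt0.
pose h := pi / x 0 i.
have hE : `|h| = pi / `|x 0 i|.
  by rewrite /h normrM normfV [`|pi|]gtr0_norm.
have h1 : `|h| <= 1 by rewrite hE ler_pdivrMr // mul1r.
have := inverse_fourier_iter_fdiff i h M x iphi.
rewrite /h divfK // /cis cosN sinN cospi sinpi oppr0 => /(congr1 (@cmod R)).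
rewrite cmodM cmodX (_ : _ - 1 = (- 2)%:C); last first.
  by apply/eqP; rewrite eq_complex /= subr0 eqxx andbT -opprD.
rewrite cmod_real normrN ger0_norm // -/h -/K => HK.
have fi : cintegrable leb (iter M (fdiff i h) phi).
  exact: cintegrable_iter_fdiff.
have : 2 ^+ M * cmod (K x) <= B1 * `|h| ^+ M.
  rewrite -HK (le_trans (cmod_inverse_fourier_le x fi)) // /B1 -!mulrA.
  rewrite ler_wpM2l // ler_wpM2l // -lee_fin fineK; last first.
    by rewrite ge0_fin_numE ?integral_ge0 //; case: fi.
  rewrite [_ * `|h| ^+ M]mulrC mulrA.
  apply: integral_le_cauchy_weight => //.
  - by apply: measurable_cmod; case: fi.
  - by move=> xi; exact: hB.
rewrite hE expr_div_n => HKx.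
have {}HKx : 2 ^+ M * cmod (K x) * `|x 0 i| ^+ M <= `|B1| * pi ^+ M.
  rewrite -ler_pdivlMr ?exprn_gt0 // (le_trans HKx) // mulrA.
  apply: ler_wpM2r; first by rewrite invr_ge0 exprn_ge0.
  by apply: ler_wpM2r; [rewrite exprn_ge0 // ltW|exact: ler_norm].
apply: le_trans HKx; rewrite mulrAC -exprMn mulrC ler_wpM2r //.
apply: lerXn2r; rewrite ?nnegrE ?addr_ge0 ?mulr_ge0 //.
by rewrite mulr2n mulrDl mul1r lerD2r (le_trans pi1).
Qed.

Lemma bracket_le_max x : (0 < d)%N ->
  exists i, bracket x <= d%:R * (1 + `|x 0 i|).
Proof.
move=> d0; pose i0 := Ordinal d0.
have [i _ hi] := @arg_maxP _ _ _ i0 xpredT (fun i => `|x 0 i|) isT.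
exists i; rewrite mulrDr mulr1 lerD ?ler1n //.
by rewrite -[d in d%:R]card_ord mulr_natl -sumr_const ler_sum.
Qed.

(** The largest coordinate of [x] controls [bracket x] up to the factor [d]. *)
Lemma kernel_decay phi n : (0 < d)%N -> nice phi ->
  exists2 B, 0 <= B & forall x, cmod (inverse_fourier phi x) <= B * bracket x ^- n.
Proof.
move=> d0 nphi.
have [B hB] := choice (fun i => coord_decay i n nphi).
have B0 i : 0 <= B i.
  by rewrite (le_trans _ (hB i 0)) // mulr_ge0 // exprn_ge0 // addr_ge0.
exists (d%:R ^+ n * \sum_i B i); first by rewrite mulr_ge0 ?exprn_ge0 ?sumr_ge0.
move=> x; rewrite ler_pdivlMr ?exprn_gt0 ?bracket_gt0 //.
have [i hi] := bracket_le_max x d0.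
apply: (@le_trans _ _ (cmod (inverse_fourier phi x) *
    (d%:R * (1 + `|x 0 i|)) ^+ n)).
  rewrite ler_wpM2l //; apply: lerXn2r => //; rewrite nnegrE.
    by rewrite ltW ?bracket_gt0.
  by rewrite mulr_ge0 ?addr_ge0.
rewrite exprMn mulrCA ler_wpM2l ?exprn_ge0 // (le_trans (hB i x)) //.
by rewrite (bigD1 i) //= lerDl sumr_ge0.
Qed.

Lemma kernel_integrable phi : (0 < d)%N -> nice phi ->
  cintegrable leb (inverse_fourier phi).
Proof.
move=> d0 nphi; have mphi : cmeasurable phi by case: nphi.
have mK := cmeasurable_inverse_fourier mphi.
have [B B0 hB] := kernel_decay (2 * d) d0 nphi.
split => //; apply: le_lt_trans (ltry (B * pi ^+ d)).
apply: integral_le_cauchy_weight => //; first exact: measurable_cmod.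
move=> x; rewrite (le_trans (hB x)) // ler_wpM2l //.
exact: bracketV_le_cauchy.
Qed.

End fourier_kernel.

Section inversion.
Context (R : realType) (d : nat).
Notation leb := (@leb R d).
Notation C := R[i].
Implicit Types (phi : 'rV[R]_d -> C) (x xi zeta : 'rV[R]_d).

Lemma realcM (a b : R) : (a * b)%:C = a%:C * b%:C.
Proof. by apply/eqP; rewrite eq_complex /= !mulr0 mul0r subr0 addr0 !eqxx. Qed.

Lemma realc_mulVK (c : R) (z : C) : c != 0 -> (c^-1)%:C * (c%:C * z) = z.
Proof. by move=> c0; rewrite mulrA -realcM mulVf // mul1r. Qed.

Lemma realc_mulKV (c : R) (z : C) : c != 0 -> c%:C * ((c^-1)%:C * z) = z.
Proof. by move=> c0; rewrite mulrA -realcM divff // mul1r. Qed.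

Lemma cmod_cvg_unique (a : nat -> C) (A B : C) :
  cmod (a n - A) @[n --> \oo] --> (0 : R) ->
  cmod (a n - B) @[n --> \oo] --> (0 : R) -> A = B.
Proof.
move=> hA hB; apply/eqP; rewrite -subr_eq0; apply/eqP/cmod0_eq0/eqP.
have h : cmod (a n - A) + cmod (a n - B) @[n --> \oo] --> (0 : R).
  by rewrite -[0 in X in _ --> X](addr0 0); exact: cvgD.
have h0 : (fun _ : nat => cmod (A - B)) @ \oo --> (0 : R).
  apply: (squeeze_cvgr _ (cvg_cst _) h); apply: nearW => n.
  rewrite cmod_ge0 /= -(cmodN (a n - A)) (le_trans _ (cmodD _ _)) //.
  by rewrite opprB addrA subrK.
by apply/eqP; exact: (cvg_unique _ (cvg_cst _) h0).
Qed.

Definition abel_tensor (e : R) x : R := \prod_i expRabs e (x 0 i).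

Lemma abel_tensor_gt0 e x : 0 < abel_tensor e x.
Proof. by rewrite prodr_gt0 // => i _; exact: expRabs_gt0. Qed.

Lemma expRabs_le1 (e t : R) : 0 <= e -> expRabs e t <= 1.
Proof. by move=> e0; rewrite -expR0 ler_expR mulNr oppr_le0 mulr_ge0. Qed.

Lemma abel_tensor_le1 e x : 0 <= e -> abel_tensor e x <= 1.
Proof.
move=> e0; rewrite /abel_tensor -[leRHS](big1_eq (op := *%R) (index_enum 'I_d) xpredT).
by apply: ler_prod => i _; rewrite expRabs_le1 // ltW // expRabs_gt0.
Qed.

Lemma measurable_abel_tensor e : measurable_fun setT (abel_tensor e).
Proof. exact: (measurable_prod_row (fun i => measurable_expRabs e)). Qed.

Lemma cintegrable_abel_tensor e : 0 < e ->
  cintegrable leb (fun x => (abel_tensor e x)%:C).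
Proof.
move=> e0.
have := cintegrable_prod_row (f := fun (i : 'I_d) t => abel_wave e 0 t)
   (fun i => cintegrable_abel_wave 0 e0).
congr cintegrable; apply/funext => x; rewrite /abel_tensor rmorph_prod.
by apply: eq_bigr => i _; rewrite /abel_wave mul0r cis0 mulr1.
Qed.

Lemma cint_abel_tensor e xi : 0 < e ->
  cint leb (fun x => (abel_tensor e x)%:C * cis (dotp x xi)) =
  (\prod_i abel e (xi 0 i))%:C.
Proof.
move=> e0.
transitivity (\prod_i cint (@lebesgue_measure R) (abel_wave e (xi 0 i))); last first.
  by rewrite rmorph_prod; apply: eq_bigr => i _; exact: cint_abel_wave.
rewrite -cint_prod_row; last by move=> i; exact: cintegrable_abel_wave.
congr cint; apply/funext => x.
rewrite /abel_tensor rmorph_prod /dotp cis_sum -big_split /=.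
by apply: eq_bigr => i _; rewrite /abel_wave mulrC [x 0 i * _]mulrC mulrC.
Qed.

(** Abel kernels are dilates of the Cauchy weight, an approximate identity. *)
Lemma abel_scale (e eta : R) : 0 < e ->
  abel e (e * eta) = 2 * e^-1 * (oneDsqr eta)^-1.
Proof.
move=> e0; have := lt_le_trans ltr01 (oneDsqr_ge1 eta); rewrite /abel /oneDsqr => h.
by field; rewrite !lt0r_neq0 // -[X in X + _]mulr1 exprMn -mulrDr mulr_gt0 // exprn_gt0.
Qed.

Lemma abel_le (e eta : R) : 0 < e -> abel e eta <= 2 * e^-1.
Proof.
move=> e0; rewrite /abel ler_pdivrMr ?ltr_pwDl ?exprn_gt0 ?sqr_ge0 //.
rewrite mulrDr -mulrA expr2 mulKf ?lt0r_neq0 // lerDl.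
by rewrite mulr_ge0 ?sqr_ge0 // mulr_ge0 // invr_ge0 ltW.
Qed.

Lemma abel_ge0 (e eta : R) : 0 < e -> 0 <= abel e eta.
Proof.
by move=> e0; rewrite divr_ge0 ?addr_ge0 ?sqr_ge0 // mulr_ge0 // ltW.
Qed.

Lemma continuous_abel (e : R) : 0 < e -> continuous (abel e).
Proof.
move=> e0 x; apply: cvgM; first exact: cvg_cst.
apply: cvgV; first by rewrite lt0r_neq0 // ltr_pwDl ?exprn_gt0 ?sqr_ge0.
by apply: cvgD; [exact: cvg_cst|exact: exprn_continuous].
Qed.

Lemma cauchy_weight_le1 x : cauchy_weight x <= 1.
Proof.
rewrite /cauchy_weight -[leRHS](big1_eq (op := *%R) (index_enum 'I_d) xpredT).
apply: ler_prod => i _; rewrite ltW ?oneDsqrV_gt0 //=.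
exact: oneDsqrV_le1.
Qed.

Lemma nice_bounded phi : nice phi -> exists B, forall xi, cmod (phi xi) <= B.
Proof.
move=> [_ [B hB] _ _]; exists B => xi; rewrite (le_trans (hB xi)) //.
rewrite ler_piMr ?cauchy_weight_le1 //.
by have := le_trans (cmod_ge0 _) (hB xi); rewrite pmulr_lge0 // cauchy_weight_gt0.
Qed.

Lemma cintegrable_cauchy_weight :
  cintegrable leb (fun x => (cauchy_weight x)%:C).
Proof.
split; first by apply: cmeasurable_real; exact: measurable_cauchy_weight.
under eq_integral do rewrite cmod_real gtr0_norm ?cauchy_weight_gt0 //.
by rewrite integral_cauchy_weight ltry.
Qed.

(** The double integral over [x] and [xi] does not converge absolutely; the factor
    [abel_tensor e x] makes Fubini's theorem applicable. Integrating over [x]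
    first leaves a convolution of [phi] with a dilate of the Cauchy weight. *)
Lemma abel_mean phi zeta e : nice phi -> 0 < e ->
  cintegrable leb (inverse_fourier phi) ->
  cint leb (fun x => inverse_fourier phi x * cis (- dotp x zeta) *
     (abel_tensor e x)%:C) =
  (pi ^- d)%:C *
  cint leb (fun eta => phi (e *: eta + zeta) * (cauchy_weight eta)%:C).
Proof.
move=> nphi e0 iK.
have iphi := nice_integrable nphi; have [mphi phioo] := iphi.
have [c [c_gt0 KE cE]] : exists c : R, [/\ 0 < c, forall x,
    inverse_fourier phi x =
      c%:C * cint leb (fun xi => phi xi * cis (dotp x xi)) &
    c = ((2 * pi) ^+ d)^-1].
  exists ((2 * pi) ^+ d)^-1; split=> //.
    by rewrite invr_gt0; apply: exprn_gt0; apply: mulr_gt0 => //; exact: pi_gt0.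
  by move=> x; exact: inverse_fourierE.
pose F (z : 'rV[R]_d * 'rV[R]_d) : C :=
  (abel_tensor e z.1)%:C * (phi z.2 * cis (dotp z.1 (z.2 - zeta))).
have mF : cmeasurable F.
  apply: cmeasurableM.
    apply: cmeasurable_real.
    exact: (measurableT_comp (measurable_abel_tensor e) measurable_fst).
  apply: cmeasurableM; first exact: (cmeasurable_comp mphi measurable_snd).
  apply: cmeasurable_cis; apply: measurable_dotp; first exact: measurable_fst.
  by apply: measurable_sub; [exact: measurable_snd|exact: measurable_cst].
have FE z : cmod (F z) = abel_tensor e z.1 * cmod (phi z.2).
  by rewrite !cmodM cmod_cis mulr1 cmod_real gtr0_norm // abel_tensor_gt0.
have Foo : (\int[leb]_x \int[leb]_xi (cmod (F (x, xi)))%:E < +oo)%E.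
  have [mG Goo] := cintegrable_abel_tensor e0.
  rewrite (eq_integral (fun x => (\int[leb]_xi (cmod (phi xi))%:E) *
      (cmod (abel_tensor e x)%:C)%:E)%E); last first.
    move=> x _; rewrite muleC -ge0_integralZl //; last exact: measurable_ecmod.
    by apply: eq_integral => xi _; rewrite !cmodM cmod_cis mulr1 -EFinM.
  rewrite ge0_integralZl //; first rewrite lte_mul_pinfty ?ge0_fin_numE //.
  - by rewrite integral_ge0.
  - by rewrite integral_ge0.
    exact: measurable_ecmod.
  by rewrite integral_ge0.
have sw := cint_swap mF Foo.
have c0 : c != 0 by exact: lt0r_neq0.
have FK x : cint leb (fun xi => F (x, xi)) = (c^-1)%:C *
    (inverse_fourier phi x * cis (- dotp x zeta) * (abel_tensor e x)%:C).
  rewrite KE -(mulrA c%:C) -(mulrA c%:C) (realc_mulVK _ c0) -mulrA mulrC -cintZ.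
    congr cint; apply/funext => xi.
    by rewrite /F /= dotpDr dotpNr cisD; ring.
  exact: cintegrable_cis (measurable_dotp_cst x) iphi.
transitivity (c%:C * cint leb (fun x => cint leb (fun xi => F (x, xi)))).
  under [in RHS]eq_fun do rewrite FK.
  rewrite cintZ; first by rewrite (realc_mulKV _ c0).
  under eq_fun do rewrite mulrC.
  apply: (cintegrableM (C := 1)).
  - by apply: cmeasurable_real; exact: measurable_abel_tensor.
  - move=> x; rewrite cmod_real (gtr0_norm (abel_tensor_gt0 _ _)).
    exact: abel_tensor_le1 (ltW e0).
  - apply: cintegrable_cis iK; under eq_fun do rewrite -dotpNr.
    by apply: measurable_dotp => //; exact: measurable_cst.
rewrite sw.
pose H xi : C := phi xi * (\prod_i abel e ((xi - zeta) 0 i))%:C.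
transitivity (c%:C * cint leb H).
  congr (_ * cint _ _); apply/funext => xi; rewrite /H -(cint_abel_tensor _ e0).
  rewrite -cintZ; last first.
    apply: cintegrable_cis; last exact: cintegrable_abel_tensor.
    by apply: measurable_dotp => //; exact: measurable_cst.
  by congr cint; apply/funext => x; rewrite /F /= mulrCA.
have iH : cintegrable leb H.
  rewrite /H; under eq_fun do rewrite mulrC.
  apply: (cintegrableM (C := (2 * e^-1) ^+ d)); last exact: iphi.
    apply: cmeasurable_real; apply: measurable_prod => i _.
    apply: (measurableT_comp (continuous_measurable_fun (continuous_abel e0))).
    apply: (measurableT_comp (measurable_coord i)).
    by apply: measurable_sub => //; exact: measurable_cst.
  move=> xi; rewrite cmod_real ger0_norm; last first.
    by apply: prodr_ge0 => i _; exact: abel_ge0.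
  rewrite -[d in _ ^+ d]card_ord -prodr_const; apply: ler_prod => i _.
  by apply/andP; split; [exact: abel_ge0|exact: abel_le].
have eneq0 : e != 0 by rewrite lt0r_neq0.
have := cint_affine zeta eneq0 iH => HE.
have -> : cint leb H = (e ^+ d)%:C * cint leb (fun x => H (e *: x + zeta)).
  rewrite HE mulrA -realcM (gtr0_norm e0) exprVn divff ?mul1r; last first.
    exact: expf_neq0.
  by [].
rewrite mulrA -realcM.
have iHe := cintegrable_affine zeta eneq0 iH.
have He x : H (e *: x + zeta) =
    ((2 * e^-1) ^+ d)%:C * (phi (e *: x + zeta) * (cauchy_weight x)%:C).
  rewrite /H addrK mulrCA; congr (_ * _); rewrite -realcM; congr (_%:C).
  rewrite -[d in _ ^+ d]card_ord -prodr_const -big_split /=.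
  by apply: eq_bigr => i _; rewrite mxE (abel_scale _ e0).
under eq_fun do rewrite He.
rewrite cintZ; last first.
  have [B hB] := nice_bounded nphi.
  apply: (@cintegrableM _ _ _ _ _ _ B).
  - exact: (cmeasurable_comp mphi (measurable_affine_row _ _)).
  - by move=> x; exact: hB.
  - exact: cintegrable_cauchy_weight.
rewrite mulrA -realcM; congr (_%:C * _).
rewrite cE -!exprVn -!exprMn; congr (_ ^+ d).
have := lt0r_neq0 (@pi_gt0 R); move: (pi : R) => a a0.
by field; rewrite a0.
Qed.

Lemma invn_gt0 n : 0 < invn R n. Proof. by rewrite invr_gt0. Qed.

Lemma cvg_invn : invn R n @[n --> \oo] --> (0 : R).
Proof. exact: cvg_harmonic. Qed.

Lemma cvg_prod1 (I : Type) (r : seq I) (f : nat -> I -> R) :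
  (forall i, f n i @[n --> \oo] --> (1 : R)) ->
  \prod_(i <- r) f n i @[n --> \oo] --> (1 : R).
Proof.
move=> f1; elim: r => [|i r IH].
  by under eq_fun do rewrite big_nil; exact: cvg_cst.
under eq_fun do rewrite big_cons.
by have := cvgM (f1 i) IH; rewrite mulr1; exact.
Qed.

Lemma cvg_abel_tensor x : abel_tensor (invn R n) x @[n --> \oo] --> (1 : R).
Proof.
apply: cvg_prod1 => i; rewrite -expR0.
apply: (@cvg_comp _ _ _ (fun n => - invn R n * `|x 0 i|) expR _ (nbhs (0 : R))).
  have := cvgMr_tmp (b := `|x 0 i|) (cvgN cvg_invn).
  by rewrite oppr0 mul0r; exact.
exact: continuous_expR.
Qed.

Lemma cint_cauchy_weight :
  cint leb (fun x => (cauchy_weight x)%:C) = (pi ^+ d)%:C.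
Proof.
rewrite /cint /= /Rintegral integral0 integral_cauchy_weight //.
Qed.

(** Let [e] tend to 0 in [abel_mean]. By dominated convergence the left side tends
    to the integral without the Abel factor, because the kernel is integrable,
    and the right side to [phi zeta], because [phi] is bounded and continuous. *)
Theorem fourier_inversion phi zeta : nice phi ->
  cintegrable leb (inverse_fourier phi) ->
  cint leb (fun x => inverse_fourier phi x * cis (- dotp x zeta)) = phi zeta.
Proof.
move=> nphi iK; have [mphi _ _ cphi] := nphi.
pose a n := cint leb (fun x => inverse_fourier phi x * cis (- dotp x zeta) *
     (abel_tensor (invn R n) x)%:C).
have iKc : cintegrable leb (fun x => inverse_fourier phi x * cis (- dotp x zeta)).
  apply: cintegrable_cis iK; under eq_fun do rewrite -dotpNr.
  by apply: measurable_dotp => //; exact: measurable_cst.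
apply: (@cmod_cvg_unique a).
  apply: (cint_dominated_convergence _ iKc.1 iKc).
  - move=> n; apply: cmeasurableM; first by case: iKc.
    by apply: cmeasurable_real; exact: measurable_abel_tensor.
  - move=> n x; rewrite cmodM cmod_real (gtr0_norm (abel_tensor_gt0 _ _)).
    rewrite ler_piMr //; exact: abel_tensor_le1 (ltW (invn_gt0 n)).
  - by move=> x; exact: lexx.
  - move=> x; set z := _ * cis _.
    have E n : cmod (z * (abel_tensor (invn R n) x)%:C - z) =
        cmod z * `|abel_tensor (invn R n) x - 1|.
      rewrite -[X in _ - X]mulr1 -mulrBr cmodM -cmod_real; congr (_ * cmod _).
      by apply/eqP; rewrite eq_complex /= subr0 !eqxx.
    under eq_fun do rewrite E.
    have := cvgMl_tmp (a := cmod z)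
      (cvg_norm (cvgB (cvg_abel_tensor x) (cvg_cst (1 : R)))).
    by rewrite subrr normr0 mulr0; exact.
pose b n := cint leb (fun eta =>
  phi (invn R n *: eta + zeta) * (cauchy_weight eta)%:C).
have [B hB] := nice_bounded nphi.
have iBw : cintegrable leb (fun x => B%:C * (cauchy_weight x)%:C).
  by apply: cintegrableZ; exact: cintegrable_cauchy_weight.
have B0 : 0 <= B by rewrite (le_trans _ (hB 0)).
have lim : cmod (b n - cint leb (fun eta => phi zeta * (cauchy_weight eta)%:C))
    @[n --> \oo] --> (0 : R).
  apply: (cint_dominated_convergence _ _ iBw).
  - move=> n; apply: cmeasurableM; last by case: cintegrable_cauchy_weight.
    exact: (cmeasurable_comp mphi (measurable_affine_row _ _)).
  - apply: cmeasurableM; last by case: cintegrable_cauchy_weight.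
    exact: cmeasurable_cst.
  - move=> n x; rewrite !cmodM [cmod B%:C]cmod_real (ger0_norm B0).
    by apply: ler_wpM2r; [exact: cmod_ge0|exact: hB].
  - move=> x; rewrite !cmodM [cmod B%:C]cmod_real (ger0_norm B0).
    by apply: ler_wpM2r; [exact: cmod_ge0|exact: hB].
  - move=> x; under eq_fun do rewrite -mulrBl cmodM.
    have := cvgMr_tmp (b := cmod (cauchy_weight x)%:C) (cphi zeta x).
    by rewrite mul0r; exact.
rewrite cintZ in lim; last exact: cintegrable_cauchy_weight.
rewrite cint_cauchy_weight in lim.
have pi0 : pi ^+ d != 0 :> R by rewrite expf_neq0 // lt0r_neq0 // pi_gt0.
have E n : cmod (a n - phi zeta) =
    cmod ((pi ^+ d)^-1%:C) * cmod (b n - phi zeta * (pi ^+ d)%:C).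
  rewrite /a (abel_mean zeta nphi (invn_gt0 n) iK) -cmodM mulrBr; congr (cmod (_ - _)).
  by rewrite mulrCA -realcM mulVf // mulr1.
under eq_fun do rewrite E.
by have := cvgMl_tmp (a := cmod ((pi ^+ d)^-1)%:C) lim; rewrite mulr0; exact.
Qed.

End inversion.

(** * Symbols from a smooth bump *)

Section directional_differences.
Context (R : realType) (d : nat) (i : 'I_d).
Implicit Types (u : 'rV[R]_d -> R) (x : 'rV[R]_d).
Notation e_i := (delta_mx 0 i : 'rV[R]_d).

Definition rdiff (h : R) u : 'rV[R]_d -> R := fun x => u (x + h *: e_i) - u x.

Let ray u x (h : R) : (fun t : R => t^-1 *: (u (t *: e_i + (x + h *: e_i)) - u (x + h *: e_i))) =
  (fun t => t^-1 *: ((fun s : R => u (x + s *: e_i)) (t *: 1 + h) - u (x + h *: e_i))).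
Proof.
apply/funext => t; congr (_ *: (u _ - _)).
by rewrite scalerDl addrCA scaler1.
Qed.

Lemma is_derive_ray u x (h : R) : derivable u (x + h *: e_i) e_i ->
  is_derive h 1 (fun s : R => u (x + s *: e_i)) ('D_e_i u (x + h *: e_i)).
Proof.
move=> du; apply: DeriveDef.
  by rewrite /derivable -ray; exact: du.
by rewrite /derive -ray.
Qed.

(** The mean value theorem on the line through [x] in direction [i]. *)
Lemma rdiff_le u (B h : R) : (forall x, derivable u x e_i) ->
  (forall x, `|'D_e_i u x| <= B) -> forall x, `|rdiff h u x| <= B * `|h|.
Proof.
move=> du uB x; rewrite /rdiff.
have D (t : R) : is_derive t (1 : R) (fun s : R => u (x + s *: e_i)) ('D_e_i u (x + t *: e_i)).
  exact: is_derive_ray.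
have cf : continuous (fun s : R => u (x + s *: e_i)).
  by move=> t; apply/differentiable_continuous/derivable1_diffP; exact: ex_derive.
have [c ->] : exists c, u (x + h *: e_i) - u x = 'D_e_i u (x + c *: e_i) * h.
  have [h0|h0|->] := ltgtP h 0.
  - have [c _] := MVT h0 (fun t _ => D t) (continuous_subspaceT cf).
    rewrite scale0r addr0 sub0r => H; exists c.
    by apply: oppr_inj; rewrite opprB H mulrN.
  - have [c _] := MVT h0 (fun t _ => D t) (continuous_subspaceT cf).
    by rewrite scale0r addr0 subr0 => H; exists c.
  - by exists 0; rewrite scale0r addr0 subrr mulr0.
by rewrite normrM ler_wpM2r.
Qed.

Let pdi n u := pderiv (nseq n i) u.

Let quotient_translate u x b :
  (fun t : R => t^-1 *: (u (t *: e_i + (x + b)) - u (x + b))) =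
  (fun t => t^-1 *: (u (t *: e_i + x + b) - u (x + b))).
Proof. by apply/funext => t; rewrite addrA. Qed.

Lemma derivable_translate u x b : derivable u (x + b) e_i ->
  derivable (fun y => u (y + b)) x e_i.
Proof. by rewrite /derivable quotient_translate. Qed.

Lemma derive_translate u x b :
  'D_e_i (fun y => u (y + b)) x = 'D_e_i u (x + b).
Proof. by rewrite /derive quotient_translate. Qed.

Lemma pderiv_rdiff n h u : (forall m x, derivable (pdi m u) x e_i) ->
  pdi n (rdiff h u) = rdiff h (pdi n u).
Proof.
move=> du; elim: n => [//|n IH].
rewrite /pdi /= -/(pdi n _) IH; apply/funext => x.
rewrite /rdiff deriveB; last exact: du.
  by rewrite derive_translate.
exact: derivable_translate.
Qed.

(** Differences commute with derivatives, so [M] differences can be traded one by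
    one for [M] derivatives. *)
Lemma iter_rdiff_le M u (B h : R) : (forall m x, derivable (pdi m u) x e_i) ->
  (forall x, `|pdi M u x| <= B) -> forall x,
  `|iter M (rdiff h) u x| <= B * `|h| ^+ M.
Proof.
elim: M u B => [|M IH] u B du uB x; first by rewrite mulr1 uB.
rewrite iterSr exprS mulrA; apply: IH => [m y|y].
  rewrite pderiv_rdiff //; apply: derivableB; last exact: du.
  exact: derivable_translate.
rewrite pderiv_rdiff //; apply: rdiff_le => //; exact: du.
Qed.

End directional_differences.

Section compact_symbols.
Context (R : realType) (d : nat).
Notation C := R[i].
Implicit Types (phi : 'rV[R]_d -> C) (x xi : 'rV[R]_d).

Lemma realcD (a b : R) : (a + b)%:C = a%:C + b%:C :> C.
Proof. by apply/eqP; rewrite eq_complex /= addr0 !eqxx. Qed.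

Definition supported (r : R) phi :=
  forall xi (j : 'I_d), r <= `|xi 0 j| -> phi xi = 0.

Definition smooth_differences phi := forall i M, exists B, forall h, `|h| <= 1 ->
  forall xi, cmod (iter M (fdiff i h) phi xi) <= B * `|h| ^+ M.

Definition ray_continuous phi := forall xi eta,
  cmod (phi (invn R n *: eta + xi) - phi xi) @[n --> \oo] --> (0 : R).

Lemma supported_fdiff r i h phi : `|h| <= 1 -> supported r phi ->
  supported (r + 1) (fdiff i h phi).
Proof.
move=> h1 sphi xi j rj; rewrite /fdiff !(sphi _ j) ?subr0 //.
  by rewrite (le_trans _ rj) // lerDl.
rewrite !mxE eqxx /=; have : `|h * (j == i)%:R| <= 1.
  by case: (j == i); rewrite ?mulr1 // mulr0 normr0.
move: (h * _) => k k1.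
have := lerB_normD (xi 0 j) k; lra.
Qed.

Lemma supported_iter_fdiff r i h M phi : `|h| <= 1 -> supported r phi ->
  supported (r + M%:R) (iter M (fdiff i h) phi).
Proof.
move=> h1 sphi; elim: M => [|M IH]; first by rewrite addr0.
by rewrite -natr1 addrA; exact: supported_fdiff.
Qed.

(** On the support every coordinate is at most [r], so the Cauchy weight is at least
    [oneDsqr r ^- d] there. *)
Lemma supported_le_weight r phi (B : R) : 0 <= B -> supported r phi ->
  (forall xi, cmod (phi xi) <= B) ->
  forall xi, cmod (phi xi) <= B * oneDsqr r ^+ d * cauchy_weight xi.
Proof.
move=> B0 sphi phiB xi.
have w0 := cauchy_weight_gt0 xi.
have [/existsP[j rj]|/existsPn small] := boolP [exists j, r <= `|xi 0 j|].
  have o1 := lt_le_trans ltr01 (oneDsqr_ge1 r).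
  rewrite (sphi _ _ rj) cmod0.
  exact: mulr_ge0 (mulr_ge0 B0 (exprn_ge0 d (ltW o1))) (ltW w0).
rewrite -mulrA (le_trans (phiB xi)) // ler_peMr //.
rewrite /cauchy_weight -[d in _ ^+ d]card_ord -prodr_const -big_split /=.
rewrite -[leLHS](big1_eq (op := *%R) (index_enum 'I_d) xpredT).
apply: ler_prod => j _; rewrite ler01 /=.
rewrite ler_pdivlMr ?(lt_le_trans ltr01 (oneDsqr_ge1 _)) // mul1r.
rewrite /oneDsqr lerD2l -(real_normK (num_real (xi 0 j))) lerXn2r ?nnegrE //.
  by have := small j; rewrite -ltNge; have := normr_ge0 (xi 0 j); lra.
by have := small j; rewrite -ltNge; exact: ltW.
Qed.

Lemma compact_nice r phi : (0 < d)%N -> cmeasurable phi -> supported r phi ->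
  smooth_differences phi -> ray_continuous phi -> nice phi.
Proof.
move=> d0 mphi sphi dphi cphi; split => //.
- have [B hB] := dphi (Ordinal d0) 0%N.
  have {}hB xi : cmod (phi xi) <= `|B|.
    have := hB 0; rewrite normr0 ler01 => /(_ isT xi).
    by rewrite expr0 mulr1 /= => h; rewrite (le_trans h) // ler_norm.
  exists (`|B| * oneDsqr r ^+ d); exact: supported_le_weight.
- move=> i M; have [B hB] := dphi i M.
  exists (`|B| * oneDsqr (r + M%:R) ^+ d) => h h1 xi.
  rewrite [`|B| * _ * _]mulrAC.
  apply: supported_le_weight => //.
  + exact: supported_iter_fdiff.
  + move=> y; rewrite (le_trans (hB h h1 y)) // ler_wpM2r ?exprn_ge0 //.
    exact: ler_norm.
Qed.

(** The symbol of the partial derivative in direction [j], up to the factor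
    [i], which is immaterial for size estimates. *)
Definition coord_mul (j : 'I_d) phi : 'rV[R]_d -> C :=
  fun xi => (xi 0 j)%:C * phi xi.

(** Leibniz rule: the second difference of a coordinate vanishes, which leaves two
    terms. *)
Lemma iter_fdiff_coord_mul i j h M phi xi :
  iter M (fdiff i h) (coord_mul j phi) xi =
  (xi 0 j)%:C * iter M (fdiff i h) phi xi +
  (M%:R * h * (j == i)%:R)%:C *
    iter M.-1 (fdiff i h) phi (xi + h *: delta_mx 0 i).
Proof.
elim: M xi => [|M IH] xi; first by rewrite /= !mul0r addr0.
rewrite iterS {1}/fdiff !IH.
have E : (xi + h *: delta_mx 0 i) 0 j = xi 0 j + h * (j == i)%:R.
  by rewrite !mxE eqxx.
have natC n : (n.+1%:R)%:C = n%:R%:C + 1 :> C by rewrite -natr1 realcD.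
case: M {IH} => [|M].
  by rewrite E /= /fdiff !realcM realcD realcM natC; ring.
rewrite E [M.+1.-1]/= [M.+2.-1]/= !iterS; move: (iter M _ _) => P.
by rewrite /fdiff !realcM realcD realcM !natC; ring.
Qed.

Lemma supported_coord_mul r j phi : supported r phi ->
  supported r (coord_mul j phi).
Proof. by move=> sphi xi k rk; rewrite /coord_mul (sphi _ _ rk) mulr0. Qed.

Lemma cmeasurable_coord_mul j phi : cmeasurable phi ->
  cmeasurable (coord_mul j phi).
Proof.
move=> mphi; apply: cmeasurableM => //; apply: cmeasurable_real.
exact: measurable_coord.
Qed.

Lemma smooth_differences_coord_mul r j phi : 0 <= r -> supported r phi ->
  smooth_differences phi -> smooth_differences (coord_mul j phi).
Proof.
move=> r0 sphi dphi i M.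
have [B hB] := dphi i M; have [B' hB'] := dphi i M.-1.
exists ((r + M%:R) * `|B| + M%:R * `|B'|) => h h1 xi.
rewrite iter_fdiff_coord_mul mulrDl (le_trans (cmodD _ _)) // lerD //.
  rewrite cmodM cmod_real -mulrA.
  have [rj|rj] := leP (r + M%:R) `|xi 0 j|.
    rewrite (supported_iter_fdiff i h1 sphi rj) cmod0 mulr0.
    by rewrite !mulr_ge0 ?exprn_ge0 ?addr_ge0.
  rewrite ler_pM //; first exact: ltW.
  by rewrite (le_trans (hB h h1 xi)) // ler_wpM2r ?exprn_ge0 // ler_norm.
rewrite cmodM cmod_real; case: M hB hB' => [|M] hB hB'.
  by rewrite !mul0r normr0 mul0r.
rewrite !normrM normr_nat -!mulrA ler_wpM2l // exprS [leRHS]mulrCA.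
rewrite ler_wpM2l //.
have b1 : `|(j == i)%:R : R| <= 1.
  by case: (j == i); rewrite ?normr1 ?normr0.
rewrite -[leRHS]mul1r; apply: ler_pM => //.
rewrite (le_trans (hB' h h1 _)) //= ler_wpM2r ?exprn_ge0 //.
exact: ler_norm.
Qed.

Lemma cmod_cvg0 (a : nat -> C) : complex.Re (a n) @[n --> \oo] --> (0 : R) ->
  complex.Im (a n) @[n --> \oo] --> (0 : R) -> cmod (a n) @[n --> \oo] --> (0 : R).
Proof.
move=> hr hi.
have h : `|complex.Re (a n)| + `|complex.Im (a n)| @[n --> \oo] --> (0 : R).
  by have := cvgD (cvg_norm hr) (cvg_norm hi); rewrite normr0 addr0; exact.
apply: (squeeze_cvgr _ (cvg_cst _) h); apply: nearW => n.
by rewrite cmod_ge0 /=; exact: cmod_le_ReIm.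
Qed.

Lemma cvg_ray xi eta : (invn R n *: eta + xi : 'rV[R]_d) @[n --> \oo] --> xi.
Proof.
have h := cvgD (cvgZ (cvg_invn (R := R)) (cvg_cst eta)) (cvg_cst xi).
by rewrite scale0r add0r in h; exact: h.
Qed.

Lemma ray_continuousP phi : continuous (@complex.Re R \o phi) ->
  continuous (@complex.Im R \o phi) -> ray_continuous phi.
Proof.
move=> cr ci xi eta; apply: cmod_cvg0.
  have h := cvgB (cvg_comp _ _ (@cvg_ray xi eta) (cr xi)) (cvg_cst (complex.Re (phi xi))).
  rewrite subrr in h; under eq_fun do rewrite ReD ReN; exact: h.
have h := cvgB (cvg_comp _ _ (@cvg_ray xi eta) (ci xi)) (cvg_cst (complex.Im (phi xi))).
rewrite subrr in h; under eq_fun do rewrite ImD ImN; exact: h.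
Qed.

Lemma ray_continuous_coord_mul j phi : ray_continuous phi ->
  ray_continuous (coord_mul j phi).
Proof.
move=> cphi xi eta.
pose y n := invn R n *: eta + xi.
have h1 : `|xi 0 j| * cmod (phi (y n) - phi xi) +
    `|invn R n * eta 0 j| * (cmod (phi (y n) - phi xi) + cmod (phi xi))
    @[n --> \oo] --> (0 : R).
  have e0 : `|invn R n * eta 0 j| @[n --> \oo] --> (0 : R).
    have := cvg_norm (cvgMr_tmp (b := eta 0 j) (cvg_invn (R := R))).
    by rewrite mul0r normr0; apply.
  have := cvgD (cvgMl_tmp (a := `|xi 0 j|) (cphi xi eta))
    (cvgM e0 (cvgD (cphi xi eta) (cvg_cst (cmod (phi xi))))).
  by rewrite mulr0 mul0r addr0; apply.
apply: (squeeze_cvgr _ (cvg_cst _) h1); apply: nearW => n.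
rewrite cmod_ge0 /= -/(y n) /coord_mul.
rewrite (_ : y n 0 j = xi 0 j + invn R n * eta 0 j); last first.
  by rewrite !mxE addrC.
rewrite (_ : _ - _ = (xi 0 j)%:C * (phi (y n) - phi xi) +
    (invn R n * eta 0 j)%:C * (phi (y n) - phi xi + phi xi)); last first.
  by rewrite realcD; ring.
rewrite (le_trans (cmodD _ _)) // !cmodM !cmod_real lerD // ler_wpM2l //.
exact: cmodD.
Qed.

End compact_symbols.

Section admissible_symbols.
Context (R : realType) (d : nat) (phi0 : 'rV[R]_d -> R[i]).
Hypothesis adm : admissible phi0.
Implicit Types (x xi : 'rV[R]_d).

Lemma enorm_ge_coord xi j : `|xi 0 j| <= enorm xi.
Proof.
rewrite /enorm /dotp -sqrtr_sqr ler_wsqrtr // (bigD1 j) //= -expr2 lerDl.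
by apply: sumr_ge0 => k _; rewrite -expr2 sqr_ge0.
Qed.

Lemma enormZ (a : R) xi : enorm (a *: xi) = `|a| * enorm xi.
Proof.
rewrite /enorm dotpZl dotpC dotpZl mulrA -expr2 sqrtrM ?sqr_ge0 //.
by rewrite sqrtr_sqr.
Qed.

Lemma supported_admissible : supported 2 phi0.
Proof.
case: adm => _ _ v xi j h; apply: v; exact: le_trans (enorm_ge_coord xi j).
Qed.

Lemma schwartz_continuous_Re (f : 'rV[R]_d -> R[i]) : schwartz f ->
  continuous (@complex.Re R \o f).
Proof. by case=> s _ _ x; exact: differentiable_continuous (s [::] x). Qed.

Lemma schwartz_continuous_Im (f : 'rV[R]_d -> R[i]) : schwartz f ->
  continuous (@complex.Im R \o f).
Proof. by case=> _ s _ x; exact: differentiable_continuous (s [::] x). Qed.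

Lemma schwartz_cmeasurable (f : 'rV[R]_d -> R[i]) : schwartz f -> cmeasurable f.
Proof.
by move=> sf; split; apply: continuous_row_measurable;
  [exact: schwartz_continuous_Re|exact: schwartz_continuous_Im].
Qed.

Lemma schwartz_pderiv_bounded (f : 'rV[R]_d -> R[i]) M : schwartz f ->
  exists B, forall s x, (size s <= M)%N -> cmod (cpderiv s f x) <= B.
Proof.
case=> _ _ /(_ M) foo; exists (fine (schwartz_norm M f)) => s x sM.
have h : (((1 + enorm x) ^+ M * cmod (cpderiv s f x))%:E <= schwartz_norm M f)%E.
  by apply: ereal_sup_ubound; exists s, x.
have fin : schwartz_norm M f \is a fin_num.
  rewrite fin_numElt foo andbT (lt_le_trans _ h) // ltNyr //.
rewrite -lee_fin fineK // (le_trans _ h) // lee_fin ler_peMl //.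
by rewrite exprn_ege1 // lerDl sqrtr_ge0.
Qed.

Lemma smooth_differences_schwartz (f : 'rV[R]_d -> R[i]) : schwartz f ->
  smooth_differences f.
Proof.
move=> sf i M; have [B hB] := schwartz_pderiv_bounded M sf.
have [sr si _] := sf.
have ReE h m : @complex.Re R \o iter m (fdiff i h) f =
    iter m (rdiff i h) (@complex.Re R \o f).
  elim: m => //= m <-; apply/funext => x.
  by rewrite /= /fdiff ReD ReN.
have ImE h m : @complex.Im R \o iter m (fdiff i h) f =
    iter m (rdiff i h) (@complex.Im R \o f).
  elim: m => //= m <-; apply/funext => x.
  by rewrite /= /fdiff ImD ImN.
exists (B + B) => h h1 xi; rewrite mulrDl (le_trans (cmod_le_ReIm _)) // lerD //.
  rewrite -[complex.Re _]/((@complex.Re R \o _) xi) ReE.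
  apply: iter_rdiff_le => [m x|x]; first exact: diff_derivable.
  rewrite (le_trans _ (hB (nseq M i) x _)) ?size_nseq //.
  exact: (Re_le_cmod (cpderiv (nseq M i) f x)).
rewrite -[complex.Im _]/((@complex.Im R \o _) xi) ImE.
apply: iter_rdiff_le => [m x|x]; first exact: diff_derivable.
rewrite (le_trans _ (hB (nseq M i) x _)) ?size_nseq //.
exact: (Im_le_cmod (cpderiv (nseq M i) f x)).
Qed.

Hypothesis d0 : (0 < d)%N.

Lemma nice_admissible : nice phi0.
Proof.
have [sphi _ _] := adm.
apply: (compact_nice d0 _ supported_admissible).
- exact: schwartz_cmeasurable.
- exact: smooth_differences_schwartz.
- by apply: ray_continuousP;
    [exact: schwartz_continuous_Re|exact: schwartz_continuous_Im].
Qed.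

Lemma nice_coord_mul_admissible j : nice (coord_mul j phi0).
Proof.
have [sphi _ _] := adm.
apply: (compact_nice (r := 2) d0).
- by apply: cmeasurable_coord_mul; exact: schwartz_cmeasurable.
- exact/supported_coord_mul/supported_admissible.
- apply: (@smooth_differences_coord_mul _ _ 2) => //.
    exact: supported_admissible.
  exact: smooth_differences_schwartz.
- apply: ray_continuous_coord_mul; apply: ray_continuousP;
    [exact: schwartz_continuous_Re|exact: schwartz_continuous_Im].
Qed.

End admissible_symbols.

(** * Dilations and convolutions *)

Section dilation.
Context (R : realType) (d : nat).
Notation leb := (@leb R d).
Notation C := R[i].
Implicit Types (phi : 'rV[R]_d -> C) (x xi zeta : 'rV[R]_d) (lam : R).

Definition dilate lam phi : 'rV[R]_d -> C := fun xi => phi (lam^-1 *: xi).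

Lemma cmeasurable_dilate lam phi : cmeasurable phi -> cmeasurable (dilate lam phi).
Proof.
move=> mphi; rewrite /dilate; under eq_fun do rewrite -[_ *: _]addr0.
exact: (cmeasurable_comp mphi (measurable_affine_row _ _)).
Qed.

Lemma cintegrable_scale lam phi : 0 < lam -> cintegrable leb phi ->
  cintegrable leb (fun x => phi (lam *: x)).
Proof.
move=> lam0 iphi; under eq_fun do rewrite -[_ *: _]addr0.
by apply: cintegrable_affine iphi; exact: lt0r_neq0.
Qed.

Lemma cint_scale lam phi : 0 < lam -> cintegrable leb phi ->
  cint leb (fun x => phi (lam *: x)) = (lam^-1 ^+ d)%:C * cint leb phi.
Proof.
move=> lam0 iphi; under eq_fun do rewrite -[_ *: _]addr0.
rewrite (cint_affine 0 (lt0r_neq0 lam0) iphi) (gtr0_norm lam0).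
by [].
Qed.

Lemma cintegrable_dilate lam phi : 0 < lam -> cintegrable leb phi ->
  cintegrable leb (dilate lam phi).
Proof. by move=> lam0; apply: cintegrable_scale; rewrite invr_gt0. Qed.

Lemma inverse_fourier_dilate lam phi x : 0 < lam -> cintegrable leb phi ->
  inverse_fourier (dilate lam phi) x =
  (lam ^+ d)%:C * inverse_fourier phi (lam *: x).
Proof.
move=> lam0 iphi; have lamV0 : 0 < lam^-1 by rewrite invr_gt0.
rewrite !inverse_fourierE; [|by case: iphi|exact: cmeasurable_dilate iphi.1].
have ig : cintegrable leb (fun xi => phi xi * cis (dotp (lam *: x) xi)).
  exact: cintegrable_cis (measurable_dotp_cst _) iphi.
have := cint_scale lamV0 ig; rewrite invrK => H.
rewrite mulrCA -H; congr (_ * cint _ _); apply/funext => xi.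
rewrite /dilate dotpZl dotpZr mulrA divff ?mul1r //.
exact: lt0r_neq0.
Qed.

Lemma kernel_dilate_integrable lam phi : 0 < lam -> cintegrable leb phi ->
  cintegrable leb (inverse_fourier phi) ->
  cintegrable leb (inverse_fourier (dilate lam phi)).
Proof.
move=> lam0 iphi iK.
rewrite (_ : inverse_fourier _ = fun x => (lam ^+ d)%:C * inverse_fourier phi (lam *: x)).
  by apply: cintegrableZ; exact: cintegrable_scale.
by apply/funext => x; exact: inverse_fourier_dilate.
Qed.

(** Transported from the undilated symbol, so that decay and regularity are
    checked for a single symbol. *)
Lemma fourier_inversion_dilate lam phi zeta : 0 < lam -> nice phi ->
  cintegrable leb (inverse_fourier phi) ->
  cint leb (fun x => inverse_fourier (dilate lam phi) x * cis (- dotp x zeta)) =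
  dilate lam phi zeta.
Proof.
move=> lam0 nphi iK; have iphi := nice_integrable nphi.
have mc (z : 'rV[R]_d) : measurable_fun setT (fun x : 'rV[R]_d => - dotp x z).
  under eq_fun do rewrite -dotpNr.
  by apply: measurable_dotp => //; exact: measurable_cst.
have iKc := cintegrable_cis (mc (lam^-1 *: zeta)) iK.
have := cint_scale lam0 iKc; rewrite (fourier_inversion _ nphi iK) => H.
rewrite /dilate -(realc_mulKV (phi _) (c := lam ^+ d)); last first.
  by rewrite expf_neq0 // lt0r_neq0.
rewrite -exprVn -H -cintZ; last exact: (cintegrable_scale lam0 iKc).
congr cint; apply/funext => x; rewrite inverse_fourier_dilate //.
rewrite dotpZl dotpZr mulrA [lam * _]mulrA divff ?mul1r ?mulrA //.
exact: lt0r_neq0.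
Qed.

End dilation.

Lemma cmod_cint_le_fine (R : realType) (d : measure_display)
  (T : measurableType d) (mu : {measure set T -> \bar R}) (f : T -> R[i]) :
  cintegrable mu f ->
  cmod (cint mu f) <= 2 * fine (\int[mu]_x (cmod (f x))%:E)%E.
Proof.
move=> fi; rewrite -lee_fin [leRHS]EFinM fineK; first exact: cmod_cint_le.
by rewrite ge0_fin_numE ?integral_ge0 //; case: fi.
Qed.

Section convolution.
Context (R : realType) (d : nat).
Notation leb := (@leb R d).
Notation C := R[i].
Implicit Types (f g h a k : 'rV[R]_d -> C) (x y xi zeta : 'rV[R]_d).

Definition conv f g x := cint leb (fun y => f y * g (x - y)).

Definition cbounded f := exists B, forall x, cmod (f x) <= B.

Lemma conv_integrable h f x : cmeasurable h -> cbounded h ->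
  cintegrable leb f -> cintegrable leb (fun y => h y * f (x - y)).
Proof.
move=> mh [B hB] fi; apply: (cintegrableM mh hB).
exact: cintegrable_reflect.
Qed.

Lemma convB h f g x : cmeasurable h -> cbounded h ->
  cintegrable leb f -> cintegrable leb g ->
  conv h (fun y => f y - g y) x = conv h f x - conv h g x.
Proof.
move=> mh bh fi gi; rewrite /conv -cintB; try exact: conv_integrable.
by congr cint; apply/funext => y; rewrite mulrBr.
Qed.

Lemma convBl h k f x : cmeasurable h -> cbounded h ->
  cmeasurable k -> cbounded k -> cintegrable leb f ->
  conv (fun y => h y - k y) f x = conv h f x - conv k f x.
Proof.
move=> mh bh mk bk fi; rewrite /conv -cintB; try exact: conv_integrable.
by congr cint; apply/funext => y; rewrite mulrBl.
Qed.

Lemma cmeasurable_conv f g : cmeasurable f -> cmeasurable g ->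
  cmeasurable (conv f g).
Proof.
move=> mf mg; apply: (@cmeasurable_cint_param _ _ _ _ _ leb
  (fun z : 'rV[R]_d * 'rV[R]_d => f z.2 * g (z.1 - z.2))).
apply: cmeasurableM; first exact: (cmeasurable_comp mf measurable_snd).
apply: (cmeasurable_comp mg).
by apply: measurable_sub; [exact: measurable_fst|exact: measurable_snd].
Qed.

Lemma conv_bounded h f : cmeasurable h -> cbounded h ->
  cintegrable leb f -> cbounded (conv h f).
Proof.
move=> mh bh fi; have [B hB] := bh; have [mf foo] := fi.
have B0 : 0 <= B by exact: le_trans (cmod_ge0 _) (hB 0).
have ffin : (\int[leb]_x (cmod (f x))%:E)%E \is a fin_num.
  by rewrite ge0_fin_numE // integral_ge0.
exists (2 * (B * fine (\int[leb]_x (cmod (f x))%:E)%E)) => x.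
rewrite -lee_fin (le_trans (cmod_cint_le (conv_integrable x mh bh fi))) //.
rewrite EFinM lee_pmul2l // EFinM fineK //.
rewrite -(ge0_integral_reflect x (f := fun y => (cmod (f y))%:E)) //; last first.
  exact: measurable_ecmod.
have mr : measurable_fun setT (fun y => (cmod (f (x - y)))%:E).
  by apply: measurable_ecmod; exact: (cmeasurable_comp mf (measurable_subl x)).
rewrite -ge0_integralZl //.
apply: ge0_le_integral => //.
- by apply: measurable_ecmod; case: (conv_integrable x mh bh fi).
- exact: measurable_funeM.
- by move=> y _; rewrite cmodM -EFinM lee_fin ler_wpM2r.
Qed.

(** The convolution theorem. The Fourier transform [m] of [k] is given explicitly,
    because it is known from the inversion formula in each use. *)
Lemma conv_kernel k m a x : cintegrable leb k -> cintegrable leb a ->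
  (forall zeta, cint leb (fun y => k y * cis (- dotp y zeta)) = m zeta) ->
  cmeasurable (fun xi => a xi * m xi) ->
  conv k (inverse_fourier a) x = inverse_fourier (fun xi => a xi * m xi) x.
Proof.
move=> ik ia km mam; have [mk koo] := ik; have [ma aoo] := ia.
rewrite inverse_fourierE //.
have [c cE] : exists c : C, c = ((2 * pi) ^- d)%:C by exists ((2 * pi) ^- d)%:C.
have aE z : inverse_fourier a z = c * cint leb (fun xi => a xi * cis (dotp z xi)).
  by rewrite inverse_fourierE // cE.
rewrite -cE {cE}.
pose F (z : 'rV[R]_d * 'rV[R]_d) : C :=
  k z.1 * (c * (a z.2 * cis (dotp (x - z.1) z.2))).
have mF : cmeasurable F.
  apply: cmeasurableM; first exact: (cmeasurable_comp mk measurable_fst).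
  apply: cmeasurableM; first exact: cmeasurable_cst.
  apply: cmeasurableM; first exact: (cmeasurable_comp ma measurable_snd).
  apply: cmeasurable_cis; apply: measurable_dotp; last exact: measurable_snd.
  by apply: measurable_sub; [exact: measurable_cst|exact: measurable_fst].
have Foo : (\int[leb]_y \int[leb]_xi (cmod (F (y, xi)))%:E < +oo)%E.
  have [mca caoo] := cintegrableZ c ia.
  rewrite (eq_integral (fun y => (\int[leb]_xi (cmod (c * a xi))%:E) *
      (cmod (k y))%:E)%E); last first.
    move=> y _; rewrite muleC -ge0_integralZl //; last exact: measurable_ecmod.
    by apply: eq_integral => xi _; rewrite !cmodM cmod_cis mulr1 -EFinM.
  rewrite ge0_integralZl //; first rewrite lte_mul_pinfty ?ge0_fin_numE //.
  - by rewrite integral_ge0.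
  - by rewrite integral_ge0.
  - exact: measurable_ecmod.
  - by rewrite integral_ge0.
have sw := cint_swap mF Foo.
have iac z : cintegrable leb (fun xi => a xi * cis (dotp z xi)).
  exact: cintegrable_cis (measurable_dotp_cst _) ia.
have iam : cintegrable leb (fun xi => a xi * m xi).
  have [B mB] : cbounded m.
    exists (2 * fine (\int[leb]_x (cmod (k x))%:E)%E) => zeta.
    have ikc : cintegrable leb (fun y => k y * cis (- dotp y zeta)).
      apply: cintegrable_cis ik; under eq_fun do rewrite -dotpNr.
      by apply: measurable_dotp => //; exact: measurable_cst.
    have := cmod_cint_le_fine ikc; rewrite km.
    by under eq_integral do rewrite cmodM cmod_cis mulr1.
  apply: (cintegrable_le (C := B) mam ia) => xi.
  by rewrite cmodM mulrC; apply: ler_wpM2r; [exact: cmod_ge0|exact: mB].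
have E xi : cint leb (fun y => F (y, xi)) = c * (a xi * m xi * cis (dotp x xi)).
  rewrite -km mulrAC mulrA -cintZ.
    congr cint; apply/funext => y; rewrite /F /= dotpDl dotpNl cisD; ring.
  apply: cintegrable_cis ik; under eq_fun do rewrite -dotpNr.
  by apply: measurable_dotp => //; exact: measurable_cst.
transitivity (cint leb (fun y => cint leb (fun xi => F (y, xi)))).
  congr cint; apply/funext => y; rewrite aE -cintZ; last exact: iac.
  by rewrite -cintZ; last exact: cintegrableZ (iac _).
rewrite sw; under eq_fun do rewrite E.
rewrite cintZ; last exact: cintegrable_cis (measurable_dotp_cst _) iam.
by [].
Qed.

(** By Fubini's theorem both sides are the double integral of
    [g z * h y * f (x - z - y)]. *)
Lemma conv_swap h f g x : cmeasurable h -> cbounded h ->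
  cintegrable leb f -> cbounded f -> cintegrable leb g ->
  conv g (conv h f) x = conv h (conv g f) x.
Proof.
move=> mh bh fi [Bf hBf] gi; have [[mf foo] [mg goo]] := (fi, gi); have [B hB] := bh.
have B0 : 0 <= B by exact: le_trans (cmod_ge0 _) (hB 0).
pose F (z : 'rV[R]_d * 'rV[R]_d) : C := g z.1 * (h z.2 * f (x - z.1 - z.2)).
have mF : cmeasurable F.
  apply: cmeasurableM; first exact: (cmeasurable_comp mg measurable_fst).
  apply: cmeasurableM; first exact: (cmeasurable_comp mh measurable_snd).
  apply: (cmeasurable_comp mf).
  apply: measurable_sub; last exact: measurable_snd.
  by apply: measurable_sub; [exact: measurable_cst|exact: measurable_fst].
have Foo : (\int[leb]_z \int[leb]_y (cmod (F (z, y)))%:E < +oo)%E.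
  have H : (B%:E * \int[leb]_y (cmod (f y))%:E * \int[leb]_z (cmod (g z))%:E < +oo)%E.
    rewrite lte_mul_pinfty //.
    - by rewrite mule_ge0 // integral_ge0.
    - by rewrite fin_numM // ge0_fin_numE // integral_ge0.
  apply: le_lt_trans H; rewrite -ge0_integralZl //; last 2 first.
  - exact: measurable_ecmod.
  - by rewrite mule_ge0 // integral_ge0.
  have mcF : measurable_fun setT (fun z => (cmod (F z))%:E) by exact: measurable_ecmod.
  apply: ge0_le_integral => //.
  - by move=> z _; exact: integral_ge0.
  - exact: (measurable_fun_fubini_tonelli_F (fun z => (cmod (F z))%:E)).
  - by apply: measurable_funeM; exact: measurable_ecmod.
  - move=> z _.
    have mr : measurable_fun setT (fun y => (cmod (f (x - z - y)))%:E).
      apply: measurable_ecmod.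
      exact: (cmeasurable_comp mf (measurable_subl (x - z))).
    rewrite -(ge0_integral_reflect (x - z) (f := fun y => (cmod (f y))%:E)) //; last first.
      exact: measurable_ecmod.
    rewrite muleC muleA -ge0_integralZl //; last by rewrite mule_ge0.
    apply: ge0_le_integral => //.
    - exact: (measurable_fun_pair2 z mcF).
    - exact: measurable_funeM.
    - move=> y _; rewrite /F /= !cmodM -!EFinM lee_fin -mulrA ler_wpM2l //.
      by rewrite ler_wpM2r.
have sw := cint_swap mF Foo.
transitivity (cint leb (fun z => cint leb (fun y => F (z, y)))).
  congr cint; apply/funext => z; rewrite /conv -cintZ; first reflexivity.
  exact: conv_integrable.
rewrite sw; congr cint; apply/funext => y; rewrite /conv -cintZ; last first.
  under eq_fun do rewrite mulrC.
  apply: (@cintegrableM _ _ _ _ _ _ Bf); last exact: gi.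
    exact: (cmeasurable_comp mf (measurable_subl (x - y))).
  by move=> z; exact: hBf.
by congr cint; apply/funext => z; rewrite /F /= mulrCA addrAC.
Qed.

End convolution.

(** * Plancherel-Polya-Peetre estimate for exponents below one *)

Lemma ge0_le_integralT (R : realType) (d : measure_display)
  (T : measurableType d) (mu : {measure set T -> \bar R}) (f g : T -> \bar R) :
  (forall x, 0 <= f x)%E -> measurable_fun setT f -> measurable_fun setT g ->
  (forall x, f x <= g x)%E -> (\int[mu]_x f x <= \int[mu]_x g x)%E.
Proof. by move=> f0 mf mg fg; exact: ge0_le_integral. Qed.

Section peetre.
Context (R : realType) (d : nat).
Notation leb := (@leb R d).
Notation C := R[i].
Variables (u : 'rV[R]_d -> C) (lam p : R) (n : nat).
Hypothesis mu_ : cmeasurable u.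
Hypothesis bu : cbounded u.
Hypothesis lam0 : 0 < lam.
Hypothesis p0 : 0 < p.
Hypothesis p1 : p < 1.
Hypothesis np : (2 * d)%:R <= n%:R * p.
Implicit Types (x y z w : 'rV[R]_d).

Let b y : R := bracket (lam *: y) ^+ n.

Let b_gt0 y : 0 < b y.
Proof. by rewrite exprn_gt0 // bracket_gt0. Qed.

Let b_ge1 y : 1 <= b y.
Proof. by rewrite exprn_ege1 // bracket_ge1. Qed.

Let b_sub y z : b (y + z) <= b y * b z.
Proof.
rewrite /b scalerDr -exprMn; apply: lerXn2r; rewrite ?nnegrE.
- by rewrite ltW // bracket_gt0.
- by rewrite mulr_ge0 // ltW // bracket_gt0.
- exact: bracketD.
Qed.

Let measurable_scaled : measurable_fun setT (fun y : 'rV[R]_d => lam *: y : 'rV[R]_d).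
Proof. by under eq_fun do rewrite -[_ *: _]addr0; exact: measurable_affine_row. Qed.

Let mb : measurable_fun setT b.
Proof.
apply: measurable_funX; exact: (measurableT_comp (@measurable_bracket R d) measurable_scaled).
Qed.

Definition peetre_set x : set R := [set r | exists y, r = cmod (u (x - y)) / b y].

(** The Peetre maximal function of [u] at scale [lam]. *)
Definition peetre x : R := sup (peetre_set x).

Let ubs x : has_sup (peetre_set x).
Proof.
split; first by exists (cmod (u (x - 0)) / b 0), 0.
have [B hB] := bu; exists B => _ [y ->].
rewrite ler_pdivrMr //; apply: (le_trans (hB _)).
have B0 : 0 <= B by exact: le_trans (cmod_ge0 _) (hB 0).
by rewrite ler_peMr.
Qed.

Let peetre_ub x y : cmod (u (x - y)) <= peetre x * b y.
Proof.
rewrite -ler_pdivrMr //; apply: (sup_upper_bound (ubs x)).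
by exists y.
Qed.

Let peetre_ge0 x : 0 <= peetre x.
Proof.
have := peetre_ub x 0; have -> : b 0 = 1.
  by rewrite /b scaler0 bracket0 expr1n.
by rewrite mulr1; exact: le_trans.
Qed.

(** This weight is integrable because of the hypothesis [np]. *)
Let e z : R := (b z)^-1 `^ p.

Let e_ge0 z : 0 <= e z. Proof. exact: powR_ge0. Qed.

Let me : measurable_fun setT e.
Proof.
have -> : e = (fun r => r `^ (- 1 * p)) \o b.
  apply/funext => z; rewrite /e /= powRrM; congr (_ `^ _).
  by rewrite powR_inv1 // ltW.
by apply: measurableT_comp mb; exact: measurable_powR.
Qed.

Let e_le z : e z <= bracket (lam *: z) ^- (2 * d).
Proof.
have b1 := bracket_ge1 (lam *: z); have b0 := ltW (bracket_gt0 (lam *: z)).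
rewrite /e /b -!powR_invn // -powRrM; apply: ler_powR => //.
by rewrite mulNr lerN2.
Qed.

(** The weighted mean of [`|u| `^ p] that dominates [peetre x `^ p]. *)
Let J x : \bar R := (\int[leb]_w ((cmod (u w)) `^ p * e (x - w))%:E)%E.

Let mf : measurable_fun setT
  (fun z : 'rV[R]_d * 'rV[R]_d => ((cmod (u z.2)) `^ p * e (z.1 - z.2))%:E).
Proof.
apply/measurable_EFinP; apply: measurable_funM.
  apply: (measurableT_comp (measurable_powR p)).
  exact: (measurableT_comp (measurable_cmod mu_) measurable_snd).
apply: (measurableT_comp me).
by apply: measurable_sub; [exact: measurable_fst|exact: measurable_snd].
Qed.

Let f_ge0 x w : 0 <= (cmod (u w)) `^ p * e (x - w).
Proof. by rewrite mulr_ge0 ?powR_ge0. Qed.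

Let mJ : measurable_fun setT J.
Proof.
apply: (measurable_fun_fubini_tonelli_F
  (fun z : 'rV[R]_d * 'rV[R]_d => ((cmod (u z.2)) `^ p * e (z.1 - z.2))%:E)) => //.
by move=> z; rewrite lee_fin f_ge0.
Qed.

Let J_ge0 x : (0 <= J x)%E.
Proof. by apply: integral_ge0 => w _; rewrite lee_fin f_ge0. Qed.

Let integral_scaled (f : 'rV[R]_d -> \bar R) : measurable_fun setT f ->
  (forall x, 0 <= f x)%E ->
  (\int[leb]_x f (lam *: x)%R = (lam^-1 ^+ d)%:E * \int[leb]_x f x)%E.
Proof.
move=> mg g0; under eq_integral do rewrite -[_ *: _]addr0.
rewrite ge0_integral_affine //; last exact: lt0r_neq0.
by rewrite gtr0_norm.
Qed.

Let mbr2 : measurable_fun setT (fun x : 'rV[R]_d => (bracket x ^- (2 * d))%:E).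
Proof. by apply/measurable_EFinP; exact: measurable_bracketV. Qed.

Let br2_ge0 (x : 'rV[R]_d) : (0 <= (bracket x ^- (2 * d))%:E :> \bar R)%E.
Proof. by rewrite lee_fin invr_ge0 exprn_ge0 // ltW // bracket_gt0. Qed.

Let int_br2 : (\int[leb]_x (bracket x ^- (2 * d))%:E <= (pi ^+ d)%:E)%E.
Proof.
rewrite -(mul1r (pi ^+ d)); apply: integral_le_cauchy_weight.
- exact: measurable_bracketV.
- by move=> x; rewrite -lee_fin.
- by move=> x; rewrite mul1r bracketV_le_cauchy.
Qed.

Let int_br2_scaled : (\int[leb]_x (bracket (lam *: x) ^- (2 * d))%:E <=
  (lam^-1 ^+ d * pi ^+ d)%:E)%E.
Proof.
rewrite (integral_scaled mbr2 br2_ge0) EFinM lee_pmul2l //.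
by rewrite lte_fin exprn_gt0 // invr_gt0.
Qed.

(** The weight [e] has integral of order [lam ^- d], which compensates the size
    [lam ^+ d] of [A]. *)
Let integral_J : (\int[leb]_x J x <=
  (lam^-1 ^+ d * pi ^+ d)%:E * \int[leb]_w ((cmod (u w)) `^ p)%:E)%E.
Proof.
have mup : measurable_fun setT (fun w => ((cmod (u w)) `^ p)%:E).
  apply/measurable_EFinP; apply: (measurableT_comp (measurable_powR p)).
  exact: measurable_cmod.
rewrite /J (fubini_tonelli
  (fun z : 'rV[R]_d * 'rV[R]_d => ((cmod (u z.2)) `^ p * e (z.1 - z.2))%:E)) //=;
  last by move=> z; rewrite lee_fin f_ge0.
have c0 : (0 <= (lam^-1 ^+ d * pi ^+ d)%:E :> \bar R)%E.
  rewrite lee_fin mulr_ge0 // exprn_ge0 //; first by rewrite invr_ge0 ltW.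
  exact: pi_ge0.
move: c0 int_br2_scaled; move: (lam^-1 ^+ d * pi ^+ d)%R => k c0 hk.
rewrite -ge0_integralZl //; last by move=> w _; rewrite lee_fin powR_ge0.
apply: ge0_le_integralT.
- by move=> w; apply: integral_ge0 => x _; rewrite lee_fin f_ge0.
- apply: (measurable_fun_fubini_tonelli_G
    (fun z : 'rV[R]_d * 'rV[R]_d => ((cmod (u z.2)) `^ p * e (z.1 - z.2))%:E)) => //.
  by move=> z; rewrite lee_fin f_ge0.
- exact: measurable_funeM.
move=> w; under eq_integral do rewrite EFinM.
rewrite ge0_integralZl //; last 3 first.
- apply/measurable_EFinP; apply: (measurableT_comp me).
  by apply: measurable_sub => //; exact: measurable_cst.
- by move=> x _; rewrite lee_fin.
- by rewrite lee_fin powR_ge0.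
rewrite muleC; apply: lee_wpmul2r; first by rewrite lee_fin powR_ge0.
rewrite (ge0_integral_translate w (f := fun x => (e x)%:E)); last 2 first.
- exact/measurable_EFinP.
- by move=> x; rewrite lee_fin.
apply: le_trans hk; apply: ge0_le_integralT.
- by move=> x; rewrite lee_fin.
- exact/measurable_EFinP.
- by apply: (measurableT_comp mbr2); exact: measurable_scaled.
- by move=> x; rewrite lee_fin.
Qed.

Variables (A B : 'rV[R]_d -> C) (cA cB : R).
Hypothesis iA : cintegrable leb A.
Hypothesis iB : cintegrable leb B.
Hypothesis cA0 : 0 < cA.
Hypothesis cB0 : 0 < cB.
Hypothesis A_le : forall z, cmod (A z) <= cA * lam ^+ d * bracket (lam *: z) ^- n.
Hypothesis B_le : forall z, cmod (B z) <=
  cB * lam ^+ d.+1 * bracket (lam *: z) ^- (n + 2 * d).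
Hypothesis uA : forall x, u x = conv A u x.

Let conv_int (k : 'rV[R]_d -> C) x : cintegrable leb k ->
  cintegrable leb (fun z => k z * u (x - z)).
Proof.
move=> ik; under eq_fun do rewrite mulrC.
have [Bu hBu] := bu.
apply: (@cintegrableM _ _ _ _ _ _ Bu); last exact: ik.
  exact: (cmeasurable_comp mu_ (measurable_subl x)).
by move=> z; exact: hBu.
Qed.

(** The factor [`|u| `^ (1 - p)] is estimated by the maximal function and only
    [`|u| `^ p] is left under the integral. *)
Let point x y w : cmod (u w) * cmod (A (x - y - w)) / b y <=
  cA * lam ^+ d * peetre x `^ (1 - p) * ((cmod (u w)) `^ p * e (x - w)).
Proof.
have hu : cmod (u w) <= peetre x * b (x - w).
  by have := peetre_ub x (x - w); rewrite opprB addrC subrK.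
have u1 : cmod (u w) <= (cmod (u w)) `^ p * (peetre x `^ (1 - p) * b (x - w) `^ (1 - p)).
  have [->|un0] := eqVneq (cmod (u w)) 0.
    by rewrite !mulr_ge0 ?powR_ge0.
  rewrite -{1}(powRr1 (cmod_ge0 (u w))) -{1}(subrK p 1) addrC powRD; last first.
    by rewrite un0 implybT.
  rewrite ler_wpM2l ?powR_ge0 // -powRM //; last exact: ltW.
  apply: ge0_ler_powR; rewrite ?nnegrE //; first by rewrite subr_ge0 ltW.
  by rewrite mulr_ge0 // ltW.
have A1 : cmod (A (x - y - w)) / b y <= cA * lam ^+ d * (b (x - w))^-1.
  rewrite ler_pdivrMr // (le_trans (A_le _)) // -!mulrA.
  rewrite ler_wpM2l ?(ltW cA0) // ler_wpM2l ?exprn_ge0 ?(ltW lam0) //.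
  have h : b (x - w) <= b y * b (x - y - w).
    by have := b_sub y (x - y - w); rewrite addrA [y + _]addrC subrK.
  rewrite [leRHS]mulrC ler_pdivlMr // mulrC.
  by rewrite -/(b (x - y - w)) ler_pdivrMr.
rewrite -mulrA; apply: (le_trans (ler_pM _ _ u1 A1)) => //.
  by rewrite divr_ge0 // ltW.
have t0 := b_gt0 (x - w); rewrite /e.
have -> : (b (x - w))^-1 `^ p = b (x - w) `^ (1 - p) * (b (x - w))^-1.
  rewrite -powR_inv1 ?(ltW t0) // -powRrM -powRD; last first.
    by rewrite lt0r_neq0 ?implybT.
  by congr (_ `^ _); ring.
by rewrite le_eqVlt; apply/orP; left; apply/eqP; ring.
Qed.

Let sample x y : ((cmod (u (x - y)) / b y)%:E <=
  (2 * (cA * lam ^+ d * peetre x `^ (1 - p)))%:E * J x)%E.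
Proof.
have by0 := b_gt0 y.
have c0 : 0 <= cA * lam ^+ d * peetre x `^ (1 - p).
  by rewrite mulr_ge0 ?powR_ge0 // mulr_ge0 ?exprn_ge0 ?ltW.
pose t := x - y.
have mAu : measurable_fun setT (fun z => (cmod (A z * u (t - z)))%:E).
  by apply: measurable_ecmod; case: (conv_int t iA).
have h : ((cmod (u t))%:E <= 2%:E * \int[leb]_w (cmod (u w) * cmod (A (t - w)))%:E)%E.
  rewrite {1}uA (le_trans (cmod_cint_le (conv_int t iA))) // lee_pmul2l //.
  rewrite -(ge0_integral_reflect t mAu) //.
  rewrite le_eqVlt; apply/orP; left; apply/eqP; apply: eq_integral => w _.
  by rewrite cmodM subKr mulrC.
have mAu' : measurable_fun setT (fun w => cmod (u w) * cmod (A (t - w))).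
  apply: measurable_funM; first exact: measurable_cmod.
  apply: measurable_cmod; case: iA => mA _.
  exact: (cmeasurable_comp mA (measurable_subl t)).
rewrite EFinM muleC.
apply: (@le_trans _ _ ((b y)^-1%:E *
    (2%:E * \int[leb]_w (cmod (u w) * cmod (A (t - w)))%:E))%E).
  by rewrite lee_pmul2l // lte_fin invr_gt0.
rewrite muleCA EFinM -muleA lee_pmul2l //.
rewrite -ge0_integralZl; [|exact: measurableT|exact/measurable_EFinP
  |by move=> w _; rewrite lee_fin mulr_ge0|by rewrite lee_fin invr_ge0 ltW].
rewrite /J -ge0_integralZl; [|exact: measurableT
  |exact: (measurable_fun_pair2 x mf)|by move=> w _; rewrite lee_fin f_ge0
  |by rewrite lee_fin].
apply: ge0_le_integralT.
- by move=> w; rewrite -EFinM lee_fin !mulr_ge0 // invr_ge0 ltW.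
- by apply: measurable_funeM; exact/measurable_EFinP.
- apply: measurable_funeM; exact: (measurable_fun_pair2 x mf).
- by move=> w; rewrite -!EFinM lee_fin mulrC; exact: point.
Qed.

(** Taking the supremum over [y] in [sample] gives
    [peetre x <= c * peetre x `^ (1 - p) * J x], and the finite power of
    [peetre x] can be cancelled. *)
Lemma peetre_bound x :
  ((peetre x `^ p)%:E <= (2 * cA * lam ^+ d)%:E * J x)%E.
Proof.
have K0 : 0 < 2 * cA * lam ^+ d by rewrite !mulr_gt0 ?exprn_gt0.
have [Jf|Jo] := boolP (J x \is a fin_num); last first.
  have -> : J x = +oo%E by apply/eqP; rewrite -leye_eq leNgt -ge0_fin_numE.
  by rewrite gt0_muley ?lte_fin // leey.
have smp' : peetre x <= 2 * (cA * lam ^+ d * peetre x `^ (1 - p)) * fine (J x).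
  apply: ge_sup; first by case: (ubs x).
  by move=> _ [y ->]; rewrite -lee_fin [leRHS]EFinM (fineK Jf); exact: sample.
have r0 : 0 <= fine (J x) by exact: fine_ge0.
rewrite -(fineK Jf) -EFinM lee_fin; move: (fine (J x)) smp' r0 => r smp' r0.
have M0 := peetre_ge0 x; move: smp' M0; move: (peetre x) => M smp' M0.
have [Mz|Mn] := eqVneq M 0.
  by rewrite Mz powR0 ?lt0r_neq0 // mulr_ge0 // ltW.
have Mp : 0 < M by rewrite lt0r Mn.
have Mq : 0 < M `^ (1 - p) by exact: powR_gt0.
rewrite -(ler_pM2l Mq) -powRD ?Mn ?implybT // subrK powRr1 //.
by apply: (le_trans smp'); rewrite le_eqVlt; apply/orP; left; apply/eqP; ring.
Qed.

(** The decay of [B] beyond the growth [bracket ^+ n] of [u] leaves an integrable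
    weight; the extra power of [lam] in the size of [B] is what differentiation
    costs. *)
Lemma conv_peetre x :
  cmod (conv B u x) <= 2 * (cB * pi ^+ d) * lam * peetre x.
Proof.
have M0 := peetre_ge0 x.
rewrite -lee_fin (le_trans (cmod_cint_le (conv_int x iB))) //.
have k0 : 0 <= cB * lam ^+ d.+1 * peetre x.
  by rewrite !mulr_ge0 // ?exprn_ge0 // ltW.
have : (2%:E * ((cB * lam ^+ d.+1 * peetre x)%:E *
    \int[leb]_z (bracket (lam *: z) ^- (2 * d))%:E) <=
    (2 * (cB * pi ^+ d) * lam * peetre x)%:E)%E.
  apply: (@le_trans _ _ (2%:E * ((cB * lam ^+ d.+1 * peetre x)%:E *
    (lam^-1 ^+ d * pi ^+ d)%:E))%E).
    by rewrite lee_pmul2l // lee_wpmul2l // lee_fin.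
  rewrite -!EFinM lee_fin le_eqVlt; apply/orP; left; apply/eqP.
  have -> : lam ^+ d.+1 = lam * lam ^+ d by rewrite exprS.
  rewrite exprVn; field; rewrite expf_neq0 // lt0r_neq0 //.
apply: le_trans; rewrite lee_pmul2l //.
rewrite -ge0_integralZl; [|exact: measurableT
  |by apply: (measurableT_comp mbr2); exact: measurable_scaled
  |by []|by rewrite lee_fin].
apply: ge0_le_integralT.
- by [].
- by apply: measurable_ecmod; case: (conv_int x iB).
- apply: measurable_funeM.
  by apply: (measurableT_comp mbr2); exact: measurable_scaled.
move=> z; rewrite -EFinM lee_fin cmodM.
apply: (le_trans (ler_pM _ _ (B_le z) (peetre_ub x z))) => //.
have w0 := bracket_gt0 (lam *: z); rewrite exprD /b.
rewrite le_eqVlt; apply/orP; left; apply/eqP.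
by field; rewrite !expf_neq0 // lt0r_neq0.
Qed.

Definition peetre_const : R := (2 * (cB * pi ^+ d)) `^ p * (2 * cA) * pi ^+ d.

(** A Bernstein inequality in L^p for [p < 1], where Young's convolution inequality
    fails: [B] behaves like the derivative of a kernel of frequency [lam], and [u]
    is reproduced by [A], which plays the role of spectrum in a ball of radius
    [lam]. *)
Theorem integral_conv_powR_le :
  (\int[leb]_x ((cmod (conv B u x)) `^ p)%:E <=
   (peetre_const * lam `^ p)%:E * \int[leb]_x ((cmod (u x)) `^ p)%:E)%E.
Proof.
have pp : 0 <= pi ^+ d :> R by rewrite exprn_ge0 // pi_ge0.
have k0 : 0 <= 2 * (cB * pi ^+ d) by rewrite !mulr_ge0 // ltW.
have l0 := ltW lam0.
apply: (@le_trans _ _ (\int[leb]_x (((2 * (cB * pi ^+ d) * lam) `^ p *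
    (2 * cA * lam ^+ d))%:E * J x))%E).
  apply: ge0_le_integralT.
  - by move=> x; rewrite lee_fin powR_ge0.
  - apply/measurable_EFinP; apply: (measurableT_comp (measurable_powR p)).
    by apply: measurable_cmod; apply: cmeasurable_conv => //; case: iB.
  - exact: measurable_funeM.
  - move=> x; rewrite EFinM -muleA.
    apply: (@le_trans _ _ (((2 * (cB * pi ^+ d) * lam) `^ p)%:E *
        (peetre x `^ p)%:E)%E); last first.
      by apply: lee_wpmul2l; [rewrite lee_fin powR_ge0|exact: peetre_bound].
    rewrite -EFinM lee_fin -(powRM _ (mulr_ge0 k0 l0) (peetre_ge0 x)).
    apply: ge0_ler_powR; rewrite ?nnegrE.
    - exact: ltW.
    - exact: cmod_ge0.
    - exact: mulr_ge0 (mulr_ge0 k0 l0) (peetre_ge0 x).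
    - exact: conv_peetre.
have cc : 0 <= (2 * (cB * pi ^+ d) * lam) `^ p * (2 * cA * lam ^+ d).
  by rewrite mulr_ge0 ?powR_ge0 // !mulr_ge0 ?exprn_ge0 // ltW.
rewrite ge0_integralZl //.
apply: (le_trans (lee_wpmul2l _ integral_J)); first by rewrite lee_fin.
rewrite muleA -EFinM le_eqVlt; apply/orP; left; apply/eqP; congr (_%:E * _)%E.
rewrite /peetre_const (powRM _ k0 l0) exprVn.
by field; rewrite expf_neq0 // lt0r_neq0.
Qed.

End peetre.

(** * Finite Haar sums *)

Section step_functions.
Context (R : realType) (d : nat).
Notation leb := (@leb R d).
Notation C := R[i].
Implicit Types (x y z : 'rV[R]_d).

Definition locally_constant (T : Type) (f : 'rV[R]_d -> T) x :=
  exists2 e : R, 0 < e & forall y, (forall i, `|y 0 i - x 0 i| < e) -> f y = f x.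

Lemma locally_constant_op (T1 T2 T : Type) (op : T1 -> T2 -> T) f g x :
  locally_constant f x -> locally_constant g x ->
  locally_constant (fun y => op (f y) (g y)) x.
Proof.
move=> [e e0 fe] [e' e'0 ge]; exists (Num.min e e'); first by rewrite lt_min e0.
move=> y yx; rewrite fe => [|i]; last by have := yx i; rewrite lt_min => /andP[].
by rewrite ge => // i; have := yx i; rewrite lt_min => /andP[].
Qed.

Lemma locally_constant_big (I T : Type) (op : T -> T -> T) (idx : T) (r : seq I)
    (f : I -> 'rV[R]_d -> T) x : (forall i, locally_constant (f i) x) ->
  locally_constant (fun y => \big[op/idx]_(i <- r) f i y) x.
Proof.
move=> fx; elim: r => [|i r IH].
  by exists 1 => // y _; rewrite !big_nil.
have [e e0 fe] := locally_constant_op op (fx i) IH.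
by exists e => // y yx; rewrite !big_cons; exact: fe.
Qed.

(** A point closer to [t] than both end points lies on the same side of each of
    them as [t]. *)
Lemma indic_near (a c s t : R) : `|s - t| < `|t - a| -> `|s - t| < `|t - c| ->
  \1_(`[a, c[) s = \1_(`[a, c[) t :> R.
Proof.
have side (u : R) : `|s - t| < `|t - u| -> (u <= s) = (u <= t).
  case: (lerP u t) => hu.
    rewrite ltr_norml => /andP[h1 h2].
    by apply/idP; lra.
  rewrite ltr_norml => /andP[h1 h2].
  by apply/negbTE; rewrite -ltNge; lra.
move=> /side ha /side hc; rewrite !indicE !mem_setE !in_itv /= ha !ltNge hc.
by [].
Qed.

Lemma haar1_near (b : bool) (t : R) : t != 0 -> t != 2^-1 -> t != 1 ->
  exists2 e, 0 < e & forall s, `|s - t| < e -> haar1 b s = haar1 b t.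
Proof.
move=> t0 th t1.
exists (Num.min `|t - 0| (Num.min `|t - 2^-1| `|t - 1|)).
  by rewrite !lt_min !normr_gt0 !subr_eq0 t0 th t1.
move=> s; rewrite !lt_min => /and3P[h0 hh h1]; rewrite /haar1.
by case: b; rewrite !(indic_near h0, indic_near hh h1).
Qed.

(** The factor in the coordinate [i] jumps only when [2 ^+ k * x 0 i - mu i] is 0,
    1/2 or 1, that is, on three hyperplanes. *)
Lemma ae_haar_locally_constant (eps : 'I_d -> bool) k (mu : 'I_d -> int) :
  {ae leb, forall x : 'rV[R]_d, locally_constant (haar (R := R) eps k mu) x}.
Proof.
have k0 : 0 < 2 ^+ k :> R by rewrite exprn_gt0.
have : {ae leb, forall x : 'rV[R]_d, forall i,
    locally_constant (fun y => haar1 (eps i) (2 ^+ k * y 0 i - (mu i)%:~R)) x}.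
  apply: filter_forall => i.
  have ae1 (c : R) : {ae leb, forall x : 'rV[R]_d, 2 ^+ k * x 0 i - (mu i)%:~R != c}.
    apply: filterS (ae_coord_neq i ((c + (mu i)%:~R) / 2 ^+ k)) => x.
    apply: contraNneq => <-; apply/eqP; field.
    by rewrite lt0r_neq0.
  apply: filterS3 (ae1 0) (ae1 2^-1) (ae1 1) => x t0 th t1.
  have [e e0 he] := haar1_near (eps i) t0 th t1.
  exists (e / 2 ^+ k); first by rewrite divr_gt0.
  move=> y yx; apply: he.
  rewrite (_ : _ - _ = 2 ^+ k * (y 0 i - x 0 i)); last by ring.
  by rewrite normrM gtr0_norm // mulrC -ltr_pdivlMr.
by apply: filterS => x hx; exact: locally_constant_big.
Qed.

Lemma measurable_haar1 (b : bool) : measurable_fun setT (haar1 (R := R) b).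
Proof.
case: b; first apply: measurable_funB; apply: measurable_indic; exact: measurable_itv.
Qed.

Lemma measurable_haar eps k mu : measurable_fun setT (@haar R d eps k mu).
Proof.
apply: measurable_prod => i _.
apply: (measurableT_comp (measurable_haar1 (eps i))).
apply: measurable_funB => //; apply: measurable_funM => //.
exact: measurable_coord.
Qed.

Lemma haar_le1 eps k mu x : `|@haar R d eps k mu x| <= 1.
Proof.
rewrite /haar normr_prod.
rewrite -[leRHS](big1_eq (op := *%R) (index_enum 'I_d) xpredT).
apply: ler_prod => i _; rewrite normr_ge0 /=.
move: (_ - _) => t; rewrite /haar1.
case: (eps i); rewrite ?indicE; last by case: (t \in _); rewrite ?normr1 ?normr0.
rewrite !mem_setE !in_itv /= [2^-1 <= t]leNgt.
by case: (t < 2^-1); case: (0 <= t); case: (t < 1);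
  rewrite /= ?subr0 ?sub0r ?subrr ?normrN ?normr1 ?normr0.
Qed.

Lemma haar_systemP (h : 'rV[R]_d -> R) : haar_system h ->
  exists eps k mu, h = haar eps k mu.
Proof.
by case=> [[mu ->]|[eps [k [mu [_ ->]]]]]; do 3 eexists.
Qed.

Lemma haar_spanP (g : 'rV[R]_d -> C) : haar_span g ->
  [/\ cmeasurable g, cbounded g &
      {ae leb, forall x : 'rV[R]_d, locally_constant g x}].
Proof.
move=> [n [c [h [hh ->]]]]; split.
- apply: cmeasurable_sum => j; apply: cmeasurableM; first exact: cmeasurable_cst.
  apply: cmeasurable_real; have [eps [k [mu ->]]] := haar_systemP (hh j).
  exact: measurable_haar.
- exists (\sum_(j < n) cmod (c j)) => x; rewrite (le_trans (cmod_sum _ _)) //.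
  apply: ler_sum => j _; have [eps [k [mu ->]]] := haar_systemP (hh j).
  by rewrite cmodM cmod_real ler_piMr // haar_le1.
- have : {ae leb, forall x : 'rV[R]_d, forall j, locally_constant (h j) x}.
    apply: filter_forall => j; have [eps [k [mu ->]]] := haar_systemP (hh j).
    exact: ae_haar_locally_constant.
  apply: filterS => x hx; apply: locally_constant_big => j.
  have [e e0 he] := hx j; exists e => // y yx.
  by rewrite (he y yx).
Qed.

(** Near a point where [g] is constant, a kernel of integral zero sees only the
    values of [g] at distance at least [e], where its tail is small. Of the decay
    exponent, [2 * d] gives integrability, [d.+1] offsets the size of [K], and
    the last unit yields the factor [lam^-1]. *)
Lemma conv_locally_constant (g : 'rV[R]_d -> C) (cB : R) x :
  cmeasurable g -> cbounded g -> locally_constant g x -> 0 < cB ->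
  exists M, forall (lam : R) (K : 'rV[R]_d -> C), 1 <= lam ->
    cintegrable leb K -> cint leb K = 0 ->
    (forall z, cmod (K z) <=
       cB * lam ^+ d.+1 * bracket (lam *: z) ^- (2 * d + d.+2)) ->
    cmod (conv g K x) <= M / lam.
Proof.
move=> mg [G hG] [e e0 ge] cB0.
have G0 : 0 <= G by exact: le_trans (cmod_ge0 _) (hG 0).
exists (2 * (2 * G * cB * e ^- d.+2) * pi ^+ d) => lam K l1 iK K0 KB.
have l0 : 0 < lam by exact: lt_le_trans l1.
have bg : cbounded g by exists G.
have E : conv g K x = cint leb (fun z => (g (x - z) - g x) * K z).
  have ig : cintegrable leb (fun z => g (x - z) * K z).
    apply: (@cintegrableM _ _ _ _ _ _ G) => //.
    exact: (cmeasurable_comp mg (measurable_subl x)).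
  have i1 := cintegrableZ (g x) iK.
  rewrite -[RHS]subr0 -[0 in RHS](mulr0 (- g x)) -K0 mulNr opprK -cintZ //.
  rewrite -cintD //; last first.
    under eq_fun do rewrite mulrBl; exact: cintegrableB.
  under [in RHS]eq_fun do rewrite mulrBl subrK.
  rewrite -(cint_reflect x ig); congr cint; apply/funext => y.
  by rewrite subKr.
have pw z : cmod ((g (x - z) - g x) * K z) <=
    2 * G * cB * e ^- d.+2 * lam^-1 * bracket z ^- (2 * d).
  have rhs0 : 0 <= 2 * G * cB * e ^- d.+2 * lam^-1 * bracket z ^- (2 * d).
    have bz := ltW (bracket_gt0 z).
    by rewrite !mulr_ge0 ?invr_ge0 ?exprn_ge0 // ltW.
  have [/existsP[i ei]|/existsPn small] := boolP [exists i, e <= `|z 0 i|]; last first.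
    rewrite ge ?subrr ?mul0r ?cmod0 // => i; rewrite !mxE.
    by rewrite addrAC subrr sub0r normrN ltNge small.
  have b0 := bracket_gt0 (lam *: z).
  have h1 : lam * e <= bracket (lam *: z).
    rewrite (le_trans _ (bracket_coord (lam *: z) i)) // mxE normrM (gtr0_norm l0).
    by rewrite (le_trans (ler_wpM2l (ltW l0) ei)) // lerDr.
  have h2 : bracket z <= bracket (lam *: z).
    rewrite lerD2l ler_sum // => j _; rewrite mxE normrM (gtr0_norm l0).
    by rewrite ler_peMl.
  have le0 : 0 < lam * e by rewrite mulr_gt0.
  have h3 : bracket (lam *: z) ^- (2 * d + d.+2) <=
      bracket z ^- (2 * d) * (lam * e) ^- d.+2.
    rewrite exprD invfM ler_pM ?invr_ge0 ?exprn_ge0 ?(ltW b0) //.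
      rewrite lef_pV2 ?posrE ?exprn_gt0 ?bracket_gt0 //.
      by apply: lerXn2r => //; rewrite nnegrE ltW ?bracket_gt0.
    rewrite lef_pV2 ?posrE ?exprn_gt0 //.
    by apply: lerXn2r => //; rewrite nnegrE ltW.
  rewrite cmodM.
  have g2 : cmod (g (x - z) - g x) <= 2 * G.
    by rewrite (le_trans (cmodB _ _)) // mulr2n mulrDl mul1r lerD.
  have K1 : cmod (K z) <= cB * lam ^+ d.+1 * (bracket z ^- (2 * d) * (lam * e) ^- d.+2).
    rewrite (le_trans (KB z)) // ler_wpM2l // mulr_ge0 ?(ltW cB0) // exprn_ge0 //.
    exact: ltW.
  rewrite (le_trans (ler_pM _ _ g2 K1)) // le_eqVlt; apply/orP; left; apply/eqP.
  have bz := bracket_gt0 z; rewrite exprMn [lam ^+ d.+2]exprS.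
  field; rewrite !expf_neq0 ?lt0r_neq0 //.
have iE : cintegrable leb (fun z => (g (x - z) - g x) * K z).
  apply: (@cintegrableM _ _ _ _ _ _ (2 * G)) => //.
    apply: cmeasurableB; last exact: cmeasurable_cst.
    exact: (cmeasurable_comp mg (measurable_subl x)).
  by move=> z; rewrite (le_trans (cmodB _ _)) // mulr2n mulrDl mul1r lerD.
have k0 : 0 <= 2 * G * cB * e ^- d.+2 * lam^-1.
  by rewrite !mulr_ge0 ?invr_ge0 ?exprn_ge0 // ltW.
have I1 : (\int[leb]_z (cmod ((g (x - z) - g x) * K z))%:E <=
    ((2 * G * cB * e ^- d.+2 * lam^-1) * pi ^+ d)%:E)%E.
  apply: integral_le_cauchy_weight.
  - by apply: measurable_cmod; case: iE.
  - by move=> z; exact: cmod_ge0.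
  - move=> z; apply: (le_trans (pw z)); apply: ler_wpM2l => //.
    exact: bracketV_le_cauchy.
rewrite E -lee_fin (le_trans (cmod_cint_le iE)) //.
apply: (le_trans (lee_wpmul2l _ I1)) => //.
rewrite -EFinM lee_fin le_eqVlt; apply/orP; left; apply/eqP.
by rewrite !mulrA; ring.
Qed.

End step_functions.

(** * Littlewood-Paley kernels and their frequency-weighted versions *)

Section littlewood_paley.
Context (R : realType) (d : nat) (phi0 : 'rV[R]_d -> R[i]).
Notation leb := (@leb R d).
Notation C := R[i].
Hypothesis adm : admissible phi0.
Hypothesis d0 : (0 < d)%N.
Let j : 'I_d := Ordinal d0.
Implicit Types (x y z xi zeta : 'rV[R]_d) (lam mu : R).

Let nphi : nice phi0 := nice_admissible adm d0.
Let nphi1 : nice (coord_mul j phi0) := nice_coord_mul_admissible adm d0 j.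
Let iphi := nice_integrable nphi.
Let iphi1 := nice_integrable nphi1.
Let iK := kernel_integrable d0 nphi.
Let iK1 := kernel_integrable d0 nphi1.

(** The kernel of the Fourier multiplier [phi0 (xi / lam)], and that of the
    multiplier [xi_j * phi0 (xi / lam)], which is its partial derivative up to
    a unimodular constant. *)
Definition low_pass lam := inverse_fourier (dilate lam phi0).
Definition low_pass_deriv lam := inverse_fourier (coord_mul j (dilate lam phi0)).

Let coord_mul_dilate lam : 0 < lam ->
  coord_mul j (dilate lam phi0) = fun xi => lam%:C * dilate lam (coord_mul j phi0) xi.
Proof.
move=> lam0; apply/funext => xi; rewrite /coord_mul /dilate mulrA -realcM mxE.
by rewrite mulrA divff ?lt0r_neq0 // mul1r.
Qed.

Lemma integrable_dilate lam : 0 < lam -> cintegrable leb (dilate lam phi0).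
Proof. by move=> lam0; exact: (cintegrable_dilate lam0 iphi). Qed.

Lemma integrable_coord_mul_dilate lam : 0 < lam ->
  cintegrable leb (coord_mul j (dilate lam phi0)).
Proof.
move=> lam0; rewrite (coord_mul_dilate lam0).
by apply: cintegrableZ; exact: (cintegrable_dilate lam0 iphi1).
Qed.

Lemma inverse_fourierZ (a : C) (phi : 'rV[R]_d -> C) x : cintegrable leb phi ->
  inverse_fourier (fun xi => a * phi xi) x = a * inverse_fourier phi x.
Proof.
move=> ip; have [mp _] := ip; rewrite !inverse_fourierE //; last first.
  by apply: cmeasurableM => //; exact: cmeasurable_cst.
rewrite [RHS]mulrCA; congr (_ * _).
rewrite -cintZ; last exact: cintegrable_cis (measurable_dotp_cst x) ip.
by congr cint; apply/funext => xi; rewrite mulrA.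
Qed.

Let low_pass_derivE lam : 0 < lam -> low_pass_deriv lam =
  fun x => lam%:C * inverse_fourier (dilate lam (coord_mul j phi0)) x.
Proof.
move=> lam0; apply/funext => x; rewrite /low_pass_deriv (coord_mul_dilate lam0).
by rewrite inverse_fourierZ; last exact: (cintegrable_dilate lam0 iphi1).
Qed.

Lemma low_pass_integrable lam : 0 < lam -> cintegrable leb (low_pass lam).
Proof. by move=> lam0; exact: (kernel_dilate_integrable lam0 iphi iK). Qed.

Lemma low_pass_deriv_integrable lam : 0 < lam ->
  cintegrable leb (low_pass_deriv lam).
Proof.
move=> lam0; rewrite (low_pass_derivE lam0); apply: cintegrableZ.
exact: (kernel_dilate_integrable lam0 iphi1 iK1).
Qed.

Lemma low_pass_transform lam zeta : 0 < lam ->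
  cint leb (fun x => low_pass lam x * cis (- dotp x zeta)) = dilate lam phi0 zeta.
Proof. by move=> lam0; exact: (fourier_inversion_dilate zeta lam0 nphi iK). Qed.

Lemma low_pass_deriv_transform lam zeta : 0 < lam ->
  cint leb (fun x => low_pass_deriv lam x * cis (- dotp x zeta)) =
  coord_mul j (dilate lam phi0) zeta.
Proof.
move=> lam0; rewrite (low_pass_derivE lam0) (coord_mul_dilate lam0).
rewrite -(fourier_inversion_dilate zeta lam0 nphi1 iK1) -cintZ; last first.
  apply: cintegrable_cis; last exact: (kernel_dilate_integrable lam0 iphi1 iK1).
  under eq_fun do rewrite -dotpNr.
  by apply: measurable_dotp => //; exact: measurable_cst.
by congr cint; apply/funext => x; rewrite mulrA.
Qed.

Lemma low_pass_le n : exists2 c, 0 < c & forall lam, 0 < lam -> forall z,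
  cmod (low_pass lam z) <= c * lam ^+ d * bracket (lam *: z) ^- n.
Proof.
have [B B0 hB] := kernel_decay n d0 nphi.
exists (B + 1) => [|lam lam0 z]; first by rewrite ltr_wpDl.
rewrite /low_pass (inverse_fourier_dilate z lam0 iphi) cmodM cmod_real.
rewrite ger0_norm ?exprn_ge0 ?(ltW lam0) // -mulrA mulrCA.
rewrite ler_wpM2l ?exprn_ge0 ?(ltW lam0) // (le_trans (hB _)) //.
by rewrite ler_wpM2r ?lerDl // invr_ge0 exprn_ge0 // ltW // bracket_gt0.
Qed.

Lemma low_pass_deriv_le n : exists2 c, 0 < c & forall lam, 0 < lam -> forall z,
  cmod (low_pass_deriv lam z) <= c * lam ^+ d.+1 * bracket (lam *: z) ^- n.
Proof.
have [B B0 hB] := kernel_decay n d0 nphi1.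
exists (B + 1) => [|lam lam0 z]; first by rewrite ltr_wpDl.
rewrite (low_pass_derivE lam0) (inverse_fourier_dilate z lam0 iphi1) mulrA -realcM -exprS.
rewrite cmodM cmod_real.
rewrite ger0_norm ?exprn_ge0 ?(ltW lam0) // -mulrA mulrCA.
rewrite ler_wpM2l ?exprn_ge0 ?(ltW lam0) // (le_trans (hB _)) //.
by rewrite ler_wpM2r ?lerDl // invr_ge0 exprn_ge0 // ltW // bracket_gt0.
Qed.

(** Where the narrow symbol does not vanish, the wide one is 1. *)
Lemma dilate_mul lam mu xi : 0 < lam -> 2 * lam <= mu ->
  dilate lam phi0 xi * dilate mu phi0 xi = dilate lam phi0 xi.
Proof.
move=> lam0 lm; have [_ one zero] := adm.
have mu0 : 0 < mu by apply: lt_le_trans lm; rewrite mulr_gt0.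
rewrite /dilate; have [h|h] := leP (2 * lam) (enorm xi).
  rewrite zero ?mul0r // enormZ ger0_norm ?invr_ge0 ?(ltW lam0) //.
  by rewrite mulrC ler_pdivlMr.
rewrite [phi0 (mu^-1 *: _)]one ?mulr1 // enormZ ger0_norm ?invr_ge0 ?(ltW mu0) //.
by rewrite mulrC ler_pdivrMr // mul1r (le_trans (ltW h)).
Qed.

Lemma dyadicS k : dyadic phi0 k.+1 =
  fun xi => dilate (2 ^+ k.+1) phi0 xi - dilate (2 ^+ k) phi0 xi.
Proof. by []. Qed.

Lemma dyadic0 : dyadic phi0 0 = dilate 1 phi0.
Proof. by apply/funext => xi; rewrite /= /dilate invr1 scale1r. Qed.

Lemma pow2_gt0 k : 0 < 2 ^+ k :> R. Proof. by rewrite exprn_gt0. Qed.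

Lemma dyadic_integrable k : cintegrable leb (dyadic phi0 k).
Proof.
case: k => [|k]; first by rewrite dyadic0; exact: integrable_dilate.
by rewrite dyadicS; apply: cintegrableB; apply: integrable_dilate; exact: pow2_gt0.
Qed.

Lemma dyadic_mul k xi :
  dyadic phi0 k xi * dilate (2 ^+ k.+1) phi0 xi = dyadic phi0 k xi.
Proof.
case: k => [|k]; first by rewrite dyadic0 dilate_mul // expr1 mulr1.
rewrite dyadicS mulrBl !dilate_mul ?pow2_gt0 // -?exprS //.
by rewrite ler_eXn2l // ltr1n.
Qed.

Definition lp_kernel k := inverse_fourier (dyadic phi0 k).
Definition lp_kernel_deriv k := inverse_fourier (coord_mul j (dyadic phi0 k)).

Lemma lp_kernel0 : lp_kernel 0 = low_pass 1.
Proof. by rewrite /lp_kernel dyadic0. Qed.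

Lemma lp_kernelS k :
  lp_kernel k.+1 = fun x => low_pass (2 ^+ k.+1) x - low_pass (2 ^+ k) x.
Proof.
apply/funext => x; rewrite /lp_kernel dyadicS inverse_fourierB //;
  apply: integrable_dilate; exact: pow2_gt0.
Qed.

Lemma lp_kernel_deriv0 : lp_kernel_deriv 0 = low_pass_deriv 1.
Proof. by rewrite /lp_kernel_deriv dyadic0. Qed.

Lemma lp_kernel_derivS k : lp_kernel_deriv k.+1 =
  fun x => low_pass_deriv (2 ^+ k.+1) x - low_pass_deriv (2 ^+ k) x.
Proof.
apply/funext => x; rewrite /lp_kernel_deriv dyadicS.
rewrite -inverse_fourierB; last 2 first.
- apply: integrable_coord_mul_dilate; exact: pow2_gt0.
- apply: integrable_coord_mul_dilate; exact: pow2_gt0.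
congr (inverse_fourier _ x); apply/funext => xi.
by rewrite /coord_mul mulrBr.
Qed.

Lemma lp_kernel_integrable k : cintegrable leb (lp_kernel k).
Proof.
case: k => [|k]; first by rewrite lp_kernel0; exact: low_pass_integrable.
by rewrite lp_kernelS; apply: cintegrableB; apply: low_pass_integrable;
  exact: pow2_gt0.
Qed.

Lemma lp_kernel_bounded k : cbounded (lp_kernel k).
Proof.
exists (2 * (2 * pi) ^- d * fine (\int[leb]_xi (cmod (dyadic phi0 k xi))%:E)%E).
by move=> x; exact: cmod_inverse_fourier_le (dyadic_integrable k).
Qed.

Lemma lp_kernel_deriv_integrable k : cintegrable leb (lp_kernel_deriv k).
Proof.
case: k => [|k]; first by rewrite lp_kernel_deriv0; exact: low_pass_deriv_integrable.
by rewrite lp_kernel_derivS; apply: cintegrableB; apply: low_pass_deriv_integrable;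
  exact: pow2_gt0.
Qed.

(** The reproducing identity behind the Bernstein inequality for the
    Littlewood-Paley blocks. *)
Lemma conv_low_pass_lp_kernel k x :
  conv (low_pass (2 ^+ k.+1)) (lp_kernel k) x = lp_kernel k x.
Proof.
have l0 := pow2_gt0 k.+1.
rewrite /lp_kernel (@conv_kernel _ _ _ (dilate (2 ^+ k.+1) phi0)).
- by congr (inverse_fourier _ x); apply/funext => xi; exact: dyadic_mul.
- exact: low_pass_integrable.
- exact: dyadic_integrable.
- by move=> zeta; exact: low_pass_transform.
- by under eq_fun do rewrite dyadic_mul; case: (dyadic_integrable k).
Qed.

Let coord_mul_dyadic k xi :
  dyadic phi0 k xi * coord_mul j (dilate (2 ^+ k.+1) phi0) xi =
  coord_mul j (dyadic phi0 k) xi.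
Proof. by rewrite /coord_mul mulrCA dyadic_mul. Qed.

Lemma conv_low_pass_deriv_lp_kernel k x :
  conv (low_pass_deriv (2 ^+ k.+1)) (lp_kernel k) x = lp_kernel_deriv k x.
Proof.
have l0 := pow2_gt0 k.+1.
rewrite /lp_kernel (@conv_kernel _ _ _ (coord_mul j (dilate (2 ^+ k.+1) phi0))).
- congr (inverse_fourier _ x); apply/funext => xi; exact: coord_mul_dyadic.
- exact: low_pass_deriv_integrable.
- exact: dyadic_integrable.
- by move=> zeta; exact: low_pass_deriv_transform.
- under eq_fun do rewrite coord_mul_dyadic.
  by apply: cmeasurable_coord_mul; case: (dyadic_integrable k).
Qed.

(** The sum telescopes. *)
Lemma sum_conv_lp_kernel_deriv (h : 'rV[R]_d -> C) x K :
  cmeasurable h -> cbounded h ->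
  \sum_(k < K.+1) conv h (lp_kernel_deriv k) x = conv h (low_pass_deriv (2 ^+ K)) x.
Proof.
move=> mh bh; elim: K => [|K IH].
  by rewrite big_ord1 lp_kernel_deriv0.
rewrite big_ord_recr /= IH lp_kernel_derivS.
have iB k := low_pass_deriv_integrable (pow2_gt0 k).
have E := convB x mh bh (iB K.+1) (iB K).
transitivity (conv h (low_pass_deriv (2 ^+ K)) x +
  (conv h (low_pass_deriv (2 ^+ K.+1)) x - conv h (low_pass_deriv (2 ^+ K)) x)).
  by congr (_ + _).
exact: subrKC.
Qed.

(** The function that is kept away from all Haar sums has its spectrum where
    the first Littlewood-Paley symbol is 1 and all the others vanish. *)
Definition target := low_pass 2^-1.

Let half_gt0 : 0 < 2^-1 :> R. Proof. by rewrite invr_gt0. Qed.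

Let half_le K : 2 * 2^-1 <= 2 ^+ K :> R.
Proof. by rewrite divff // exprn_ege1 // ler1n. Qed.

Lemma target_integrable : cintegrable leb target.
Proof. exact: low_pass_integrable. Qed.

Lemma target_bounded : cbounded target.
Proof.
exists (2 * (2 * pi) ^- d * fine (\int[leb]_xi (cmod (dilate 2^-1 phi0 xi))%:E)%E).
by move=> x; exact: cmod_inverse_fourier_le (integrable_dilate half_gt0).
Qed.

Let conv_target (a : 'rV[R]_d -> C) x : cintegrable leb a ->
  conv target (inverse_fourier a) x =
  inverse_fourier (fun xi => a xi * dilate 2^-1 phi0 xi) x.
Proof.
move=> ia.
have [ma _] := ia; have [mh _] := integrable_dilate half_gt0.
exact: (conv_kernel x target_integrable ia
  (fun zeta => low_pass_transform zeta half_gt0) (cmeasurableM ma mh)).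
Qed.

Let dilate_half K xi : dilate (2 ^+ K) phi0 xi * dilate 2^-1 phi0 xi =
  dilate 2^-1 phi0 xi.
Proof. by rewrite mulrC (dilate_mul xi half_gt0 (half_le K)). Qed.

Lemma conv_target_lp_kernel k x :
  conv target (lp_kernel k) x = if k is 0%N then target x else 0.
Proof.
rewrite /lp_kernel conv_target; last exact: dyadic_integrable.
case: k => [|k].
  congr (inverse_fourier _ x); apply/funext => xi.
  by rewrite dyadic0 -[1]/(2 ^+ 0) dilate_half.
have -> : (fun xi => dyadic phi0 k.+1 xi * dilate 2^-1 phi0 xi) = fun=> 0.
  by apply/funext => xi; rewrite dyadicS mulrBl !dilate_half subrr.
rewrite inverse_fourierE; last exact: cmeasurable_cst.
by under eq_fun do rewrite mul0r; rewrite cint0 mulr0.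
Qed.

Definition target_deriv := low_pass_deriv 2^-1.

Lemma conv_target_low_pass_deriv K x :
  conv target (low_pass_deriv (2 ^+ K)) x = target_deriv x.
Proof.
rewrite /low_pass_deriv conv_target; last first.
  by apply: integrable_coord_mul_dilate; exact: pow2_gt0.
congr (inverse_fourier _ x); apply/funext => xi.
by rewrite /coord_mul -mulrA dilate_half.
Qed.

Lemma measurable_powR_cmod (f : 'rV[R]_d -> C) (p : R) : cmeasurable f ->
  measurable_fun setT (fun x => ((cmod (f x)) `^ p)%:E).
Proof.
move=> mf; apply/measurable_EFinP.
by apply: (measurableT_comp (measurable_powR p)); exact: measurable_cmod.
Qed.

(** If the integral were 0, then [target_deriv] would vanish almost everywhere and
    its Fourier transform everywhere; but the latter is [1 / 4] at the frequency
    [zeta], where the cut-off function is 1. *)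
Lemma target_deriv_neq0 (p : R) : 0 < p ->
  (0 < \int[leb]_x ((cmod (target_deriv x)) `^ p)%:E)%E.
Proof.
move=> p0; have it := low_pass_deriv_integrable half_gt0.
have [mt _] := it.
rewrite lt0e integral_ge0 ?andbT => [|x _]; last by rewrite lee_fin powR_ge0.
apply/eqP => I0.
have mp := measurable_powR_cmod p mt.
have z0 : (\int[leb]_x (cmod (target_deriv x))%:E = 0)%E.
  have mE := measurable_ecmod mt.
  have := (ae_eq_integral_abs leb measurableT mp).1.
  rewrite -{1}I0 => /(_ _) [].
    by apply: eq_integral => x _; rewrite gee0_abs // lee_fin powR_ge0.
  move=> N [mN N0 sN].
  have /(ae_eq_integral_abs leb measurableT mE) :
      ae_eq leb setT (fun x => (cmod (target_deriv x))%:E) (cst 0%E).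
    exists N; split => // x /= nx; apply: sN => /= h; apply: nx => _.
    have /= := h I; case => /eqP; rewrite powR_eq0 => /andP[/eqP -> _].
    by [].
  by under eq_integral do rewrite gee0_abs //.
have [_ one _] := adm.
pose zeta : 'rV[R]_d := 4^-1 *: delta_mx 0 j.
have := low_pass_deriv_transform zeta half_gt0.
have ic : cintegrable leb (fun x => low_pass_deriv 2^-1 x * cis (- dotp x zeta)).
  apply: cintegrable_cis it; under eq_fun do rewrite -dotpNr.
  by apply: measurable_dotp => //; exact: measurable_cst.
have -> : cint leb (fun x => low_pass_deriv 2^-1 x * cis (- dotp x zeta)) = 0.
  apply: cmod0_eq0; apply/eqP; rewrite eq_le cmod_ge0 andbT.
  rewrite (le_trans (cmod_cint_le_fine ic)) //.
  under eq_integral do rewrite cmodM cmod_cis mulr1.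
  by rewrite z0 mulr0.
rewrite /coord_mul /dilate invrK one; last first.
  rewrite enormZ /zeta enormZ /enorm dotp_delta mxE !eqxx sqrtr1.
  rewrite !ger0_norm // mulr1; lra.
rewrite !mxE !eqxx !mulr1 => /esym/(congr1 (@complex.Re R)) /= /eqP.
by rewrite invr_eq0 pnatr_eq0.
Qed.

End littlewood_paley.

(** * Quasi-norms for exponents below one *)

Lemma powR_le1 (R : realType) (a r : R) : 0 <= a -> a <= 1 -> 0 <= r ->
  a `^ r <= 1.
Proof.
by move=> a0 a1 r0; have := ge0_ler_powR r0 a0 ler01 a1; rewrite powR1.
Qed.

Section powR_subadditive.
Context (R : realType) (p : R).
Hypothesis p0 : 0 < p.
Hypothesis p1 : p <= 1.

(** With [s = a + b], the inequality [t / s <= (t / s) `^ p] for [t = a] and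
    [t = b] sums up to [1 <= (a `^ p + b `^ p) / s `^ p]. *)
Lemma powR_subadd (a b : R) : 0 <= a -> 0 <= b ->
  (a + b) `^ p <= a `^ p + b `^ p.
Proof.
move=> a0 b0; have [s0|s0] := eqVneq (a + b) 0.
  by rewrite s0 powR0 ?gt_eqF // addr_ge0 ?powR_ge0.
have sp : 0 < a + b by rewrite lt0r s0 addr_ge0.
have part t : 0 <= t -> t <= a + b -> t / (a + b) * (a + b) `^ p <= t `^ p.
  move=> t0 ts; have [->|tn] := eqVneq t 0; first by rewrite mul0r mul0r powR_ge0.
  rewrite -{2}(divfK s0 t) powRM ?divr_ge0 ?(ltW sp) //.
  rewrite ler_wpM2r ?powR_ge0 // ger1_powR //.
  by apply/andP; split; [rewrite divr_gt0 // lt0r tn|rewrite ler_pdivrMr // mul1r].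
have := lerD (part a a0 _) (part b b0 _).
rewrite lerDl lerDr -!mulrDl divff // mul1r; exact.
Qed.

Lemma powR_sum_le (I : Type) (r : seq I) (a : I -> R) : (forall i, 0 <= a i) ->
  (\sum_(i <- r) a i) `^ p <= \sum_(i <- r) a i `^ p.
Proof.
move=> a0; elim: r => [|i r IH]; first by rewrite !big_nil powR0 ?gt_eqF.
rewrite !big_cons (le_trans (powR_subadd _ _)) ?sumr_ge0 //.
by rewrite lerD2l.
Qed.

End powR_subadditive.

Section quasi_norms.
Context (R : realType) (d : nat).
Notation leb := (@leb R d).
Notation C := R[i].
Variable phi0 : 'rV[R]_d -> C.

Lemma cLnorm_powR (f : 'rV[R]_d -> C) (p : R) : 0 < p -> cmeasurable f ->
  (cLnorm p%:E f `^ p = \int[leb]_x ((cmod (f x)) `^ p)%:E)%E.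
Proof.
move=> p0 mf; rewrite /cLnorm poweR_Lnorm ?gt_eqF // ge0_integral_leb.
- apply: eq_integral => t _.
  by rewrite gee0_abs ?lee_fin ?cmod_ge0 // poweR_EFin.
- exact: measurable_powR_cmod.
- by move=> x; rewrite lee_fin powR_ge0.
Qed.

Definition besov_term p (T : functional R d) k : \bar R :=
  ((2 `^ (k%:R * 1))%:E * cLnorm p%:E (lp_block phi0 T k))%E.

Lemma besov_term_ge0 p T k : (0 <= besov_term p T k)%E.
Proof. by rewrite mule_ge0 ?lee_fin ?powR_ge0 // Lnorm_ge0. Qed.

Lemma besov_term_powR p T k : 0 < p -> cmeasurable (lp_block phi0 T k) ->
  (besov_term p T k `^ p = ((2 ^+ k) `^ p)%:E *
     \int[leb]_x ((cmod (lp_block phi0 T k x)) `^ p)%:E)%E.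
Proof.
move=> p0 mT; rewrite poweRM ?lee_fin ?powR_ge0 ?Lnorm_ge0 //.
by rewrite cLnorm_powR // poweR_EFin mulr1 powR_mulrn.
Qed.

Lemma besov_normE p q T : 0 < q ->
  (besov_norm phi0 1 p%:E q%:E T =
   (\sum_(0 <= k <oo) besov_term p T k `^ q) `^ q^-1)%E.
Proof.
move=> q0; rewrite /besov_norm Lnorm_counting //; congr (_ `^ _)%E.
by apply: eq_eseriesr => k _; rewrite gee0_abs // besov_term_ge0.
Qed.

(** Each term of the Besov sequence is at most one once the quasi-norm is, so
    raising the terms to the power [p >= q] instead of [q] can only decrease
    the sum: this is where the hypothesis [q <= p] enters. *)
Lemma besov_sum_le (p q : R) (T : functional R d) (e : R) : 0 < q -> q <= p -> 0 < e -> e <= 1 ->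
  (forall k, cmeasurable (lp_block phi0 T k)) ->
  (besov_norm phi0 1 p%:E q%:E T < e%:E)%E ->
  (\sum_(0 <= k <oo) (((2 ^+ k) `^ p)%:E *
     \int[leb]_x ((cmod (lp_block phi0 T k x)) `^ p)%:E) <= (e `^ q)%:E)%E.
Proof.
move=> q0 qp e0 e1 mT; have p0 := lt_le_trans q0 qp.
have a0 k := besov_term_ge0 p T k.
have aq k : (0 <= besov_term p T k `^ q)%E by exact: poweR_ge0.
have S0 : (0 <= \sum_(0 <= k <oo) besov_term p T k `^ q)%E.
  by apply: nneseries_ge0.
rewrite besov_normE //.
have [S SE] : exists S, S = (\sum_(0 <= k <oo) besov_term p T k `^ q)%E.
  by eexists.
rewrite -SE in S0 *; move=> Se.
have Seq : (S < (e `^ q)%:E)%E.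
  rewrite ltNge; apply/negP => eS; move: Se; rewrite ltNge => /negP; apply.
  have -> : e%:E = ((e `^ q)%:E `^ q^-1)%E.
    by rewrite poweR_EFin -powRrM divff ?gt_eqF // powRr1 // ltW.
  have qV : 0 <= q^-1 by rewrite invr_ge0 ltW.
  apply: (gt0_ler_poweR qV) => //; rewrite in_itv /= leey andbT //.
  by rewrite lee_fin powR_ge0.
have aS k : (besov_term p T k `^ q <= S)%E.
  rewrite SE.
  apply: (le_trans _ (nneseries_lim_ge k.+1 (fun n _ _ => aq n))).
  rewrite big_nat_recr //= leeDr //.
  by apply: sume_ge0.
have S1 : (S < 1)%E.
  by apply: (lt_le_trans Seq); rewrite lee_fin powR_le1 // ltW.
apply: (le_trans _ (ltW Seq)); rewrite SE.
apply: lee_nneseries => [k _ _|k _].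
  by rewrite mule_ge0 ?lee_fin ?powR_ge0 // integral_ge0 // => x _; rewrite lee_fin powR_ge0.
rewrite -besov_term_powR //.
have := le_lt_trans (aS k) S1.
case: (besov_term p T k) (a0 k) => [a| |] //; last first.
  by rewrite poweRyr ?gt_eqF.
rewrite lee_fin => {}a0; rewrite !poweR_EFin lte_fin lee_fin => aq1.
have [->|an] := eqVneq a 0; first by rewrite !powR0 ?gt_eqF.
apply: ger_powR => //; rewrite lt0r an a0 /= leNgt; apply/negP => a1.
move: aq1; rewrite ltNge => /negP; apply.
by have := ge0_ler_powR (ltW q0) ler01 a0 (ltW a1); rewrite powR1.
Qed.

End quasi_norms.

(** * Regular distributions and the target *)

Section regular.
Context (R : realType) (d : nat).
Notation leb := (@leb R d).
Notation C := R[i].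

Lemma schwartz_bounded (f : 'rV[R]_d -> C) : schwartz f -> cbounded f.
Proof.
move=> sf; have [B hB] := schwartz_pderiv_bounded 0 sf.
exists B => x; move: (hB [::] x isT); rewrite /cpderiv /=.
by case: (f x).
Qed.

Lemma regular_tempered (g : 'rV[R]_d -> C) : cintegrable leb g ->
  tempered (regular_distribution g).
Proof.
move=> ig; have [mg gfin] := ig.
have gi (f : 'rV[R]_d -> C) : schwartz f -> cintegrable leb (fun x => g x * f x).
  move=> sf; have [B hB] := schwartz_bounded sf.
  have mf := schwartz_cmeasurable sf.
  have := cintegrableM mf hB ig.
  by under eq_fun do rewrite mulrC.
split.
  move=> a f1 f2 s1 s2; rewrite /regular_distribution !cintegralE; last 3 first.
  - by case: (gi _ s2).
  - by case: (gi _ s1).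
  - apply: (cmeasurableM mg); apply: cmeasurableD; last exact: schwartz_cmeasurable.
    by apply: cmeasurableM; [exact: cmeasurable_cst|exact: schwartz_cmeasurable].
  rewrite -cintZ; last exact: gi.
  rewrite -cintD; [|by apply: cintegrableZ; exact: gi|exact: gi].
  by congr cint; apply/funext => x; rewrite mulrDr mulrCA.
pose G := fine (\int[leb]_x (cmod (g x))%:E)%E.
have G0 : 0 <= G by rewrite fine_ge0 // integral_ge0.
exists 0, (2 * G) => f sf; rewrite /regular_distribution cintegralE; last first.
  by case: (gi _ sf).
have [B hB] := schwartz_bounded sf.
have fle x : ((cmod (f x))%:E <= schwartz_norm 0 f)%E.
  apply: ereal_sup_ubound; exists [::], x; split => //.
  rewrite expr0 mul1r /cpderiv /=.
  by case: (f x).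
apply: (le_trans (cmod_cint_le (gi _ sf))).
have nfin : schwartz_norm 0 f \is a fin_num.
  rewrite ge0_fin_numE; last exact: le_trans (fle 0).
  by case: sf => _ _; exact.
rewrite -(fineK nfin) EFinM -muleA; apply: lee_wpmul2l => //.
have gfn : (\int[leb]_x (cmod (g x))%:E)%E \is a fin_num.
  by rewrite ge0_fin_numE //; exact: integral_ge0.
rewrite muleC /G (fineK gfn).
rewrite -ge0_integralZl //; last 2 first.
- exact: measurable_ecmod.
- by rewrite lee_fin fine_ge0 //; exact: le_trans (fle 0).
apply: ge0_le_integralT => //.
- by apply: measurable_ecmod; case: (gi _ sf).
- apply: measurable_funeM; exact: measurable_ecmod.
- move=> x; rewrite cmodM mulrC EFinM; apply: lee_wpmul2r => //.
  by rewrite fineK.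
Qed.

Variables (phi0 : 'rV[R]_d -> C).
Hypothesis adm : admissible phi0.
Hypothesis d0 : (0 < d)%N.

Lemma lp_block_regular (f : 'rV[R]_d -> C) k :
  cmeasurable f -> cbounded f ->
  lp_block phi0 (regular_distribution f) k = conv f (lp_kernel phi0 k).
Proof.
move=> mf bf; apply/funext => x.
rewrite /lp_block /regular_distribution cintegralE //.
by case: (conv_integrable x mf bf (lp_kernel_integrable adm d0 k)).
Qed.

Lemma lp_block_regularB (f g : 'rV[R]_d -> C) k :
  cmeasurable f -> cbounded f -> cmeasurable g -> cbounded g ->
  lp_block phi0 (fun a => regular_distribution f a - regular_distribution g a) k =
  conv (fun y => f y - g y) (lp_kernel phi0 k).
Proof.
move=> mf bf mg bg; apply/funext => x.
rewrite convBl //; last exact: lp_kernel_integrable.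
by rewrite -(lp_block_regular k mf bf) -(lp_block_regular k mg bg).
Qed.

Lemma exists_decay_order (p : R) : 0 < p ->
  exists n : nat, (2 * d)%:R <= n%:R * p.
Proof.
move=> p0; have h0 : 0 <= (2 * d)%:R / p by rewrite divr_ge0 // ltW.
exists (Num.bound ((2 * d)%:R / p)).
by rewrite -ler_pdivrMr // ltW // archi_boundP.
Qed.

Lemma target_powR_integrable (p : R) : 0 < p ->
  (\int[leb]_x ((cmod (target phi0 x)) `^ p)%:E < +oo)%E.
Proof.
move=> p0; have [n np] := exists_decay_order p0.
have [c c0 hc] := low_pass_le adm d0 n.
have half0 : 0 < 2^-1 :> R by rewrite invr_gt0.
have A0 : 0 <= c * 2^-1 ^+ d by rewrite mulr_ge0 ?exprn_ge0 // ltW.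
have mw : measurable_fun setT (fun x : 'rV[R]_d => (bracket x ^- (2 * d))%:E).
  by apply/measurable_EFinP; exact: measurable_bracketV.
have w0 (x : 'rV[R]_d) : (0 <= (bracket x ^- (2 * d))%:E :> \bar R)%E.
  by rewrite lee_fin invr_ge0 exprn_ge0 // ltW // bracket_gt0.
have mws : measurable_fun setT (fun x : 'rV[R]_d => (bracket (2^-1 *: x) ^- (2 * d))%:E).
  under eq_fun do rewrite -[_ *: _]addr0.
  exact: (measurableT_comp mw (measurable_affine_row _ _)).
have mt : cmeasurable (target phi0) by case: (target_integrable adm d0).
apply: (@le_lt_trans _ _ (((c * 2^-1 ^+ d) `^ p)%:E *
    \int[leb]_x (bracket (2^-1 *: x) ^- (2 * d))%:E)%E).
  rewrite -ge0_integralZl //; last by rewrite lee_fin powR_ge0.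
  apply: ge0_le_integralT => [x||| x].
  - by rewrite lee_fin powR_ge0.
  - exact: measurable_powR_cmod.
  - exact: measurable_funeM.
  - have b0 := ltW (bracket_gt0 (2^-1 *: x)).
    rewrite -EFinM lee_fin.
    apply: (@le_trans _ _ ((c * 2^-1 ^+ d * bracket (2^-1 *: x) ^- n) `^ p)).
      apply: ge0_ler_powR; rewrite ?nnegrE ?(ltW p0) ?cmod_ge0 //.
      - by rewrite mulr_ge0 // invr_ge0 exprn_ge0.
      - exact: hc.
    rewrite powRM ?invr_ge0 ?exprn_ge0 //; apply: ler_wpM2l; first exact: powR_ge0.
    rewrite -!powR_invn // -powRrM; apply: ler_powR; first exact: bracket_ge1.
    by rewrite mulNr lerN2.
rewrite lte_mul_pinfty ?lee_fin ?powR_ge0 //.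
under eq_integral do rewrite -[_ *: _]addr0.
rewrite (ge0_integral_affine 0 (lt0r_neq0 half0) mw w0).
by rewrite lte_mul_pinfty ?lee_fin ?exprn_ge0 // integral_bracketV.
Qed.

(** All blocks but the first vanish. *)
Lemma target_besov (p q : R) : 0 < p -> 0 < q ->
  besov phi0 1 p%:E q%:E (regular_distribution (target phi0)).
Proof.
move=> p0 q0; have it := target_integrable adm d0; have [mt _] := it.
have bt := target_bounded adm d0.
split; first exact: regular_tempered.
rewrite besov_normE //; apply: poweR_lty.
have tE k x : lp_block phi0 (regular_distribution (target phi0)) k x =
    if k is 0%N then target phi0 x else 0.
  by rewrite lp_block_regular // (conv_target_lp_kernel adm d0).
rewrite nneseries_recl //; last by move=> k _; exact: poweR_ge0.
rewrite eseries0 => [|[|k] // _ _]; last first.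
  rewrite /besov_term (_ : cLnorm _ _ = 0%E) ?mule0 ?poweR0r ?gt_eqF //.
  rewrite /cLnorm -[RHS](Lnorm0 (lebesgue_tuple R d) (p := p%:E)); last first.
    by rewrite eqe gt_eqF.
  by apply: eq_Lnorm => t; rewrite tE cmod0.
rewrite adde0; apply: poweR_lty; apply: lte_mul_pinfty => //.
rewrite (_ : lp_block _ _ _ = target phi0); last by apply/funext => x; rewrite tE.
apply: (@lty_poweRy _ _ p); first by rewrite gt_eqF.
by rewrite cLnorm_powR // target_powR_integrable.
Qed.

End regular.

(** * The lower bound for Haar approximants *)

Section lower_bound.
Context (R : realType) (d : nat) (phi0 : 'rV[R]_d -> R[i]) (p : R).
Notation leb := (@leb R d).
Notation C := R[i].
Hypothesis adm : admissible phi0.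
Hypothesis d0 : (0 < d)%N.
Hypothesis p0 : 0 < p.
Hypothesis p1 : p < 1.
Local Notation lp_kernel_deriv := (lp_kernel_deriv phi0 d0).
Local Notation low_pass_deriv := (low_pass_deriv phi0 d0).
Local Notation target_deriv := (target_deriv phi0 d0).
Local Notation target := (target phi0).

Lemma cboundedB (f g : 'rV[R]_d -> C) :
  cbounded f -> cbounded g -> cbounded (fun y => f y - g y).
Proof.
move=> [B1 h1] [B2 h2]; exists (B1 + B2) => x.
by rewrite (le_trans (cmodB _ _)) // lerD.
Qed.

(** [conv h (lp_kernel k)] is reproduced by [low_pass (2 ^+ k.+1)], and convolution
    with [low_pass_deriv (2 ^+ k.+1)] turns it into
    [conv h (lp_kernel_deriv k)]; the constants of the two kernels do not
    depend on the scale. *)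
Lemma bernstein_lp_block : exists2 P, 0 < P & forall (h : 'rV[R]_d -> C) k,
  cmeasurable h -> cbounded h ->
  (\int[leb]_x ((cmod (conv h (lp_kernel_deriv k) x)) `^ p)%:E <=
   P%:E * (((2 ^+ k) `^ p)%:E *
     \int[leb]_x ((cmod (conv h (lp_kernel phi0 k) x)) `^ p)%:E))%E.
Proof.
have [n np] := exists_decay_order d p0.
have [cA cA0 hA] := low_pass_le adm d0 n.
have [cB cB0 hB] := low_pass_deriv_le adm d0 (n + 2 * d).
exists (peetre_const d p cA cB * 2 `^ p).
  have pid : 0 < pi ^+ d :> R by rewrite exprn_gt0 // pi_gt0.
  have cBp : 0 < 2 * (cB * pi ^+ d) by rewrite !mulr_gt0.
  have cA2 : 0 < 2 * cA by rewrite mulr_gt0.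
  have h2 : 0 < 2 `^ p :> R by rewrite powR_gt0.
  by rewrite /peetre_const; do 3! apply: mulr_gt0 => //; exact: powR_gt0.
move=> h k mh bh; have l0 := pow2_gt0 R k.+1.
have ik := lp_kernel_integrable adm d0 k.
have bk := lp_kernel_bounded adm d0 k.
have iA := low_pass_integrable adm d0 l0.
have iB := low_pass_deriv_integrable adm d0 l0.
have mu_ : cmeasurable (conv h (lp_kernel phi0 k)).
  exact: (cmeasurable_conv mh ik.1).
have bu : cbounded (conv h (lp_kernel phi0 k)) by exact: (conv_bounded mh bh ik).
have uA x : conv h (lp_kernel phi0 k) x =
    conv (low_pass phi0 (2 ^+ k.+1)) (conv h (lp_kernel phi0 k)) x.
  rewrite (conv_swap x mh bh ik bk iA); congr (conv h _ x).
  by apply/funext => y; rewrite (conv_low_pass_lp_kernel adm d0).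
have uB : conv h (lp_kernel_deriv k) =
    conv (low_pass_deriv (2 ^+ k.+1)) (conv h (lp_kernel phi0 k)).
  apply/funext => x; rewrite (conv_swap x mh bh ik bk iB); congr (conv h _ x).
  by apply/funext => y; rewrite (conv_low_pass_deriv_lp_kernel adm d0).
have := integral_conv_powR_le mu_ bu l0 p0 p1 np iA iB cA0 cB0 (hA _ l0) (hB _ l0) uA.
rewrite -uB => /le_trans; apply.
have -> : (2 ^+ k.+1) `^ p = 2 `^ p * (2 ^+ k) `^ p :> R.
  by rewrite exprS powRM // exprn_ge0.
by rewrite mulrA EFinM muleA.
Qed.

Lemma cint_low_pass_deriv lam : 0 < lam -> cint leb (low_pass_deriv lam) = 0.
Proof.
move=> l0; have := low_pass_deriv_transform adm d0 (0 : 'rV[R]_d) l0.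
have -> : coord_mul (Ordinal d0) (dilate lam phi0) 0 = 0.
  by rewrite /coord_mul mxE mul0r.
move=> <-; congr cint; apply/funext => x.
by rewrite -[X in dotp x X](scale0r (0 : 'rV[R]_d)) dotpZr mul0r oppr0 cis0 mulr1.
Qed.

(** The distributional derivative of a Haar sum is carried by finitely many
    hyperplanes: its mollifications tend to 0 at all other points. *)
Lemma ae_conv_haar_vanish (g : 'rV[R]_d -> C) : haar_span g ->
  {ae leb, forall x : 'rV[R]_d, exists M, forall K,
    cmod (conv g (low_pass_deriv (2 ^+ K)) x) <= M / 2 ^+ K}.
Proof.
move=> /haar_spanP[mg bg]; apply: filterS => x gx.
have [c c0 hc] := low_pass_deriv_le adm d0 (2 * d + d.+2).
have [M hM] := conv_locally_constant mg bg gx c0.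
exists M => K; have l0 := pow2_gt0 R K.
apply: hM; first by rewrite exprn_ege1 // ler1n.
- exact: low_pass_deriv_integrable.
- exact: cint_low_pass_deriv.
- exact: hc.
Qed.

Lemma exists_pow2_le (M e : R) : 0 < e -> exists K : nat, M / 2 ^+ K <= e.
Proof.
move=> e0; pose K := Num.bound (`|M| / e); exists K.
have h0 : 0 <= `|M| / e by rewrite divr_ge0 // ltW.
have hK : K%:R <= 2 ^+ K :> R by rewrite -natrX ler_nat ltnW // ltn_expl.
rewrite ler_pdivrMr ?pow2_gt0 // mulrC -ler_pdivrMr //.
apply: (le_trans _ (le_trans (ltW (archi_boundP h0)) hK)).
by rewrite ler_pM2r ?invr_gt0 // ler_norm.
Qed.

(** The first [K.+1] terms [v k] add up to [target_deriv x] minus a mollified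
    derivative of [g], which tends to 0; then the [p]-th power is
    subadditive. *)
Lemma ae_target_deriv_le (g : 'rV[R]_d -> C) : haar_span g ->
  {ae leb, forall x : 'rV[R]_d, (((cmod (target_deriv x)) `^ p)%:E <=
    \sum_(0 <= k <oo)
      ((cmod (conv (fun y => target y - g y) (lp_kernel_deriv k) x)) `^ p)%:E)%E}.
Proof.
move=> hg; have [mg bg _] := haar_spanP hg.
have [mt _] := target_integrable adm d0; have bt := target_bounded adm d0.
have mh : cmeasurable (fun y => target y - g y) by exact: cmeasurableB.
have bh := cboundedB bt bg.
apply: filterS (ae_conv_haar_vanish hg) => x [M hM].
set v := fun k => conv (fun y => target y - g y) (lp_kernel_deriv k) x.
have v0 k : (0 <= ((cmod (v k)) `^ p)%:E :> \bar R)%E by rewrite lee_fin powR_ge0.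
apply/lee_addgt0Pr => e e0.
(* [K] makes the [p]-th power of the remaining term at most [e]. *)
have pV : 0 < e `^ p^-1 by rewrite powR_gt0.
have [K hK] := exists_pow2_le M pV.
have iB := low_pass_deriv_integrable adm d0 (pow2_gt0 R K).
have -> : target_deriv x = \sum_(k < K.+1) v k + conv g (low_pass_deriv (2 ^+ K)) x.
  rewrite (sum_conv_lp_kernel_deriv adm d0 x K mh bh) (convBl x mt bt mg bg iB).
  by rewrite (conv_target_low_pass_deriv adm d0) subrK.
have MK0 : 0 <= M / 2 ^+ K by exact: le_trans (cmod_ge0 _) (hM K).
have S0 : 0 <= \sum_(k < K.+1) cmod (v k).
  by apply: sumr_ge0 => i _; exact: cmod_ge0.
apply: (@le_trans _ _ (\sum_(k < K.+1) (cmod (v k)) `^ p + e)%:E).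
  rewrite lee_fin; apply: (@le_trans _ _
    ((\sum_(k < K.+1) cmod (v k) + M / 2 ^+ K) `^ p)).
    apply: ge0_ler_powR; rewrite ?nnegrE ?(ltW p0) ?cmod_ge0 //.
    - exact: addr_ge0.
    - by rewrite (le_trans (cmodD _ _)) // lerD // cmod_sum.
  apply: (le_trans (powR_subadd p0 (ltW p1) S0 MK0)).
  apply: lerD.
    by apply: powR_sum_le => [||i]; [exact: p0|exact: ltW|exact: cmod_ge0].
  have := ge0_ler_powR (ltW p0) MK0 (ltW pV) hK.
  by rewrite -powRrM mulVf ?gt_eqF // powRr1 // ltW.
rewrite EFinD; apply: leeD => //.
rewrite -sumEFin -(big_mkord xpredT (fun k => ((cmod (v k)) `^ p)%:E)).
exact: nneseries_lim_ge.
Qed.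

(** The constant [P] is independent of [g]: the integral on the left is a fixed
    positive number, while the sum on the right is the [p]-th power of a Besov
    quasi-norm of [target - g], with both exponents equal to [p]. *)
Lemma target_deriv_integral_le : exists2 P, 0 < P &
  forall g : 'rV[R]_d -> C, haar_span g ->
  (\int[leb]_x ((cmod (target_deriv x)) `^ p)%:E <=
   P%:E * \sum_(0 <= k <oo) (((2 ^+ k) `^ p)%:E *
     \int[leb]_x
       ((cmod (conv (fun y => target y - g y) (lp_kernel phi0 k) x)) `^ p)%:E))%E.
Proof.
have [P P0 hP] := bernstein_lp_block; exists P => // g hg.
have [mg bg _] := haar_spanP hg.
have [mt _] := target_integrable adm d0; have bt := target_bounded adm d0.
have mh : cmeasurable (fun y => target y - g y) by exact: cmeasurableB.
have bh := cboundedB bt bg.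
move: (ae_target_deriv_le hg) mh bh.
move: (fun y => target y - g y) => h ae_le mh bh.
have mv k : measurable_fun setT
    (fun x => ((cmod (conv h (lp_kernel_deriv k) x)) `^ p)%:E).
  apply: measurable_powR_cmod; apply: (cmeasurable_conv mh).
  exact: (lp_kernel_deriv_integrable adm d0 k).1.
have v0 k x : (0 <= ((cmod (conv h (lp_kernel_deriv k) x)) `^ p)%:E :> \bar R)%E.
  by rewrite lee_fin powR_ge0.
apply: (@le_trans _ _ (\int[leb]_x \sum_(0 <= k <oo)
    ((cmod (conv h (lp_kernel_deriv k) x)) `^ p)%:E)%E).
  apply: ae_ge0_le_integral.
  - exact: measurableT.
  - by move=> x _; rewrite lee_fin powR_ge0.
  - apply: measurable_powR_cmod; apply: (low_pass_deriv_integrable adm d0 _).1.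
    by rewrite invr_gt0.
  - by move=> x _; apply: nneseries_ge0 => k _ _; exact: v0.
  - apply: ge0_emeasurable_sum => k; first by move=> x _ _; exact: v0.
    by move=> _; exact: mv.
  - by apply: filterS ae_le => x h1 _.
rewrite (integral_nneseries leb measurableT mv); last by move=> k x _; exact: v0.
rewrite -nneseriesZl; last first.
  move=> k _; apply: mule_ge0; first by rewrite lee_fin powR_ge0.
  by apply: integral_ge0 => x _; rewrite lee_fin powR_ge0.
apply: lee_nneseries => [k _ _|k _].
  by apply: integral_ge0 => x _; exact: v0.
exact: hP.
Qed.

End lower_bound.

(** * Non-density *)

Theorem corollary8p4 (R : realType) (d : nat) (p q : R)
    (phi0 : 'rV[R]_d -> R[i]) :
  (1 <= d)%N -> d%:R / (d%:R + 1) <= p -> p < 1 -> 0 < q -> q <= p ->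
  admissible phi0 ->
  ~ dense_in_besov phi0 1 p%:E q%:E (@haar_span R d).
Proof.
move=> d0 _ p1 q0 qp adm dense; have p0 := lt_le_trans q0 qp.
have [P P0 hP] := target_deriv_integral_le adm d0 p0 p1.
have [mt _] := target_integrable adm d0; have bt := target_bounded adm d0.
have := target_deriv_neq0 adm d0 p0; apply/negP; rewrite -leNgt.
apply/lee_addgt0Pr => e e0; rewrite add0e.
(* The distance [r] makes [P * r `^ q <= e]. *)
pose r := Num.min 1 ((e / P) `^ q^-1).
have eP : 0 < e / P by rewrite divr_gt0.
have r0 : 0 < r by rewrite lt_min ltr01 powR_gt0.
have r1 : r <= 1 by rewrite ge_min lexx.
have rq : r `^ q <= e / P.
  have rle : r <= (e / P) `^ q^-1 by rewrite ge_min lexx orbT.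
  have := ge0_ler_powR (ltW q0) (ltW r0) (powR_ge0 _ _) rle.
  by rewrite -powRrM mulVf ?gt_eqF // powRr1 // ltW.
have [g hg gr] := dense _ (target_besov adm d0 p0 q0) r r0.
have [mg bg _] := haar_spanP hg.
have blockE k := lp_block_regularB adm d0 k mt bt mg bg.
have mblock k : cmeasurable (lp_block phi0 (fun a =>
    regular_distribution (target phi0) a - regular_distribution g a) k).
  rewrite blockE; apply: cmeasurable_conv; first exact: cmeasurableB.
  exact: (lp_kernel_integrable adm d0 k).1.
have := besov_sum_le q0 qp r0 r1 mblock gr.
under eq_eseriesr do rewrite blockE.
move=> small; apply: (le_trans (hP g hg)).
apply: (le_trans (lee_wpmul2l (ltW P0 : (0 <= P%:E)%E) small)).
by rewrite -EFinM lee_fin mulrC -ler_pdivlMr.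
Qed.
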